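(* Let $0<p,q<\infty$ and $\psi\in\mathcal{SR}(\mathbb H)$. Fix $I,J\in\mathbb S$ with $J\perp I$, and write $\psi_I=P+QJ$ with $P,Q:\mathbb C_I\to\mathbb C_I$ entire and $Q\not\equiv0$. Put $\Delta:=(P-P^\#)^2-4QQ^\#$ and, for $w\in\mathbb C_I$, $$\mathcal B_{\psi,I}(w):=\int_{\mathbb C_I}\left|(k_w\bullet\psi)_I(z)\right|^q e^{-\frac{\alpha q}{2}|z|^2}\,dm_{2,I}(z).$$ Suppose that either $\sup_{w\in\mathbb C_I}\mathcal B_{\psi,I}(w)<\infty$, or $0<q<p$ and, with $s=p/(p-q)$, $\int_{\mathbb C_I}\mathcal B_{\psi,I}(w)^s\,dm_{2,I}(w)<\infty$. Suppose moreover that $\Delta$ has no zeros on $\mathbb C_I$. Then there exist $a,b\in\mathbb R$, $c>0$, and an entire function $h:\mathbb C_I\to\mathbb C_I$ with $h^\#=h$, such that $$P(z)=az+b+Ih(z),\qquad QQ^\#=c^2-h^2,\qquad |a|\le1.$$ Equivalently, $\psi_I(z)=az+b+Ih(z)+Q(z)J$ (with the same conditions on $a$, $b$, $c$, $h$, $Q$). If, in addition, $P^\#=P$, then $h\equiv0$, and hence $QQ^\#=c^2$. Consequently, $Q=c\,e^{I\ell}$ for some entire function $\ell:\mathbb C_I\to\mathbb C_I$ satisfying $\ell^\#=\ell$.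
   Context: $\mathbb H$ denotes the quaternions, $\mathbb S=\{I\in\mathbb H: I^2=-1\}$, and for $I\in\mathbb S$, $\mathbb C_I=\{x+yI: x,y\in\mathbb R\}$. $J\perp I$ means orthogonality of imaginary units (so $IJ=-JI$). A real differentiable $f:\mathbb H\to\mathbb H$ is slice regular if for every $I\in\mathbb S$ the restriction $f_I:=f|_{\mathbb C_I}$ satisfies $\frac12(\partial_x+I\partial_y)f_I(x+yI)=0$; $\mathcal{SR}(\mathbb H)$ is the class of such functions. For $J\perp I$, each $f\in\mathcal{SR}(\mathbb H)$ splits uniquely as $f_I=F+GJ$ with $F,G:\mathbb C_I\to\mathbb C_I$ entire. Every $f\in\mathcal{SR}(\mathbb H)$ has a power series $f(\xi)=\sum_{n\ge0}\xi^na_n$, $a_n\in\mathbb H$. For $f=\sum\xi^na_n$, $g=\sum\xi^nb_n$ the $\star$-product is $(f\star g)(\xi)=\sum_n\xi^n\sum_{k=0}^na_kb_{n-k}$. The slice regular composition is $(f\bullet\psi)(\xi)=\sum_{n\ge0}\psi^{\star n}(\xi)a_n$, where $\psi^{\star n}$ is the $n$-th $\star$-power and $\psi^{\star0}\equiv1$. For holomorphic $D$ on $\mathbb C_I$, $D^\#(z)=\overline{D(\overline z)}$. Fix $\alpha>0$; $dm_{2,I}$ is planar Lebesgue measure on $\mathbb C_I$; for $w\in\mathbb C_I$, $k_w(z)=e^{-\frac\alpha2|w|^2}\sum_{n\ge0}\frac{\alpha^nz^n\overline w^{\,n}}{n!}$. *)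

(* Defs.v *)
From HB Require Import structures.
From mathcomp Require Import all_boot all_order all_algebra.
From mathcomp Require Import complex.
From mathcomp Require Import all_classical all_reals all_analysis.
From mathcomp Require Import ring.

Set Implicit Arguments.
Unset Strict Implicit.
Unset Printing Implicit Defensive.

Import Order.TTheory GRing.Theory Num.Theory.
Import numFieldNormedType.Exports.

Local Open Scope classical_set_scope.
Local Open Scope ring_scope.
Local Open Scope complex_scope.

(* ((a, b), (c, d)) stands for a + b i + c j + d k.  The alias inherits the
   real normed module structure of the product (whose norm `|.| is the sup
   norm: the Euclidean modulus is [qabs] below), but its multiplication is the
   Hamilton product, not the componentwise one. *)
Definition quat (R : realType) : Type := ((R * R) * (R * R))%type.

HB.instance Definition _ (R : realType) :=
  NormedModule.copy (quat R) ((R * R) * (R * R))%type.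

Definition qone (R : realType) : quat R := ((1, 0), (0, 0)).

Definition qmul (R : realType) (x y : quat R) : quat R :=
  let: ((a, b), (c, d)) := x in
  let: ((a', b'), (c', d')) := y in
  ((a * a' - b * b' - c * c' - d * d', a * b' + b * a' + c * d' - d * c'),
   (a * c' - b * d' + c * a' + d * b', a * d' + b * c' - c * b' + d * a')).

Lemma qmulA (R : realType) : associative (@qmul R).
Proof.
move=> [[a b] [c d]] [[a' b'] [c' d']] [[a'' b''] [c'' d'']] /=.
by congr ((_, _), (_, _)); ring.
Qed.

Lemma qmul1q (R : realType) : left_id (qone R) (@qmul R).
Proof. by move=> [[a b] [c d]] /=; congr ((_, _), (_, _)); ring. Qed.

Lemma qmulq1 (R : realType) : right_id (qone R) (@qmul R).
Proof. by move=> [[a b] [c d]] /=; congr ((_, _), (_, _)); ring. Qed.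

Lemma qmulDl (R : realType) : left_distributive (@qmul R) +%R.
Proof.
move=> [[a b] [c d]] [[a' b'] [c' d']] [[a'' b''] [c'' d'']].
by apply/eqP; rewrite /eq_op /= /eq_op /=; apply/andP; split;
  apply/andP; split; apply/eqP => /=; ring.
Qed.

Lemma qmulDr (R : realType) : right_distributive (@qmul R) +%R.
Proof.
move=> [[a b] [c d]] [[a' b'] [c' d']] [[a'' b''] [c'' d'']].
by apply/eqP; rewrite /eq_op /= /eq_op /=; apply/andP; split;
  apply/andP; split; apply/eqP => /=; ring.
Qed.

Lemma qone_neq0 (R : realType) : qone R != 0 :> quat R.
Proof. by apply/eqP => -[] /eqP; rewrite oner_eq0. Qed.

HB.instance Definition _ (R : realType) :=
  GRing.Zmodule_isNzRing.Build (quat R)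
    (@qmulA R) (@qmul1q R) (@qmulq1 R) (@qmulDl R) (@qmulDr R) (@qone_neq0 R).

Section Quaternions.
Variable R : realType.

Definition qconj (x : quat R) : quat R :=
  ((x.1.1, - x.1.2), (- x.2.1, - x.2.2)).

Definition qdot (x y : quat R) : R :=
  x.1.1 * y.1.1 + x.1.2 * y.1.2 + x.2.1 * y.2.1 + x.2.2 * y.2.2.

Definition qabs (x : quat R) : R := Num.sqrt (qdot x x).

Definition imag_units : set (quat R) := [set I | I * I = - 1].

Definition perp (I J : quat R) : Prop := qdot I J = 0.

(* The isomorphism x + iy |-> x + y I from R[i] onto C_I.  Functions
   C_I -> C_I are represented by functions R[i] -> R[i] through it. *)
Definition emb (I : quat R) (z : R[i]) : quat R :=
  complex.Re z *: (1 : quat R) + complex.Im z *: I.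

Definition slice (I : quat R) : set (quat R) := range (emb I).

Definition slice_regular (f : quat R -> quat R) : Prop :=
  (forall x, differentiable f x) /\
  (forall I, imag_units I -> forall x y : R,
    2^-1 *: (derive1 (fun t : R => f (emb I (t +i* y))) x
             + I * derive1 (fun t : R => f (emb I (x +i* t))) y) = 0).

Definition is_qpseries (a : nat -> quat R) (f : quat R -> quat R) : Prop :=
  forall xi : quat R,
    (fun N => \sum_(0 <= n < N) xi ^+ n * a n) @ \oo --> f xi.

(* The coefficients of the power series of f (unique when they exist). *)
Definition qcoef (f : quat R -> quat R) : nat -> quat R :=
  xget (fun=> 0) [set a | is_qpseries a f].

Definition qstar (f g : quat R -> quat R) (xi : quat R) : quat R :=
  \big[+%R/0]_(0 <= n <oo)
    (xi ^+ n * \sum_(k < n.+1) qcoef f k * qcoef g (n - k)).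

Definition qstar_pow (f : quat R -> quat R) (n : nat) : quat R -> quat R :=
  iter n (qstar f) (fun=> 1).

Definition qcomp (f psi : quat R -> quat R) (xi : quat R) : quat R :=
  \big[+%R/0]_(0 <= n <oo)
    (qstar_pow psi n xi * qcoef f n).

(* k_w, extended from C_I to a slice regular function on the quaternions. *)
Definition fock_kernel (alpha : R) (w xi : quat R) : quat R :=
  expR (- (alpha / 2) * qabs w ^+ 2) *:
  \big[+%R/0]_(0 <= n <oo)
    ((alpha ^+ n / n`!%:R) *: (xi ^+ n * qconj w ^+ n)).

(* Integration over C_I against planar Lebesgue measure, in the coordinates
   (x, y) of x + y I. *)
Definition slice_integral (I : quat R) (g : quat R -> \bar R) : \bar R :=
  (\int[(@lebesgue_measure R \x @lebesgue_measure R)%E]_(v in [set: R * R])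
     g (emb I (v.1 +i* v.2)))%E.

Definition calB (alpha q : R) (psi : quat R -> quat R) (I w : quat R) : \bar R :=
  slice_integral I (fun z =>
    (qabs (qcomp (fock_kernel alpha w) psi z) `^ q
     * expR (- (alpha * q / 2) * qabs z ^+ 2))%:E).

Definition entire (F : R[i] -> R[i]) : Prop :=
  forall z : R[i], derivable (F : R[i]^o -> R[i]^o) z 1.

Definition sharp (F : R[i] -> R[i]) : R[i] -> R[i] :=
  fun z => conjc (F (conjc z)).

Definition Delta (P Q : R[i] -> R[i]) (z : R[i]) : R[i] :=
  (P z - sharp P z) ^+ 2 - 4 * (Q z * sharp Q z).

Definition cexp (z : R[i]) : R[i] :=
  (expR (complex.Re z))%:C * (cos (complex.Im z) +i* sin (complex.Im z)).

End Quaternions.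

(* Main.v *)
(* On C_I, left star multiplication by psi acts as the matrix ((P, Q), (- Q#, P#)), whose
   eigenvalues l1, l2 have sum P + P# and discriminant Delta.  As Delta has no zeros,
   Delta = d^2 with d = l1 - l2 entire and l1, l2 are entire; the J-component of (k_w o psi)_I is
   e^(- alpha |w|^2 / 2) Q (e^(alpha w l1) - e^(alpha w l2)) / d.
   The sub-mean value property (applied in z, and in the L^s case once more in w) bounds it by
   C e^(alpha |z|^2 / 2), uniformly in z and w.  Taking for w the conjugate of the larger eigenvalue yields,
   for every beta < alpha / 2 and T = (P + P#) / 2,
     |Q d| e^(beta (|T|^2 + |d|^2 / 4)) <= C' e^(alpha |z|^2 / 2).
   Jensen's inequality for Q d then controls the quadratic means of T and d on circles, so that
   T and d are affine and the slope of T has modulus at most 1.  Being zero free, d is constant;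
   evaluating Delta on the real line gives Delta = - 4 c^2, and h = (P - P#) / (2 i). *)

Require Import Defs.
From HB Require Import structures.
From mathcomp Require Import all_boot all_order all_algebra.
From mathcomp Require Import complex.
From mathcomp Require Import all_classical all_reals all_analysis.
From mathcomp Require Import measurable_realfun.
From mathcomp Require Import ring lra.
Import Order.TTheory GRing.Theory Num.Theory.
Import numFieldNormedType.Exports.
Set Implicit Arguments.
Unset Strict Implicit.
Unset Printing Implicit Defensive.
Local Open Scope classical_set_scope.
Local Open Scope ring_scope.
Local Open Scope complex_scope.

(** * Complex differentiability *)

(** The hypothesis concerns integrals of q-th powers for any q > 0, of an integrand that is itself a
    limit of star powers. Only a pointwise lower bound on it is used: the C_I-component of (k_w o
    psi)_I is discarded, and what remains is, up to Gaussian factors, the modulus of a function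
    entire in z and in w. The sub-mean value property is therefore shown in a weak form, with an
    unspecified constant, from a square on which an entire function stays large; this works for
    every exponent and rests only on monotonicity of the integral. That Delta has no zeros serves
    twice: it makes the eigenvalues entire with nowhere vanishing difference, and it turns an affine
    d into a constant. The strict inequality beta < alpha / 2 pays for a factor 1 + 2 alpha |l|^2
    lost in comparing the two exponentials; the squared slope of T is at most alpha / (2 beta) for
    each such beta, and beta close to alpha / 2 gives |a| <= 1. Jensen's inequality appears in a
    discrete form, with products over roots of unity in place of integrals of log |W|. Constants
    such as 40 and 41 are far from sharp: only the logarithm of the latter enters the growth
    estimate. *)

Section Modulus.
Variable R : realType.
Implicit Types (z w : R[i]) (x y : R).

(** The norm [|z|] of [R[i]] is an element of [R[i]]. This is the same modulus with values in [R],
    where real inequalities can be combined. *)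
Definition cmod z : R := Num.sqrt (complex.Re z ^+ 2 + complex.Im z ^+ 2).

Lemma cmodE z : `|z| = (cmod z)%:C.
Proof. exact: normc_def. Qed.

Lemma cmodZ (r : R) z : `|z| = r%:C -> cmod z = r.
Proof. by rewrite cmodE => -[]. Qed.

Lemma cmod_ge0 z : 0 <= cmod z. Proof. exact: sqrtr_ge0. Qed.
Lemma cmodM z w : cmod (z * w) = cmod z * cmod w.
Proof. by apply: cmodZ; rewrite normrM !cmodE -rmorphM. Qed.
Lemma cmodV z : cmod z^-1 = (cmod z)^-1.
Proof. by apply: cmodZ; rewrite normfV !cmodE -fmorphV. Qed.
Lemma cmodf z w : cmod (z / w) = cmod z / cmod w.
Proof. by rewrite cmodM cmodV. Qed.
Lemma cmodX z n : cmod (z ^+ n) = cmod z ^+ n.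
Proof. by apply: cmodZ; rewrite normrX !cmodE -rmorphXn. Qed.
Lemma cmod0 : cmod 0 = 0. Proof. by apply: cmodZ; rewrite normr0. Qed.
Lemma cmod1 : cmod 1 = 1. Proof. by apply: cmodZ; rewrite normr1. Qed.
Lemma cmodN z : cmod (- z) = cmod z.
Proof. by apply: cmodZ; rewrite normrN cmodE. Qed.
Lemma cmodB z w : cmod (z - w) = cmod (w - z).
Proof. by rewrite -cmodN opprB. Qed.
Lemma cmodD z w : cmod (z + w) <= cmod z + cmod w.
Proof. by rewrite -lecR rmorphD /= -!cmodE; exact: ler_normD. Qed.
Lemma cmodBD z w : cmod (z - w) <= cmod z + cmod w.
Proof. by rewrite -(cmodN w); exact: cmodD. Qed.
Lemma cmod_dist z w : cmod z - cmod w <= cmod (z - w).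
Proof. by rewrite lerBlDr; have := cmodD (z - w) w; rewrite subrK. Qed.
Lemma cmod_sum (I : Type) (s : seq I) (P : pred I) (F : I -> R[i]) :
  cmod (\sum_(i <- s | P i) F i) <= \sum_(i <- s | P i) cmod (F i).
Proof.
elim/big_rec2 : _ => [|i y1 y2 _ h]; first by rewrite cmod0.
by apply: le_trans (cmodD _ _) _; rewrite lerD2l.
Qed.
Lemma cmod_prod (I : Type) (s : seq I) (P : pred I) (F : I -> R[i]) :
  cmod (\prod_(i <- s | P i) F i) = \prod_(i <- s | P i) cmod (F i).
Proof. by elim/big_rec2 : _ => [|i y1 y2 _ <-]; rewrite ?cmod1 ?cmodM. Qed.
Lemma cmod_eq0 z : (cmod z == 0) = (z == 0).
Proof. by rewrite -(normr_eq0 z) cmodE -(inj_eq (@complexI R)). Qed.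
Lemma cmod_gt0 z : (0 < cmod z) = (z != 0).
Proof. by rewrite lt0r cmod_eq0 cmod_ge0 andbT. Qed.
Lemma cmodC x : cmod x%:C = `|x|.
Proof. by rewrite /cmod /= expr0n addr0 sqrtr_sqr. Qed.
Lemma cmodn n : cmod n%:R = n%:R.
Proof. by rewrite -(rmorph_nat (real_complex R)) cmodC normr_nat. Qed.
Lemma cmodi : cmod 'i = 1.
Proof. by rewrite /cmod /= expr0n add0r expr1n sqrtr1. Qed.
Lemma cmod_conj z : cmod (conjc z) = cmod z.
Proof. by case: z => a b; rewrite /cmod /= sqrrN. Qed.
Lemma sqr_cmod z : cmod z ^+ 2 = complex.Re z ^+ 2 + complex.Im z ^+ 2.
Proof. by rewrite sqr_sqrtr// addr_ge0// sqr_ge0. Qed.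
Lemma mul_conjc z : z * conjc z = (cmod z ^+ 2)%:C.
Proof.
by case: z => a b; rewrite sqr_cmod /=; apply/eqP; rewrite eq_complex /=;
  apply/andP; split; apply/eqP; ring.
Qed.
Lemma Re_le_cmod z : `|complex.Re z| <= cmod z.
Proof.
by rewrite -sqrtr_sqr ler_sqrt ?addr_ge0 ?sqr_ge0 // lerDl sqr_ge0.
Qed.
Lemma Im_le_cmod z : `|complex.Im z| <= cmod z.
Proof.
by rewrite -sqrtr_sqr ler_sqrt ?addr_ge0 ?sqr_ge0 // lerDr sqr_ge0.
Qed.
Lemma cmod_leD z : cmod z <= `|complex.Re z| + `|complex.Im z|.
Proof.
case: z => a b; have -> : a +i* b = a%:C + 'i * b%:C :> R[i].
  by apply/eqP; rewrite eq_complex /=; apply/andP; split; apply/eqP; ring.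
apply: le_trans (cmodD _ _) _; rewrite cmodM cmodi mul1r !cmodC /=.
by rewrite !(mul0r, mul1r, addr0, subr0, mulr0, add0r).
Qed.
Lemma cReD z w : complex.Re (z + w) = complex.Re z + complex.Re w.
Proof. by case: z; case: w. Qed.
Lemma cImD z w : complex.Im (z + w) = complex.Im z + complex.Im w.
Proof. by case: z; case: w. Qed.
Lemma cReN z : complex.Re (- z) = - complex.Re z. Proof. by case: z. Qed.
Lemma cImN z : complex.Im (- z) = - complex.Im z. Proof. by case: z. Qed.
Lemma cReM z w : complex.Re (z * w) =
  complex.Re z * complex.Re w - complex.Im z * complex.Im w.
Proof. by case: z; case: w. Qed.
Lemma cImM z w : complex.Im (z * w) =
  complex.Re z * complex.Im w + complex.Im z * complex.Re w.
Proof. by case: z => a b; case: w => c d /=; ring. Qed.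
Lemma cRe_conj z : complex.Re (conjc z) = complex.Re z. Proof. by case: z. Qed.
Lemma cIm_conj z : complex.Im (conjc z) = - complex.Im z. Proof. by case: z. Qed.
Lemma complex_eq z w :
  complex.Re z = complex.Re w -> complex.Im z = complex.Im w -> z = w.
Proof. by case: z => a b; case: w => c d /= -> ->. Qed.

End Modulus.

(** * Complex derivatives by real estimates, and closure properties of entire functions *)

Section ComplexDerivative.
Variable R : realType.
Implicit Types (F G : R[i] -> R[i]) (z w D : R[i]).

(** The first-order expansion in multiplied-out form: the point w = z needs no separate treatment.
    [entireP] relates it to [derivable]. *)
Definition cder F z D : Prop := forall e : R, 0 < e -> exists2 d : R, 0 < d &
  forall w, cmod (w - z) < d -> cmod (F w - F z - D * (w - z)) <= e * cmod (w - z).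

Definition ccont F z : Prop := forall e : R, 0 < e -> exists2 d : R, 0 < d &
  forall w, cmod (w - z) < d -> cmod (F w - F z) < e.

Lemma derivable_cder F z : derivable (F : R[i]^o -> R[i]^o) z 1 -> exists D, cder F z D.
Proof.
move=> /cvg_ex [D /= /cvgrPdist_le hD]; exists D => e e0.
have /hD : 0 < e%:C by rewrite ltcR.
rewrite near_withinE => /nbhs_ballP[d /= d0 hd].
have dE : d = (complex.Re d)%:C by rewrite RRe_real // gtr0_real.
exists (complex.Re d); first by rewrite dE ltcR in d0.
move=> w wz; have [->|wz0] := eqVneq w z.
  by rewrite !subrr mulr0 subr0 cmod0 mulr0.
have w0 : w - z != 0 by rewrite subr_eq0.
have := hd (w - z); rewrite /ball /= sub0r normrN cmodE dE ltcR => /(_ wz w0).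
rewrite /GRing.scale /= mulr1 subrK cmodE lecR => h.
have -> : F w - F z - D * (w - z) = - (D - (w - z)^-1 * (F w - F z)) * (w - z).
  by rewrite opprB mulrBl mulrAC mulVf // mul1r.
by rewrite cmodM cmodN ler_wpM2r // cmod_ge0.
Qed.

Lemma cder_derivable F z D : cder F z D -> derivable (F : R[i]^o -> R[i]^o) z 1.
Proof.
move=> hD; apply/cvg_ex; exists D; apply/cvgrPdist_le => /= e e0.
have eE : e = (complex.Re e)%:C by rewrite RRe_real // gtr0_real.
have [|d d0 hd] := hD (complex.Re e); first by rewrite eE ltcR in e0.
rewrite near_withinE; apply/nbhs_ballP; exists d%:C => /=; first by rewrite ltcR.
move=> h; rewrite /ball /= sub0r normrN cmodE ltcR => hd' h0.
have := hd (h + z); rewrite addrK => /(_ hd') H.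
rewrite /GRing.scale /= mulr1 cmodE eE lecR.
have -> : D - h^-1 * (F (h + z) - F z) = - (F (h + z) - F z - D * h) / h.
  by rewrite opprB mulrBl mulfK // mulrC [_ / h]mulrC.
by rewrite cmodf cmodN ler_pdivrMr // cmod_gt0.
Qed.

Lemma entireP F : entire F <-> forall z, exists D, cder F z D.
Proof.
split=> h z; first exact/derivable_cder/h.
by have [D /cder_derivable] := h z.
Qed.

Lemma cder_cont F z D : cder F z D -> ccont F z.
Proof.
move=> hD e e0; have [d d0 hd] := hD 1 ltr01.
have K0 : 0 < 1 + cmod D by rewrite ltr_pwDl // cmod_ge0.
exists (Num.min d (e / (1 + cmod D))); first by rewrite lt_min d0 divr_gt0.
move=> w; rewrite lt_min => /andP[/hd h1]; rewrite ltr_pdivlMr // => h2.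
apply: le_lt_trans h2; rewrite mulrDr mulr1.
have -> : F w - F z = (F w - F z - D * (w - z)) + D * (w - z) by rewrite subrK.
apply: le_trans (cmodD _ _) _; rewrite [cmod (D * _)]cmodM lerD //.
  by rewrite -[leRHS]mul1r.
by rewrite mulrC.
Qed.

Lemma cder_eq F G z D d : 0 < d -> (forall w, cmod (w - z) < d -> F w = G w) ->
  cder F z D -> cder G z D.
Proof.
move=> d0 FG hF e e0; have [d' d'0 h] := hF e e0.
exists (Num.min d d'); first by rewrite lt_min d0.
move=> w; rewrite lt_min => /andP[wd wd']; rewrite -!FG ?h ?subrr ?cmod0 //.
Qed.

Lemma cder_cst c z : cder (fun=> c) z 0.
Proof.
by move=> e e0; exists 1 => // w _; rewrite subrr mul0r subr0 cmod0 mulr_ge0 ?cmod_ge0 // ltW.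
Qed.

Lemma cder_id z : cder id z 1.
Proof.
by move=> e e0; exists 1 => // w _; rewrite mul1r subrr cmod0 mulr_ge0 ?cmod_ge0 // ltW.
Qed.

Lemma cderD F G z D E : cder F z D -> cder G z E -> cder (fun w => F w + G w) z (D + E).
Proof.
move=> hF hG e e0; have e20 : 0 < e / 2 by rewrite divr_gt0.
have [d d0 hd] := hF _ e20; have [d' d'0 hd'] := hG _ e20.
exists (Num.min d d'); first by rewrite lt_min d0.
move=> w; rewrite lt_min => /andP[/hd h1 /hd' h2].
have -> : F w + G w - (F z + G z) - (D + E) * (w - z) =
  (F w - F z - D * (w - z)) + (G w - G z - E * (w - z)) by ring.
by apply: le_trans (cmodD _ _) _; rewrite [e]splitr mulrDl lerD.
Qed.

Lemma cder_comp F G z D E : cder G z E -> cder F (G z) D ->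
  cder (fun w => F (G w)) z (D * E).
Proof.
move=> hG hF e e0.
have K0 : 0 < cmod E + 1 by rewrite ltr_wpDl // cmod_ge0.
have L0 : 0 < cmod D + 1 by rewrite ltr_wpDl // cmod_ge0.
have [d d0 hd] := hF (e / 2 / (cmod E + 1)) ltac:(by rewrite !divr_gt0).
have [d1 d10 hd1] := hG (Num.min 1 (e / 2 / (cmod D + 1))) ltac:(by rewrite lt_min ltr01 !divr_gt0).
have [d2 d20 hd2] := cder_cont hG d0.
exists (Num.min d1 d2); first by rewrite lt_min d10.
move=> w; rewrite lt_min => /andP[/hd1 h1 /hd2/hd h2].
have a0 := cmod_ge0 (w - z).
have h3 : cmod (G w - G z) <= (cmod E + 1) * cmod (w - z).
  have -> : G w - G z = E * (w - z) + (G w - G z - E * (w - z)) by ring.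
  apply: le_trans (cmodD _ _) _; rewrite cmodM mulrDl lerD //.
  by apply: le_trans h1 _; rewrite ler_wpM2r // ge_min lexx.
have -> : F (G w) - F (G z) - D * E * (w - z) =
  (F (G w) - F (G z) - D * (G w - G z)) + D * (G w - G z - E * (w - z)) by ring.
apply: le_trans (cmodD _ _) _; rewrite [e]splitr mulrDl lerD //.
  apply: le_trans h2 _.
  rewrite -[X in _ <= X * _](@divfK _ (cmod E + 1)) ?gt_eqF // -[leRHS]mulrA ler_wpM2l //.
  by rewrite !divr_ge0 // ltW.
rewrite cmodM; apply: (@le_trans _ _ ((cmod D + 1) * (e / 2 / (cmod D + 1) * cmod (w - z)))).
  apply: ler_pM; rewrite ?cmod_ge0 ?lerDl //.
  by apply: le_trans h1 _; rewrite ler_wpM2r // ge_min lexx orbT.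
by rewrite mulrA mulrCA divff ?gt_eqF // mulr1.
Qed.

Lemma cder_sqr z : cder (fun w => w * w) z (2 * z).
Proof.
move=> e e0; exists e => // w /ltW h.
have -> : w * w - z * z - 2 * z * (w - z) = (w - z) * (w - z) by ring.
by rewrite cmodM ler_wpM2r // cmod_ge0.
Qed.

Lemma cderZ c F z D : cder F z D -> cder (fun w => c * F w) z (c * D).
Proof.
move=> hF; apply: (@cder_comp (fun w => c * w) F z c D hF) => e e0.
by exists 1 => // w _; rewrite -mulrBr subrr cmod0 mulr_ge0 ?cmod_ge0 // ltW.
Qed.

Lemma cderN F z D : cder F z D -> cder (fun w => - F w) z (- D).
Proof.
move=> /(cderZ (-1)); rewrite mulN1r; apply: (cder_eq ltr01) => w _.
by rewrite mulN1r.
Qed.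

Lemma cderB F G z D E : cder F z D -> cder G z E -> cder (fun w => F w - G w) z (D - E).
Proof. by move=> hF /cderN; exact: cderD. Qed.

(** Polarisation, 2 F G = (F + G)^2 - F^2 - G^2, reduces the product rule to the chain rule and the
    derivative of the square. *)
Lemma cderM F G z D E : cder F z D -> cder G z E ->
  cder (fun w => F w * G w) z (D * G z + F z * E).
Proof.
move=> hF hG.
have h1 := cder_comp (cderD hF hG) (@cder_sqr (F z + G z)).
have h2 := cder_comp hF (@cder_sqr (F z)).
have h3 := cder_comp hG (@cder_sqr (G z)).
have := cderZ (2^-1) (cderB (cderB h1 h2) h3).
have -> : 2^-1 * (2 * (F z + G z) * (D + E) - 2 * F z * D - 2 * G z * E) = D * G z + F z * E.
  by field.
by apply: (cder_eq ltr01) => w _; field.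
Qed.

Lemma cderV z : z != 0 -> cder (fun w => w^-1) z (- (z ^- 2)).
Proof.
move=> z0 e e0; have cz : 0 < cmod z by rewrite cmod_gt0.
(* The remainder is (w - z)^2 / (w z^2). Since |w| >= |z| / 2, it is at most 2 |w - z|^2 / |z|^3. *)
exists (Num.min (cmod z / 2) (e * cmod z ^+ 3 / 2)).
  by rewrite lt_min !divr_gt0 // mulr_gt0 // exprn_gt0.
move=> w; rewrite lt_min => /andP[h1 h2].
have hw : cmod z / 2 <= cmod w.
  by have := cmod_dist z w; rewrite cmodB => h; lra.
have w0 : w != 0 by rewrite -cmod_gt0; apply: lt_le_trans hw; rewrite divr_gt0.
have -> : w^-1 - z^-1 - - z ^- 2 * (w - z) = (w - z) / (w * z ^+ 2) * (w - z).
  by field; rewrite z0 w0.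
rewrite cmodM ler_wpM2r ?cmod_ge0 // cmodf ler_pdivrMr; last by rewrite cmod_gt0 mulf_neq0 // expf_neq0.
apply: le_trans (ltW h2) _; rewrite cmodM cmodX -mulrA ler_wpM2l ?(ltW e0) //.
by rewrite exprS mulrAC ler_wpM2r // sqr_ge0.
Qed.

Lemma cder_inv F z D : F z != 0 -> cder F z D ->
  cder (fun w => (F w)^-1) z (- (F z ^- 2) * D).
Proof. by move=> F0 hF; apply: (cder_comp hF); exact: cderV. Qed.

Lemma ccontD F G z : ccont F z -> ccont G z -> ccont (fun w => F w + G w) z.
Proof.
move=> hF hG e e0; have e20 : 0 < e / 2 by rewrite divr_gt0.
have [d d0 hd] := hF _ e20; have [d' d'0 hd'] := hG _ e20.
exists (Num.min d d'); first by rewrite lt_min d0.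
move=> w; rewrite lt_min => /andP[/hd h1 /hd' h2].
have -> : F w + G w - (F z + G z) = (F w - F z) + (G w - G z) by ring.
by apply: le_lt_trans (cmodD _ _) _; rewrite [e]splitr ltrD.
Qed.

Lemma ccontM F G z : ccont F z -> ccont G z -> ccont (fun w => F w * G w) z.
Proof.
move=> hF hG e e0.
have K0 : 0 < cmod (F z) + 1 by rewrite ltr_wpDl // cmod_ge0.
have L0 : 0 < cmod (G z) + 1 by rewrite ltr_wpDl // cmod_ge0.
have [d d0 hd] := hF _ (divr_gt0 (divr_gt0 e0 (ltr0n R 2)) L0).
have [d' d'0 hd'] := hG (Num.min 1 (e / 2 / (cmod (F z) + 1)))
  ltac:(by rewrite lt_min ltr01 !divr_gt0).
exists (Num.min d d'); first by rewrite lt_min d0.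
move=> w; rewrite lt_min => /andP[/hd h1 /hd']; rewrite lt_min => /andP[h2 h3].
have -> : F w * G w - F z * G z = (F w - F z) * G w + F z * (G w - G z) by ring.
apply: le_lt_trans (cmodD _ _) _; rewrite !cmodM [e]splitr ltr_leD //.
  have gw : cmod (G w) <= cmod (G z) + 1.
    by have := cmod_dist (G w) (G z); lra.
  apply: (@le_lt_trans _ _ (cmod (F w - F z) * (cmod (G z) + 1))).
    by rewrite ler_wpM2l ?cmod_ge0.
  by rewrite -ltr_pdivlMr.
apply: (@le_trans _ _ ((cmod (F z) + 1) * (e / 2 / (cmod (F z) + 1)))).
  by apply: ler_pM; rewrite ?cmod_ge0 ?lerDl ?(ltW h3).
by rewrite mulrC divfK // gt_eqF.
Qed.

Lemma ccont_comp F G z : ccont G z -> ccont F (G z) -> ccont (fun w => F (G w)) z.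
Proof.
move=> hG hF e e0; have [d d0 hd] := hF e e0; have [d' d'0 hd'] := hG d d0.
by exists d' => // w /hd'/hd.
Qed.

Lemma entire_cst c : entire (fun=> c : R[i]).
Proof. by apply/entireP => z; exists 0; exact: cder_cst. Qed.
Lemma entire_id : entire (id : R[i] -> R[i]).
Proof. by apply/entireP => z; exists 1; exact: cder_id. Qed.
Lemma entireD F G : entire F -> entire G -> entire (fun z => F z + G z).
Proof.
move=> /entireP hF /entireP hG; apply/entireP => z.
by have [[D hD] [E hE]] := (hF z, hG z); exists (D + E); exact: cderD.
Qed.
Lemma entireN F : entire F -> entire (fun z => - F z).
Proof.
by move=> /entireP hF; apply/entireP => z; have [D /cderN] := hF z; exists (- D).
Qed.
Lemma entireB F G : entire F -> entire G -> entire (fun z => F z - G z).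
Proof. by move=> hF hG; exact (entireD hF (entireN hG)). Qed.
Lemma entireM F G : entire F -> entire G -> entire (fun z => F z * G z).
Proof.
move=> /entireP hF /entireP hG; apply/entireP => z.
by have [[D hD] [E hE]] := (hF z, hG z); eexists; exact: (cderM hD hE).
Qed.
Lemma entireV F : entire F -> (forall z, F z != 0) -> entire (fun z => (F z)^-1).
Proof.
move=> /entireP hF F0; apply/entireP => z.
by have [D hD] := hF z; eexists; exact: (cder_inv (F0 z) hD).
Qed.
Lemma entire_comp F G : entire F -> entire G -> entire (fun z => F (G z)).
Proof.
move=> /entireP hF /entireP hG; apply/entireP => z.
by have [[E hE] [D hD]] := (hG z, hF (G z)); eexists; exact: (cder_comp hE hD).
Qed.
Lemma entireX F n : entire F -> entire (fun z => F z ^+ n).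
Proof.
move=> hF; elim: n => [|n IH]; first exact: entire_cst.
have -> : (fun z => F z ^+ n.+1) = (fun z => F z * F z ^+ n).
  by apply/funext => z; rewrite exprS.
exact: entireM.
Qed.
Lemma entire_sharp F : entire F -> entire (sharp F).
Proof.
move=> /entireP hF; apply/entireP => z; have [D hD] := hF (conjc z).
exists (conjc D) => e e0; have [d d0 hd] := hD e e0; exists d => // w wz.
have := hd (conjc w); rewrite -rmorphB cmod_conj => /(_ wz).
by rewrite -[X in X <= _]cmod_conj !(rmorphB, rmorphM) /= !conjcK.
Qed.
Lemma entire_prod (I : Type) (s : seq I) (F : I -> R[i] -> R[i]) :
  (forall i, entire (F i)) -> entire (fun z => \prod_(i <- s) F i z).
Proof.
move=> hF; elim: s => [|i s IH].
  have -> : (fun z => \prod_(i <- [::]) F i z) = fun=> 1.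
    by apply/funext => z; rewrite big_nil.
  exact: entire_cst.
have -> : (fun z => \prod_(j <- i :: s) F j z) = fun z => F i z * \prod_(j <- s) F j z.
  by apply/funext => z; rewrite big_cons.
exact (entireM (hF i) IH).
Qed.

End ComplexDerivative.

(** * Goursat's theorem *)

Section RealIntegral.
Variable R : realType.
Implicit Types (f g G : R -> R) (x a b : R).

Definition rder f x (D : R) : Prop := forall e : R, 0 < e -> exists2 d : R, 0 < d &
  forall y, `|y - x| < d -> `|f y - f x - D * (y - x)| <= e * `|y - x|.

Lemma is_derive_rder f x D : is_derive x 1 f D -> rder f x D.
Proof.
move=> -[/cvg_ex [D' hD'] hE].
have <- : D' = D by rewrite -hE; apply/esym/cvg_lim.
move=> e e0; move/cvgrPdist_le : hD' => /(_ e e0).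
rewrite near_withinE => /nbhs_ballP[d /= d0 hd]; exists d => // y yx.
have [->|yx0] := eqVneq y x; first by rewrite !subrr mulr0 subr0 normr0 mulr0.
have w0 : y - x != 0 by rewrite subr_eq0.
have := hd (y - x); rewrite /ball /= sub0r normrN => /(_ yx w0).
rewrite /GRing.scale /= mulr1 subrK => h.
have -> : f y - f x - D' * (y - x) = - (D' - (y - x)^-1 * (f y - f x)) * (y - x).
  by rewrite opprB mulrBl mulrAC mulVf // mul1r.
by rewrite normrM normrN ler_wpM2r.
Qed.

Lemma rder_is_derive f x D : rder f x D -> is_derive x (1 : R) f D.
Proof.
move=> hD; have h : h^-1 *: (f (h *: (1 : R) + x) - f x) @[h --> 0^'] --> D.
  apply/cvgrPdist_le => /= e e0; have [d d0 hd] := hD e e0.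
  rewrite near_withinE; apply/nbhs_ballP; exists d => //=.
  move=> h; rewrite /ball /= sub0r normrN => hd' h0.
  have := hd (h + x); rewrite addrK => /(_ hd') H.
  rewrite /GRing.scale /= mulr1.
  have -> : D - h^-1 * (f (h + x) - f x) = - (f (h + x) - f x - D * h) / h.
    by rewrite opprB mulrBl mulfK // mulrC [_ / h]mulrC.
  by rewrite normrM normrN normfV ler_pdivrMr // normr_gt0.
by apply: DeriveDef; [apply/cvg_ex; exists D|apply/cvg_lim].
Qed.

(** The integral is the increment of a chosen primitive on the whole line (the zero function when
    there is none), so concatenation of intervals holds by definition; [continuous_primitive] makes
    it meaningful for continuous [g]. *)
Definition rint g a b : R :=
  let G := xget (fun=> 0) [set G : R -> R | forall x, is_derive x (1 : R) G (g x)] in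
  G b - G a.

Lemma rintE g G a b : (forall x, is_derive x (1 : R) G (g x)) -> rint g a b = G b - G a.
Proof.
move=> hG; rewrite /rint; case: xgetP => [H _ hH|/(_ G)]; last by case.
have h : forall x, is_derive x (1 : R) (H \- G) 0.
  by move=> x; have := is_deriveB (hH x) (hG x); rewrite subrr.
by have := is_derive_0_is_cst b a h; rewrite /= => h'; lra.
Qed.

Lemma continuous_primitive_right g a : continuous g ->
  exists G, forall x, a < x -> is_derive x (1 : R) G (g x).
Proof.
move=> cg; exists (fun x => (\int[lebesgue_measure]_(t in [set` `[a, x]]) (g t))%R) => x ax.
have h : (x < x + 1)%R by rewrite ltrDl.
have [|d E] := @continuous_FTC1_closed R g a x (x + 1) h _ ax (cg x).
  by apply: continuous_compact_integrable; [exact: segment_compact|exact: continuous_subspaceT].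
by split; [exact: d|rewrite -derive1E; exact: E].
Qed.

(** An integral from a base point is a primitive only to its right. A second one, for x |-> g (- x),
    is reflected to cover the left; both are normalised at 0 and agree on ]-1, 1[, where both are
    primitives. *)
Lemma continuous_primitive g : continuous g ->
  exists G, forall x, is_derive x (1 : R) G (g x).
Proof.
move=> cg; have [G1 h1] := continuous_primitive_right (-1) cg.
have [|G2 h2] := continuous_primitive_right (-1) (g := fun x => g (- x)).
  by move=> x; apply: continuous_comp; [exact: opp_continuous|exact: cg].
have h3 x : x < 1 -> is_derive x (1 : R) (fun x => - G2 (- x)) (g x).
  move=> x1; have Nx1 : -1 < - x by rewrite ltrN2.
  have := h2 _ Nx1; rewrite opprK => h.
  have hN := is_deriveNid x (1 : R).
  have := is_deriveN (is_derive1_comp (f := G2) (g := -%R) h hN).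
  by rewrite /GRing.scale /= mulrN1 opprK.
exists (fun x => if x < 0 then - G2 (- x) + G2 0 else G1 x - G1 0) => x.
have rd x' : -1 < x' < 1 -> - G2 (- x') + G2 0 = G1 x' - G1 0.
  move=> /andP[x1 x2]; have key a b : -1 < a -> b < 1 -> a <= b ->
      G1 b + G2 (- b) = G1 a + G2 (- a).
    move=> ha hb ab; have hd : forall c, c \in `]a, b[ -> is_derive c (1 : R) (fun c => G1 c - - G2 (- c)) 0.
      move=> c; rewrite in_itv /= => /andP[ac cb].
      by have := is_deriveB (h1 c (lt_trans ha ac)) (h3 c (lt_trans cb hb)); rewrite subrr.
    have cont : {within `[a, b], continuous (fun c => G1 c - - G2 (- c))}.
      apply: derivable_within_continuous => c; rewrite in_itv /= => /andP[ac cb].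
      by have := is_deriveB (h1 c (lt_le_trans ha ac)) (h3 c (le_lt_trans cb hb)) => -[].
    have [c _] := MVT_segment ab hd cont; rewrite mul0r => /eqP.
    by rewrite subr_eq0 !opprK => /eqP.
  have [x0|x0] := leP 0 x'.
    by have := key 0 x' ltac:(lra) x2 x0; rewrite oppr0; lra.
  by have := key x' 0 x1 ltac:(lra) (ltW x0); rewrite oppr0; lra.
have tr H c d : 0 < d -> rder H x (g x) ->
   (forall y, `|y - x| < d -> (if y < 0 then - G2 (- y) + G2 0 else G1 y - G1 0) = H y + c) ->
   is_derive x (1 : R) (fun x => if x < 0 then - G2 (- x) + G2 0 else G1 x - G1 0) (g x).
  move=> d0 hH hE; apply: rder_is_derive => e e0; have [d' d'0 hd'] := hH e e0.
  exists (Num.min d d'); first by rewrite lt_min d0.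
  move=> y; rewrite lt_min => /andP[yd yd']; rewrite !hE ?subrr ?normr0 //.
  have -> : H y + c - (H x + c) - g x * (y - x) = H y - H x - g x * (y - x) by ring.
  exact: hd'.
have [x0|x0] := ltP x 0.
  apply: (tr (fun x => - G2 (- x)) (G2 0) (- x)); first by lra.
    by apply/is_derive_rder/h3; lra.
  by move=> y; rewrite ltr_norml => /andP[_ yx]; have -> : y < 0 by lra.
apply: (tr G1 (- G1 0) 1); first by lra.
  by apply/is_derive_rder/h1; lra.
move=> y; rewrite ltr_norml => /andP[y1 y2]; case: ltP => // y0.
by apply: rd; lra.
Qed.

Lemma rintD f g a b : continuous f -> continuous g ->
  rint (fun x => f x + g x) a b = rint f a b + rint g a b.
Proof.
move=> /continuous_primitive[F hF] /continuous_primitive[G hG].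
rewrite (rintE _ _ hF) (rintE _ _ hG) (rintE (G := F \+ G)) /=; first by ring.
Qed.

Lemma rint_cat g a b c : rint g a b + rint g b c = rint g a c.
Proof. by rewrite /rint; ring. Qed.

Lemma rint_le g a b M : continuous g -> a <= b ->
  (forall x, a <= x <= b -> `|g x| <= M) -> `|rint g a b| <= M * (b - a).
Proof.
move=> /continuous_primitive[G hG] ab hM; rewrite (rintE _ _ hG).
have [|c cab ->] := @MVT_segment _ G g a b ab (fun x _ => hG x).
  by apply: derivable_within_continuous => x _; have [] := hG x.
rewrite normrM [`|b - a|]ger0_norm ?subr_ge0 // ler_wpM2r ?subr_ge0 //.
by apply: hM; move: cab; rewrite in_itv.
Qed.

End RealIntegral.

(** * Complex integrals along horizontal and vertical segments *)

Section SegmentIntegrals.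
Variable R : realType.
Implicit Types (k K : R[i] -> R[i]) (x y a b c d : R).

Definition hint k y a b : R[i] :=
  rint (fun x => complex.Re (k (x +i* y))) a b +i*
  rint (fun x => complex.Im (k (x +i* y))) a b.

Definition vint k x c d : R[i] :=
  rint (fun y => complex.Re (k (x +i* y))) c d +i*
  rint (fun y => complex.Im (k (x +i* y))) c d.

Lemma line_continuous k (l : R -> R[i]) : (forall z, ccont k z) ->
  (forall x y, cmod (l x - l y) = `|x - y|) ->
  continuous (fun x => complex.Re (k (l x))) /\ continuous (fun x => complex.Im (k (l x))).
Proof.
move=> kc lE; split=> x; apply/cvgrPdist_lt => /= e e0; have [d d0 hd] := kc (l x) e e0;
  apply/nbhs_ballP; exists d => //= y; rewrite /ball /= -lE => /=; rewrite cmodB => /hd h;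
  rewrite distrC.
- by apply: le_lt_trans h; rewrite -cReN -cReD; exact: Re_le_cmod.
- by apply: le_lt_trans h; rewrite -cImN -cImD; exact: Im_le_cmod.
Qed.

Lemma cmod_hline y x x' : cmod (x +i* y - (x' +i* y)) = `|x - x'|.
Proof.
have -> : x +i* y - (x' +i* y) = (x - x')%:C by apply/complex_eq => /=; ring.
exact: cmodC.
Qed.

Lemma cmod_vline x y y' : cmod (x +i* y - (x +i* y')) = `|y - y'|.
Proof.
have -> : x +i* y - (x +i* y') = 'i * (y - y')%:C by apply/complex_eq => /=; ring.
by rewrite cmodM cmodi mul1r cmodC.
Qed.

Lemma hintD k k' y a b : (forall z, ccont k z) -> (forall z, ccont k' z) ->
  hint (fun z => k z + k' z) y a b = hint k y a b + hint k' y a b.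
Proof.
move=> kc kc'; have [c1 c2] := line_continuous kc (cmod_hline y).
have [c1' c2'] := line_continuous kc' (cmod_hline y).
apply/complex_eq; rewrite ?cReD ?cImD /=.
  by rewrite -rintD //; congr rint; apply/funext => x; rewrite cReD.
by rewrite -rintD //; congr rint; apply/funext => x; rewrite cImD.
Qed.

Lemma vintD k k' x c d : (forall z, ccont k z) -> (forall z, ccont k' z) ->
  vint (fun z => k z + k' z) x c d = vint k x c d + vint k' x c d.
Proof.
move=> kc kc'; have [c1 c2] := line_continuous kc (cmod_vline x).
have [c1' c2'] := line_continuous kc' (cmod_vline x).
apply/complex_eq; rewrite ?cReD ?cImD /=.
  by rewrite -rintD //; congr rint; apply/funext => y; rewrite cReD.
by rewrite -rintD //; congr rint; apply/funext => y; rewrite cImD.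
Qed.

Lemma hint_cat k y a b c : hint k y a b + hint k y b c = hint k y a c.
Proof. by apply/complex_eq; rewrite /= rint_cat. Qed.

Lemma vint_cat k x a b c : vint k x a b + vint k x b c = vint k x a c.
Proof. by apply/complex_eq; rewrite /= rint_cat. Qed.

(** The factor 2 comes from bounding real and imaginary parts separately; it propagates to the
    constants of the Cauchy estimates. *)
Lemma hint_le k y a b M : (forall z, ccont k z) -> a <= b ->
  (forall x, a <= x <= b -> cmod (k (x +i* y)) <= M) ->
  cmod (hint k y a b) <= 2 * M * (b - a).
Proof.
move=> kc ab kM; have [c1 c2] := line_continuous kc (cmod_hline y).
apply: le_trans (cmod_leD _) _; rewrite /= mulr2n mulrDl !mul1r mulrDl.
apply: lerD; apply: rint_le => // x /kM; apply: le_trans.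
  exact: Re_le_cmod.
exact: Im_le_cmod.
Qed.

Lemma vint_le k x c d M : (forall z, ccont k z) -> c <= d ->
  (forall y, c <= y <= d -> cmod (k (x +i* y)) <= M) ->
  cmod (vint k x c d) <= 2 * M * (d - c).
Proof.
move=> kc ab kM; have [c1 c2] := line_continuous kc (cmod_vline x).
apply: le_trans (cmod_leD _) _; rewrite /= mulr2n mulrDl !mul1r mulrDl.
apply: lerD; apply: rint_le => // y /kM; apply: le_trans.
  exact: Re_le_cmod.
exact: Im_le_cmod.
Qed.

Lemma hint_prim k K y a b : (forall z, cder K z (k z)) ->
  hint k y a b = K (b +i* y) - K (a +i* y).
Proof.
move=> hK.
have h1 x : is_derive x (1 : R) (fun x => complex.Re (K (x +i* y))) (complex.Re (k (x +i* y))).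
  apply: rder_is_derive => e e0; have [d d0 hd] := hK (x +i* y) e e0.
  exists d => // x'; rewrite -!(cmod_hline y x' x) => h; apply: le_trans _ (hd _ h); apply: le_trans _ (Re_le_cmod _); rewrite !(cReD, cReN, cReM) /=.
  by rewrite le_eqVlt; apply/orP; left; apply/eqP; congr `|_|; ring.
have h2 x : is_derive x (1 : R) (fun x => complex.Im (K (x +i* y))) (complex.Im (k (x +i* y))).
  apply: rder_is_derive => e e0; have [d d0 hd] := hK (x +i* y) e e0.
  exists d => // x'; rewrite -!(cmod_hline y x' x) => h; apply: le_trans _ (hd _ h); apply: le_trans _ (Im_le_cmod _); rewrite !(cImD, cImN, cImM) /=.
  by rewrite le_eqVlt; apply/orP; left; apply/eqP; congr `|_|; ring.
by apply/complex_eq; rewrite ?cReD ?cImD ?cReN ?cImN /= (rintE _ _ h1, rintE _ _ h2).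
Qed.

Lemma vint_prim k K x c d : (forall z, cder K z (k z)) ->
  vint k x c d = - 'i * (K (x +i* d) - K (x +i* c)).
Proof.
move=> hK.
have h1 y : is_derive y (1 : R) (fun y => complex.Im (K (x +i* y))) (complex.Re (k (x +i* y))).
  apply: rder_is_derive => e e0; have [d' d'0 hd] := hK (x +i* y) e e0.
  exists d' => // y'; rewrite -!(cmod_vline x y' y) => h; apply: le_trans _ (hd _ h); apply: le_trans _ (Im_le_cmod _); rewrite !(cImD, cImN, cImM) /=.
  by rewrite le_eqVlt; apply/orP; left; apply/eqP; congr `|_|; ring.
have h2 y : is_derive y (1 : R) (fun y => - complex.Re (K (x +i* y))) (complex.Im (k (x +i* y))).
  apply: rder_is_derive => e e0; have [d' d'0 hd] := hK (x +i* y) e e0.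
  exists d' => // y'; rewrite -!(cmod_vline x y' y) => h; apply: le_trans _ (hd _ h); apply: le_trans _ (Re_le_cmod _); rewrite !(cReD, cReN, cReM) /= -[leRHS]normrN.
  by rewrite le_eqVlt; apply/orP; left; apply/eqP; congr `|_|; ring.
apply/complex_eq; rewrite !(cReM, cImM, cReD, cImD, cReN, cImN) /=.
  by rewrite (rintE _ _ h1); ring.
by rewrite (rintE _ _ h2); ring.
Qed.

End SegmentIntegrals.

(** * A bisection principle for rectangles *)

Section Bisection.
Variable R : realType.
Implicit Types (a b c d x y : R).

Let in_rect a b c d (z : R[i]) :=
  [/\ a <= complex.Re z, complex.Re z <= b, c <= complex.Im z & complex.Im z <= d].

(** Compactness in inductive form: a property inherited from the four quarters and true for all
    small rectangles around each point is true of the whole. It serves both Goursat's theorem and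
    boundedness of continuous functions. *)
Lemma rect_bisection (P : R -> R -> R -> R -> Prop) a b c d :
  a <= b -> c <= d ->
  (forall a b c d, let m := (a + b) / 2 in let n := (c + d) / 2 in
     P a m c n -> P m b c n -> P a m n d -> P m b n d -> P a b c d) ->
  (forall z, in_rect a b c d z -> exists2 e : R, 0 < e &
     forall a' b' c' d', a <= a' -> b' <= b -> c <= c' -> d' <= d ->
       in_rect a' b' c' d' z -> (b' - a') + (d' - c') < e -> P a' b' c' d') ->
  P a b c d.
Proof.
move=> ab cd hsplit hloc; apply: contrapT => nP.
pose child (q q' : (R * R) * (R * R)) :=
  let m := (q.1.1 + q.1.2) / 2 in let n := (q.2.1 + q.2.2) / 2 in
  (q'.1 = (q.1.1, m) \/ q'.1 = (m, q.1.2)) /\ (q'.2 = (q.2.1, n) \/ q'.2 = (n, q.2.2)).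
pose Bad (q : (R * R) * (R * R)) := ~ P q.1.1 q.1.2 q.2.1 q.2.2.
have step q : Bad q -> exists q', child q q' /\ Bad q'.
  move=> bad; apply: contrapT => H; apply: bad.
  by apply: hsplit; apply: contrapT => hP; apply: H;
    [exists ((q.1.1, (q.1.1 + q.1.2) / 2), (q.2.1, (q.2.1 + q.2.2) / 2))|
     exists (((q.1.1 + q.1.2) / 2, q.1.2), (q.2.1, (q.2.1 + q.2.2) / 2))|
     exists ((q.1.1, (q.1.1 + q.1.2) / 2), ((q.2.1 + q.2.2) / 2, q.2.2))|
     exists (((q.1.1 + q.1.2) / 2, q.1.2), ((q.2.1 + q.2.2) / 2, q.2.2))];
    split => //; split; (try by left); right.
pose next q := xget q [set q' | child q q' /\ Bad q'].
have nextP q : Bad q -> child q (next q) /\ Bad (next q).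
  by move=> /step[q' hq']; rewrite /next; case: xgetP => [? -> //|/(_ q')].
pose s n := iter n next ((a, b), (c, d)).
have sBad n : Bad (s n) by elim: n => [//|n /nextP[]].
have sch n : child (s n) (s n.+1) by have [] := nextP _ (sBad n).
have sle n : (s n).1.1 <= (s n).1.2 /\ (s n).2.1 <= (s n).2.2.
  elim: n => [//|n [h1 h2]]; have [[->|->] [->|->]] /= := sch n; split; lra.
have smono n : [/\ (s n).1.1 <= (s n.+1).1.1, (s n.+1).1.2 <= (s n).1.2,
    (s n).2.1 <= (s n.+1).2.1 & (s n.+1).2.2 <= (s n).2.2].
  have [h1 h2] := sle n; have [[->|->] [->|->]] /= := sch n; split; lra.
have ssize n : (s n).1.2 - (s n).1.1 = (b - a) / 2 ^+ n /\
    (s n).2.2 - (s n).2.1 = (d - c) / 2 ^+ n.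
  elim: n => [|n [h1 h2]]; first by rewrite expr0 !divr1.
  have -> x : x / 2 ^+ n.+1 = x / 2 ^+ n / 2 by rewrite exprS invfM mulrA mulrAC.
  have -> x : x / 2 ^+ n.+1 = x / 2 ^+ n / 2 by rewrite exprS invfM mulrA mulrAC.
  by rewrite -h1 -h2; have [[->|->] [->|->]] /= := sch n; split; field.
have smonoD n k : [/\ (s n).1.1 <= (s (n + k)%N).1.1, (s (n + k)%N).1.2 <= (s n).1.2,
    (s n).2.1 <= (s (n + k)%N).2.1 & (s (n + k)%N).2.2 <= (s n).2.2].
  elim: k => [|k [h1 h2 h3 h4]]; first by rewrite addn0.
  by rewrite addnS; have [h1' h2' h3' h4'] := smono (n + k)%N; split;
    [apply: le_trans h1'|apply: le_trans h2' _|apply: le_trans h3'|apply: le_trans h4' _].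
have cross n m : (s n).1.1 <= (s m).1.2 /\ (s n).2.1 <= (s m).2.2.
  have [h1 _ h3 _] := smonoD n m; have [_ h2 _ h4] := smonoD m n.
  have [h5 h6] := sle (n + m)%N; move: h2 h4; rewrite addnC => h2 h4.
  by split; [apply: le_trans h1 (le_trans h5 h2)|apply: le_trans h3 (le_trans h6 h4)].
(* The bad rectangles are nested, so by [cross] every left or lower end lies below every right or
   upper end. The suprema give a common point, where [hloc] contradicts [sBad]. *)
pose X := sup [set (s n).1.1 | n in setT]; pose Y := sup [set (s n).2.1 | n in setT].
have hX n : (s n).1.1 <= X /\ X <= (s n).1.2.
  split; first by apply: sup_ubound; [exists b => _ [m _ <-]; have [] := cross m 0%N|exists n].
  by apply: ge_sup; [exists (s 0%N).1.1; exists 0%N|move=> _ [m _ <-]; have [] := cross m n].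
have hY n : (s n).2.1 <= Y /\ Y <= (s n).2.2.
  split; first by apply: sup_ubound; [exists d => _ [m _ <-]; have [] := cross m 0%N|exists n].
  by apply: ge_sup; [exists (s 0%N).2.1; exists 0%N|move=> _ [m _ <-]; have [] := cross m n].
have [|e e0 he] := hloc (X +i* Y).
  by have [] := hX 0%N; have [] := hY 0%N => /= *; split.
have [n hn] : exists n, (b - a + (d - c)) / 2 ^+ n < e.
  pose L := b - a + (d - c); have L0 : 0 <= L by rewrite addr_ge0 // subr_ge0.
  exists (Num.truncn (L / e)).+1; rewrite ltr_pdivrMr ?exprn_gt0 // mulrC -ltr_pdivrMr //.
  apply: lt_trans (truncnS_gt _) _; rewrite -natrX ltr_nat; exact: ltn_expl.
apply: (sBad n); have [m1 m2 m3 m4] := smonoD 0%N n; rewrite !add0n in m1 m2 m3 m4.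
apply: he => //; first by have [] := hX n; have [] := hY n => /= *; split.
by have [-> ->] := ssize n; rewrite -mulrDl.
Qed.

End Bisection.

(** * Vanishing of integrals around rectangles *)

Section Goursat.
Variable R : realType.
Implicit Types (k : R[i] -> R[i]) (a b c d : R) (z : R[i]).

Definition rectint k a b c d : R[i] :=
  hint k c a b + 'i * vint k b c d - hint k d a b - 'i * vint k a c d.

Lemma rectint_hcat k a m b c d : rectint k a b c d = rectint k a m c d + rectint k m b c d.
Proof. by rewrite /rectint -(hint_cat k c a m b) -(hint_cat k d a m b); ring. Qed.

Lemma rectint_vcat k a b c m d : rectint k a b c d = rectint k a b c m + rectint k a b m d.
Proof. by rewrite /rectint -(vint_cat k a c m d) -(vint_cat k b c m d); ring. Qed.

Lemma rectintD k k' a b c d : (forall z, ccont k z) -> (forall z, ccont k' z) ->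
  rectint (fun z => k z + k' z) a b c d = rectint k a b c d + rectint k' a b c d.
Proof. by move=> kc kc'; rewrite /rectint !hintD // !vintD //; ring. Qed.

Lemma rectint_prim k K a b c d : (forall z, cder K z (k z)) -> rectint k a b c d = 0.
Proof.
move=> hK; rewrite /rectint !(hint_prim _ _ _ hK) !(vint_prim _ _ _ hK).
rewrite !mulrA mulrN -expr2 sqr_i opprK !mul1r; ring.
Qed.

Lemma rectint_le k a b c d M : (forall z, ccont k z) -> a <= b -> c <= d ->
  (forall z, a <= complex.Re z <= b -> c <= complex.Im z <= d -> cmod (k z) <= M) ->
  cmod (rectint k a b c d) <= 4 * M * ((b - a) + (d - c)).
Proof.
move=> kc ab cd kM.
have h1 : cmod (hint k c a b) <= 2 * M * (b - a).
  by apply: hint_le => // x hx; apply: kM => //=; rewrite lexx.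
have h2 : cmod (hint k d a b) <= 2 * M * (b - a).
  by apply: hint_le => // x hx; apply: kM => //=; rewrite lexx andbT.
have h3 : cmod (vint k a c d) <= 2 * M * (d - c).
  by apply: vint_le => // x hx; apply: kM => //=; rewrite lexx.
have h4 : cmod (vint k b c d) <= 2 * M * (d - c).
  by apply: vint_le => // x hx; apply: kM => //=; rewrite lexx andbT.
rewrite /rectint.
have t1 := cmodD (hint k c a b) ('i * vint k b c d).
have t2 := cmodBD (hint k c a b + 'i * vint k b c d) (hint k d a b).
have t3 := cmodBD (hint k c a b + 'i * vint k b c d - hint k d a b) ('i * vint k a c d).
rewrite !(cmodM 'i) !cmodi !mul1r in t1 t3.
lra.
Qed.

(** The property bisected is |integral| <= e L^2, with L the half perimeter: it passes from quarters
    to the whole because 4 (L / 2)^2 = L^2. Locally the affine part of k has a primitive and drops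
    out, and the error is at most a small multiple of L on a boundary of length 2 L. *)
Theorem goursat k a b c d : (forall z, ccont k z) -> a <= b -> c <= d ->
  (forall z, a <= complex.Re z <= b -> c <= complex.Im z <= d -> exists D, cder k z D) ->
  rectint k a b c d = 0.
Proof.
move=> kc ab cd kd; apply/eqP; rewrite -cmod_eq0 eq_le cmod_ge0 andbT.
apply/ler_addgt0Pr => e0 e00; rewrite add0r.
set L := (b - a) + (d - c).
have L0 : 0 <= L by rewrite addr_ge0 // subr_ge0.
(* The summand 1 covers the degenerate rectangle, where L = 0. *)
pose e := e0 / (L ^+ 2 + 1).
have K0 : 0 < L ^+ 2 + 1 by rewrite ltr_wpDl // sqr_ge0.
have e_gt0 : 0 < e by rewrite divr_gt0.
suff : cmod (rectint k a b c d) <= e * L ^+ 2.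
  move=> /le_trans; apply; rewrite /e mulrAC ler_pdivrMr // ler_pM2l //.
  by rewrite lerDl.
pose P a b c d := a <= b -> c <= d -> cmod (rectint k a b c d) <= e * ((b - a) + (d - c)) ^+ 2.
clearbody e; apply: (@rect_bisection R P a b c d ab cd) => //.
  move=> {ab cd L L0 K0 e0 e00 kd}a {}b {}c {}d m n P1 P2 P3 P4 ab cd.
  have am : a <= m by rewrite /m; lra.
  have mb : m <= b by rewrite /m; lra.
  have cn : c <= n by rewrite /n; lra.
  have nd : n <= d by rewrite /n; lra.
  rewrite (rectint_hcat k a m b) !(rectint_vcat k _ _ c n d).
  apply: le_trans (cmodD _ _) _.
  apply: le_trans (lerD (cmodD _ _) (cmodD _ _)) _.
  apply: le_trans (lerD (lerD (P1 am cn) (P3 am nd)) (lerD (P2 mb cn) (P4 mb nd))) _.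
  by rewrite le_eqVlt; apply/orP; left; apply/eqP; rewrite /m /n; field.
move=> z [az zb cz zd]; have [D hD] : exists D, cder k z D by apply: kd; apply/andP; split.
(* The quarter cancels the factor 4 of [rectint_le]. *)
have [|d0 d00 hd0] := hD (e / 4); first by rewrite divr_gt0.
exists d0 => // a' b' c' d' aa' b'b cc' d'd [a'z zb' c'z zd'] small {ab cd}ab cd.
pose err w := k w - k z - D * (w - z).
pose aff w := k z + D * (w - z).
have hK w : cder (fun w => k z * w + D / 2 * ((w - z) * (w - z))) w (aff w).
  have h1 := cderZ (k z) (cder_id w).
  have h2 := cderB (cder_id w) (cder_cst z w).
  have h3 := cderD h1 (cderZ (D / 2) (cderM h2 h2)).
  by apply: (eq_ind _ (cder _ _) h3); rewrite /aff /=; field.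
have affc w : ccont aff w.
  apply: (@cder_cont _ _ _ (0 + D * (1 - 0))); apply: cderD (cder_cst _ _) _.
  by apply: cderZ; apply: cderB; [exact: cder_id|exact: cder_cst].
have errc w : ccont err w.
  have -> : err = fun w => k w + -1 * aff w.
    by apply/funext => w'; rewrite /err /aff; ring.
  apply: ccontD => //; apply: ccontM => //.
  exact: (cder_cont (cder_cst _ _)).
have -> : k = (fun w => aff w + err w).
  by apply/funext => w; rewrite /aff /err; ring.
rewrite rectintD // (rectint_prim _ _ _ _ hK) add0r.
apply: le_trans (rectint_le (M := e / 4 * ((b' - a') + (d' - c'))) errc ab cd _) _; last first.
  by rewrite le_eqVlt; apply/orP; left; apply/eqP; field.
move=> w /andP[aw wb] /andP[cw wd].
have wz : cmod (w - z) <= (b' - a') + (d' - c').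
  apply: le_trans (cmod_leD _) _; rewrite !(cReD, cImD, cReN, cImN).
  by apply: lerD; rewrite ler_norml; apply/andP; split; lra.
apply: le_trans (hd0 w _) _; first exact: le_lt_trans wz small.
by rewrite ler_wpM2l // ltW // divr_gt0.
Qed.

(* The exceptional point is cut out by a small square, whose boundary integral
   tends to zero with its size since k is bounded near s. *)
Theorem goursat_punctured k a b c d s : (forall z, ccont k z) ->
  a < complex.Re s < b -> c < complex.Im s < d ->
  (forall z, a <= complex.Re z <= b -> c <= complex.Im z <= d -> z != s -> exists D, cder k z D) ->
  rectint k a b c d = 0.
Proof.
move: s => [x y] kc /= /andP[ax xb] /andP[cy yd] kd.
apply/eqP; rewrite -cmod_eq0 eq_le cmod_ge0 andbT.
apply/ler_addgt0Pr => e0 e00; rewrite add0r.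
have [d0 d00 hd0] := kc (x +i* y) 1 ltr01.
pose M := cmod (k (x +i* y)) + 1.
have M0 : 0 < M by rewrite ltr_wpDl // cmod_ge0.
pose m1 := Num.min (x - a) (b - x); pose m2 := Num.min (y - c) (d - y).
(* Half the side of the excised square. The three bounds keep it inside the rectangle, inside the
   disc where |k| <= M, and make its boundary integral, at most 4 M (4 e), no larger than e0. *)
pose e := Num.min (Num.min m1 m2 / 2) (Num.min (d0 / 4) (e0 / (16 * M))).
have e_gt0 : 0 < e.
  by rewrite !lt_min !divr_gt0 //= ?mulr_gt0 // !lt_min; apply/andP; split; apply/andP; split; lra.
have e1 : e <= Num.min m1 m2 / 2 by rewrite ge_min lexx.
have e2 : e <= d0 / 4 by rewrite !ge_min lexx orbT.
have e3 : e <= e0 / (16 * M) by rewrite !ge_min lexx !orbT.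
have h1 : Num.min m1 m2 <= x - a by rewrite !ge_min lexx.
have h2 : Num.min m1 m2 <= b - x by rewrite !ge_min lexx orbT.
have h3 : Num.min m1 m2 <= y - c by rewrite !ge_min lexx orbT.
have h4 : Num.min m1 m2 <= d - y by rewrite !ge_min lexx !orbT.
clearbody e m1 m2.
rewrite (rectint_vcat k a b c (y - e) d) (rectint_vcat k a b (y - e) (y + e) d).
rewrite (rectint_hcat k a (x - e) b (y - e)) (rectint_hcat k (x - e) (x + e) b (y - e)).
have z1 : rectint k a b c (y - e) = 0.
  apply: goursat => //; [lra|lra|] => z hz /andP[hz1 hz2]; apply: kd => //; first by lra.
  by apply/eqP => E; move: hz2; rewrite E /= => ?; lra.
have z2 : rectint k a b (y + e) d = 0.
  apply: goursat => //; [lra|lra|] => z hz /andP[hz1 hz2]; apply: kd => //; first by lra.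
  by apply/eqP => E; move: hz1; rewrite E /= => ?; lra.
have z3 : rectint k a (x - e) (y - e) (y + e) = 0.
  apply: goursat => //; [lra|lra|] => z /andP[hz1 hz2] /andP[hz3 hz4]; apply: kd; [lra|lra|].
  by apply/eqP => E; move: hz2; rewrite E /= => ?; lra.
have z4 : rectint k (x + e) b (y - e) (y + e) = 0.
  apply: goursat => //; [lra|lra|] => z /andP[hz1 hz2] /andP[hz3 hz4]; apply: kd; [lra|lra|].
  by apply/eqP => E; move: hz1; rewrite E /= => ?; lra.
rewrite z1 z2 z3 z4 !(add0r, addr0).
apply: le_trans (rectint_le (M := M) kc _ _ _) _; [lra|lra| |].
  move=> z /andP[hz1 hz2] /andP[hz3 hz4].
  have /hd0 hz : cmod (z - (x +i* y)) < d0.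
    apply: le_lt_trans (cmod_leD _) _; rewrite !(cReD, cImD, cReN, cImN) /=.
    have h5 : `|complex.Re z - x| <= e by rewrite ler_norml; apply/andP; split; lra.
    have h6 : `|complex.Im z - y| <= e by rewrite ler_norml; apply/andP; split; lra.
    by lra.
  by have := cmod_dist (k z) (k (x +i* y)); rewrite /M; lra.
have -> : 4 * M * (x + e - (x - e) + (y + e - (y - e))) = e * (16 * M) by ring.
by rewrite -ler_pdivlMr // mulr_gt0.
Qed.

Lemma ccont_bounded k a b c d : (forall z, ccont k z) -> a <= b -> c <= d ->
  exists M, forall z, a <= complex.Re z <= b -> c <= complex.Im z <= d -> cmod (k z) <= M.
Proof.
move=> kc ab cd.
pose P a b c d := exists M, forall z, a <= complex.Re z <= b -> c <= complex.Im z <= d -> cmod (k z) <= M.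
apply: (@rect_bisection R P a b c d ab cd) => //.
  move=> {ab cd}a {}b {}c {}d m n [M1 h1] [M2 h2] [M3 h3] [M4 h4].
  exists (Num.max (Num.max M1 M2) (Num.max M3 M4)) => z /andP[x1 x2] /andP[y1 y2].
  rewrite !le_max; have [xm|/ltW xm] := leP (complex.Re z) m;
    have [yn|/ltW yn] := leP (complex.Im z) n.
  - by rewrite h1 // ?x1 ?xm ?y1 ?yn.
  - by rewrite h3 ?orbT // ?x1 ?xm ?y2 ?yn.
  - by rewrite h2 ?orbT // ?x2 ?xm ?y1 ?yn.
  - by rewrite h4 ?orbT // ?x2 ?xm ?y2 ?yn.
move=> z _; have [e e0 he] := kc z 1 ltr01; exists e => // a' b' c' d' _ _ _ _ [h1 h2 h3 h4] small.
exists (cmod (k z) + 1) => w /andP[x1 x2] /andP[y1 y2].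
have /he hw : cmod (w - z) < e.
  apply: le_lt_trans small; apply: le_trans (cmod_leD _) _; rewrite !(cReD, cImD, cReN, cImN).
  by apply: lerD; rewrite ler_norml; apply/andP; split; lra.
by have := cmod_dist (k w) (k z); lra.
Qed.

End Goursat.

(** * Taylor series and logarithms of entire functions *)

Section ComplexExponential.
Variable R : realType.
Implicit Types (z w s : R[i]) (x y : R).

Lemma Re_cexp z : complex.Re (cexp z) = expR (complex.Re z) * cos (complex.Im z).
Proof. by rewrite /cexp /= mul0r subr0. Qed.
Lemma Im_cexp z : complex.Im (cexp z) = expR (complex.Re z) * sin (complex.Im z).
Proof. by rewrite /cexp /= mul0r addr0. Qed.

Lemma cexpD z w : cexp (z + w) = cexp z * cexp w.
Proof.
apply/complex_eq; rewrite !(cReM, cImM, Re_cexp, Im_cexp, cReD, cImD, expRD).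
  by rewrite cosD; ring.
by rewrite sinD; ring.
Qed.

Lemma cexp0 : cexp 0 = 1 :> R[i].
Proof. by apply/complex_eq; rewrite ?(Re_cexp, Im_cexp) /= expR0 mul1r ?cos0 ?sin0. Qed.

Lemma cmod_cexp z : cmod (cexp z) = expR (complex.Re z).
Proof.
rewrite /cmod Re_cexp Im_cexp !exprMn -mulrDr cos2Dsin2 mulr1 sqrtr_sqr.
by rewrite ger0_norm // expR_ge0.
Qed.

Lemma cexp_neq0 z : cexp z != 0.
Proof. by rewrite -cmod_gt0 cmod_cexp expR_gt0. Qed.

Lemma cexpN z : cexp (- z) = (cexp z)^-1.
Proof. by apply: (mulIf (cexp_neq0 z)); rewrite -cexpD addNr cexp0 mulVf // cexp_neq0. Qed.

Lemma cexpMn n z : cexp (n%:R * z) = cexp z ^+ n.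
Proof.
by elim: n => [|n IH]; rewrite ?mul0r ?cexp0 // -natr1 mulrDl mul1r cexpD IH exprSr.
Qed.

Lemma cexp_conj z : cexp (conjc z) = conjc (cexp z).
Proof.
apply/complex_eq; rewrite !(cRe_conj, cIm_conj, Re_cexp, Im_cexp) ?cosN //.
by rewrite sinN mulrN.
Qed.

Lemma cder_cexp0 : cder (@cexp R) 0 1.
Proof.
(* The bounds [b1] to [b5] below contribute 1 + 2 + 3 + 1 + 1 = 8 multiples of e1 t. *)
move=> e e0; pose e1 := Num.min 1 (e / 8).
have e10 : 0 < e1 by rewrite lt_min ltr01 divr_gt0.
have e1e : e1 <= e / 8 by rewrite ge_min lexx orbT.
have e11 : e1 <= 1 by rewrite ge_min lexx.
have [d1 d10 h1] := is_derive_rder (is_derive_expR (0 : R)) e10.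
have [d2 d20 h2] := is_derive_rder (is_derive_sin (0 : R)) e10.
have [d3 d30 h3] := is_derive_rder (is_derive_cos (0 : R)) e10.
clearbody e1; exists (Num.min (Num.min d1 d2) (Num.min d3 e1)); first by rewrite !lt_min d10 d20 d30.
move=> [x y]; rewrite subr0 !lt_min => /andP[/andP[c1 c2] /andP[c3 c4]].
have hx := Re_le_cmod (x +i* y); have hy := Im_le_cmod (x +i* y); rewrite /= in hx hy.
have := h1 x; rewrite !subr0 expR0 mul1r => /(_ (le_lt_trans hx c1)) {}h1.
have := h2 y; rewrite !subr0 sin0 cos0 mul1r subr0 => /(_ (le_lt_trans hy c2)) {}h2.
have := h3 y; rewrite !subr0 sin0 cos0 oppr0 mul0r subr0 => /(_ (le_lt_trans hy c3)) {}h3.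
have hcos := cos_max y.
set t := cmod (x +i* y) in c1 c2 c3 c4 hx hy *.
have t0 : 0 <= t by exact: cmod_ge0.
apply: le_trans (cmod_leD _) _.
rewrite cexp0 mul1r !(cReD, cImD, cReN, cImN) Re_cexp Im_cexp /= oppr0 addr0.
have -> : expR x * cos y - 1 - x = (expR x - 1 - x) * cos y + (1 + x) * (cos y - 1) by ring.
have -> : expR x * sin y - y = expR x * (sin y - y) + (expR x - 1 - x) * y + x * y by ring.
have hx1 : `|x| <= 1 by lra.
have hE : `|expR x| <= 3.
  have -> : expR x = (expR x - 1 - x) + 1 + x by ring.
  apply: le_trans (ler_normD _ _) _; apply: le_trans (lerD (ler_normD _ _) (lexx _)) _.
  rewrite normr1; have : e1 * `|x| <= 1 * 1 by apply: ler_pM => //; exact: ltW.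
  by lra.
have b1 : `|(expR x - 1 - x) * cos y| <= e1 * t * 1.
  by rewrite normrM; apply: ler_pM => //; apply: le_trans h1 _; rewrite ler_pM2l.
have b2 : `|(1 + x) * (cos y - 1)| <= 2 * (e1 * t).
  rewrite normrM; apply: ler_pM => //; first by apply: le_trans (ler_normD _ _) _; rewrite normr1; lra.
  by apply: le_trans h3 _; rewrite ler_pM2l.
have b3 : `|expR x * (sin y - y)| <= 3 * (e1 * t).
  by rewrite normrM; apply: ler_pM => //; apply: le_trans h2 _; rewrite ler_pM2l.
have b4 : `|(expR x - 1 - x) * y| <= e1 * t * 1.
  rewrite normrM; apply: ler_pM => //; last by lra.
  by apply: le_trans h1 _; rewrite ler_pM2l.
have b5 : `|x * y| <= e1 * t.
  by rewrite normrM; apply: ler_pM => //; lra.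
have s1 := ler_normD ((expR x - 1 - x) * cos y) ((1 + x) * (cos y - 1)).
have s2 := ler_normD (expR x * (sin y - y) + (expR x - 1 - x) * y) (x * y).
have s3 := ler_normD (expR x * (sin y - y)) ((expR x - 1 - x) * y).
have : e1 * t <= e / 8 * t by rewrite ler_wpM2r.
lra.
Qed.

Lemma cder_cexp z : cder (@cexp R) z (cexp z).
Proof.
have h : cder (fun w => w - z) z 1.
  by have := cderB (cder_id z) (cder_cst z z); rewrite subr0.
have h0 : cder (@cexp R) (z - z) 1 by rewrite subrr; exact: cder_cexp0.
have := cderZ (cexp z) (cder_comp h h0); rewrite !mulr1.
by apply: (cder_eq ltr01) => w _; rewrite -cexpD addrC subrK.
Qed.

Lemma entire_cexp : entire (@cexp R).
Proof. by apply/entireP => z; exists (cexp z); exact: cder_cexp. Qed.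

Lemma cexp_surj z : z != 0 -> exists s, cexp s = z.
Proof.
move=> z0; have c0 : 0 < cmod z by rewrite cmod_gt0.
case: z z0 c0 => a b z0 c0; set r := cmod _ in c0.
have r2 : a ^+ 2 + b ^+ 2 = r ^+ 2 by rewrite sqr_cmod.
have ar : -1 <= a / r <= 1.
  by rewrite -ler_norml normrM normfV (ger0_norm (ltW c0)) ler_pdivrMr // mul1r; exact: (Re_le_cmod (a +i* b)).
have hs : sin (acos (a / r)) = `|b| / r.
  rewrite sin_acos //; have -> : 1 - (a / r) ^+ 2 = (b / r) ^+ 2.
    by rewrite !expr_div_n -r2; field; rewrite r2 expf_neq0 // gt_eqF.
  by rewrite sqrtr_sqr normrM normfV (ger0_norm (ltW c0)).
have hc : cos (acos (a / r)) = a / r by apply: acosK; rewrite in_itv.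
exists (ln r +i* (if 0 <= b then acos (a / r) else - acos (a / r))).
apply/complex_eq; rewrite ?(Re_cexp, Im_cexp) /= lnK //.
  by case: ifP => _; rewrite ?cosN hc mulrC divfK // gt_eqF.
case: ifPn => hb; rewrite ?sinN hs.
  by rewrite ger0_norm // mulrC divfK // gt_eqF.
rewrite -ltNge in hb.
by rewrite ltr0_norm // mulNr opprK mulrC divfK // gt_eqF.
Qed.

Lemma cexp_eq1 z : `|complex.Im z| <= pi -> cexp z = 1 -> z = 0.
Proof.
move: z => [x y] /= yp h.
have x0 : x = 0.
  by have := cmod_cexp (x +i* y); rewrite h cmod1 /= -expR0 => /expR_inj.
have : complex.Re (cexp (x +i* y)) = 1 by rewrite h.
rewrite Re_cexp /= x0 expR0 mul1r -cos_norm -cos0 => /cos_inj.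
rewrite !in_itv /= normr_ge0 yp lexx pi_ge0 => /(_ isT isT) /eqP.
by rewrite normr_eq0 => /eqP ->.
Qed.

Lemma cexp_2pi z : cexp (z + 0 +i* (2 * pi)) = cexp z.
Proof.
rewrite cexpD; have -> : cexp (0 +i* (2 * pi)) = 1 :> R[i]; last by rewrite mulr1.
apply/complex_eq; rewrite ?(Re_cexp, Im_cexp) /= expR0 mul1r.
  by rewrite mulr_natl cos2pi.
by rewrite mulr_natl sin2pi.
Qed.

Lemma cexp_inj z w : `|complex.Im z - complex.Im w| <= pi -> cexp z = cexp w -> z = w.
Proof.
move=> h E; apply/eqP; rewrite -subr_eq0; apply/eqP/cexp_eq1; first by rewrite cImD cImN.
by rewrite cexpD cexpN E divff // cexp_neq0.
Qed.

End ComplexExponential.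

(** * Linearity and periodicity of integrals over vertical segments *)

Section VerticalIntegrals.
Variable R : realType.

Lemma rintZ (c : R) (g : R -> R) a b : continuous g ->
  rint (fun x => c * g x) a b = c * rint g a b.
Proof.
move=> /continuous_primitive[G hG]; rewrite (rintE _ _ hG).
have h x : is_derive x (1 : R) (fun x => c * G x) (c * g x) by exact: is_deriveZ.
by rewrite (rintE _ _ h); ring.
Qed.

Lemma rint_periodic (g : R -> R) T a : continuous g -> (forall x, g (x + T) = g x) ->
  rint g a (a + T) = rint g 0 T.
Proof.
move=> /continuous_primitive[G hG] gT; rewrite !(rintE _ _ hG).
have h x : is_derive x (1 : R) (fun x => G (x + T) - G x) 0.
  have hT : is_derive x (1 : R) (fun x => x + T) (1 + 0).
    exact: is_deriveD (is_derive_id x (1 : R)) (is_derive_cst T x (1 : R)).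
  have h1 := is_derive1_comp (f := G) (g := fun x => x + T) (hG (x + T)) hT.
  have := is_deriveB h1 (hG x).
  by rewrite addr0 /GRing.scale /= ?mul1r ?mulr1 gT subrr.
by have := is_derive_0_is_cst a 0 h; rewrite add0r.
Qed.

Lemma vintZ (c : R[i]) (k : R[i] -> R[i]) x a b : (forall z, ccont k z) ->
  vint (fun z => c * k z) x a b = c * vint k x a b.
Proof.
move=> kc; have [c1 c2] := line_continuous kc (cmod_vline x).
have cZ (r : R) (g : R -> R) : continuous g -> continuous (fun x => r * g x).
  by move=> cg y; exact: (continuousM (cvg_cst r) (cg y)).
apply/complex_eq; rewrite ?(cReM, cImM) /=.
  rewrite -!rintZ // (_ : forall u v : R, u - v = u + -1 * v); last by move=> u v; rewrite mulN1r.
  rewrite -rintZ; last exact: cZ.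
  rewrite -rintD; [|exact: cZ|exact/cZ/cZ].
  by congr rint; apply/funext => y; rewrite cReM; ring.
rewrite -!rintZ // -rintD; [|exact: cZ|exact: cZ].
by congr rint; apply/funext => y; rewrite cImM; ring.
Qed.

Lemma vint_sum N (k : nat -> R[i] -> R[i]) x a b : (forall n z, ccont (k n) z) ->
  vint (fun z => \sum_(n < N) k n z) x a b = \sum_(n < N) vint (k n) x a b.
Proof.
move=> kc; suff : (forall z, ccont (fun z => \sum_(n < N) k n z) z) /\
    vint (fun z => \sum_(n < N) k n z) x a b = \sum_(n < N) vint (k n) x a b by case.
elim: N => [|N [cN IH]].
  have -> : (fun z => \sum_(n < 0) k n z) = fun=> 0 by apply/funext => z; rewrite big_ord0.
  rewrite big_ord0; split=> [z|]; first exact: (cder_cont (cder_cst _ _)).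
  by rewrite (vint_prim _ _ _ (K := fun=> 0)) ?subrr ?mulr0 // => z; exact: cder_cst.
have -> : (fun z => \sum_(n < N.+1) k n z) = fun z => \sum_(n < N) k n z + k N z.
  by apply/funext => z; rewrite big_ord_recr.
rewrite big_ord_recr /= -IH; split; last by rewrite vintD.
by move=> z; exact: ccontD.
Qed.

Lemma vint_periodic (k : R[i] -> R[i]) x a T : (forall z, ccont k z) ->
  (forall y, k (x +i* (y + T)) = k (x +i* y)) -> vint k x a (a + T) = vint k x 0 T.
Proof.
move=> kc kT; have [c1 c2] := line_continuous kc (cmod_vline x).
by apply/complex_eq => /=; apply: rint_periodic => // y; rewrite kT.
Qed.

End VerticalIntegrals.

(** * Cauchy's formula and Taylor expansion in a disc *)

Section Taylor.
Variable R : realType.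
Implicit Types (f H : R[i] -> R[i]) (z w s : R[i]).

Lemma cexp_vperiod x y : cexp (x +i* (y + 2 * pi)) = cexp (x +i* y) :> R[i].
Proof.
by rewrite -[RHS]cexp_2pi; congr cexp; apply/complex_eq; rewrite ?(cReD, cImD) /= ?addr0.
Qed.

(* In the coordinate s = log w the circles become vertical segments, and the
   horizontal sides of a rectangle of height 2 pi cancel by periodicity. *)
Lemma circle_integral0 H z r : 0 < r -> cmod z < r -> (forall w, ccont H w) ->
  (forall w, w != z -> exists D, cder H w D) ->
  vint (fun s => H (cexp s) * cexp s) (ln r) 0 (2 * pi) = 0.
Proof.
move=> r0 zr Hc Hd; set k := fun s => _.
have kc s : ccont k s.
  have ec := cder_cont (cder_cexp s).
  by apply: ccontM => //; apply: (ccont_comp ec).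
have kper x y : k (x +i* (y + 2 * pi)) = k (x +i* y) by rewrite /k cexp_vperiod.
have kd s : cexp s != z -> exists D, cder k s D.
  move=> /Hd[D hD]; eexists; apply: cderM (cder_cexp s); exact: (cder_comp (cder_cexp s) hD).
have pi0 : 0 < pi :> R := pi_gt0 R.
(* For z != 0 the strip is centred at the height of a logarithm s0 of z. By [cexp_inj] it then
   contains no other logarithm of z, and s0 lies inside the first rectangle and outside the second.
   For z = 0 there is no logarithm and any height will do. *)
have [t ht] : exists t : R, forall x, (x < ln r /\ (z != 0 -> expR x < cmod z)) ->
    rectint k x (ln r + 1) (t - pi) (t + pi) = 0 /\ rectint k (ln r) (ln r + 1) (t - pi) (t + pi) = 0.
  have [z0|z0] := eqVneq z 0.
    exists 0 => x [xr _]; split; apply: goursat => //; try lra.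
      by move=> s _ _; apply: kd; rewrite z0 cexp_neq0.
    by move=> s _ _; apply: kd; rewrite z0 cexp_neq0.
  have [s0 hs0] := cexp_surj z0; exists (complex.Im s0) => x [xr xz].
  have Es0 : cmod z = expR (complex.Re s0) by rewrite -hs0 cmod_cexp.
  have {}xz : x < complex.Re s0 by have := xz isT; rewrite Es0 ltr_expR.
  have s0r : complex.Re s0 < ln r by rewrite -ltr_expR lnK // -Es0.
  have kd' s : complex.Im s0 - pi <= complex.Im s <= complex.Im s0 + pi -> s != s0 ->
      exists D, cder k s D.
    move=> hs ss0; apply: kd; apply: contra_neq ss0; rewrite -hs0; apply: cexp_inj.
    by rewrite ler_norml; lra.
  split.
    apply: (@goursat_punctured R k _ _ _ _ s0) => //; [lra|lra|].
    by move=> s _ hs; exact: kd'.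
  apply: goursat => //; [lra|lra|] => s /andP[hs1 _] hs2; apply: kd' => //.
  by apply/eqP => E; rewrite E in hs1; lra.
have vE x x' : rectint k x x' (t - pi) (t + pi) = 'i * (vint k x' 0 (2 * pi) - vint k x 0 (2 * pi)).
  have -> : t + pi = t - pi + 2 * pi by ring.
  rewrite /rectint !vint_periodic //.
  have -> : hint k (t - pi + 2 * pi) x x' = hint k (t - pi) x x'.
    by rewrite /hint; congr (_ +i* _); congr rint; apply/funext => y; rewrite kper.
  by ring.
have i0 : 'i != 0 :> R[i] by rewrite -cmod_gt0 cmodi.
have vr x : x < ln r -> (z != 0 -> expR x < cmod z) -> vint k (ln r) 0 (2 * pi) = vint k x 0 (2 * pi).
  move=> h1 h2; have [] := ht x (conj h1 h2); rewrite !vE.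
  move=> /eqP; rewrite mulf_eq0 (negPf i0) subr_eq0 => /eqP <-.
  by move=> /eqP; rewrite mulf_eq0 (negPf i0) subr_eq0 => /eqP <-.
apply/eqP; rewrite -cmod_eq0 eq_le cmod_ge0 andbT.
apply/ler_addgt0Pr => e e0; rewrite add0r.
have [d d0 hd] := Hc 0 1 ltr01.
pose M := cmod (H 0) + 1; have M0 : 0 < M by rewrite ltr_wpDl // cmod_ge0.
(* The radius of a small circle, on which the integrand is at most M m and the integral at most 4 pi
   M m. The last two bounds keep it below r and, for z != 0, below |z|, as [vr] requires; 1 fills in
   when z = 0. *)
pose m := Num.min (Num.min (d / 2) (e / (4 * pi * M))) (Num.min (r / 2) (if z == 0 then 1 else cmod z / 2)).
have m0 : 0 < m.
  rewrite !lt_min !divr_gt0 ?mulr_gt0 //=.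
  by case: ifPn => // z0; rewrite divr_gt0 // cmod_gt0.
have m1 : m <= d / 2 by rewrite !ge_min lexx.
have m2 : m <= e / (4 * pi * M) by rewrite !ge_min lexx !orbT.
have m3 : m <= r / 2 by rewrite !ge_min lexx !orbT.
have m4 : z != 0 -> m <= cmod z / 2 by move=> /negPf z0; rewrite /m z0 !ge_min lexx !orbT.
rewrite (vr (ln m)); first last.
- by move=> z0; rewrite lnK //; have := m4 z0; have := cmod_gt0 z; rewrite z0 => /= ? ?; lra.
- by rewrite -ltr_expR !lnK //; lra.
apply: le_trans (vint_le (M := M * m) kc _ _) _; first by lra.
  move=> y _; rewrite /k cmodM cmod_cexp /= lnK // ler_wpM2r ?(ltW m0) //.
  have /hd : cmod (cexp (ln m +i* y) - 0) < d by rewrite subr0 cmod_cexp /= lnK //; lra.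
  by have := cmod_dist (H (cexp (ln m +i* y))) (H 0); rewrite /M; lra.
have -> : 2 * (M * m) * (2 * pi - 0) = m * (4 * pi * M) by ring.
by rewrite -ler_pdivlMr // !mulr_gt0.
Qed.

Lemma vint_cexpVX n x : vint (fun s => (cexp s)^-1 ^+ n) x 0 (2 * pi) = (if n == 0%N then (2 * pi)%:C else 0) :> R[i].
Proof.
case: n => [|n] /=.
  have -> : (fun s : R[i] => (cexp s)^-1 ^+ 0) = fun=> 1 by apply/funext => s; rewrite expr0.
  rewrite (vint_prim _ _ _ (K := id)); last by move=> s; exact: cder_id.
  by apply/complex_eq; rewrite !(cReM, cImM, cReD, cImD, cReN, cImN) /=; ring.
have n0 : n.+1%:R != 0 :> R[i] by rewrite pnatr_eq0.
have h s : cder (fun s : R[i] => (- n.+1%:R)^-1 * cexp (- n.+1%:R * s)) s ((cexp s)^-1 ^+ n.+1).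
  have := cderZ (- n.+1%:R)^-1 (cder_comp (cderZ (- n.+1%:R) (cder_id s)) (cder_cexp (- n.+1%:R * s))).
  rewrite mulr1 [_ * - _]mulrC mulKf ?oppr_eq0 //.
  by rewrite -cexpN -cexpMn mulrN mulNr.
rewrite (vint_prim _ _ _ h).
have cE y : cexp (- n.+1%:R * (x +i* y)) = (cexp (x +i* y))^-1 ^+ n.+1.
  by rewrite -cexpN -cexpMn mulrN mulNr.
by rewrite !cE -[2 * pi]add0r cexp_vperiod subrr mulr0.
Qed.

(** The coefficients are the Fourier integrals of f over the circle of radius r, so they depend on r
    a priori; [taylor] removes this dependence. The bound M is quantified after c, so one sequence
    serves every M. *)
Lemma taylor_at_radius f (r : R) : entire f -> 0 < r -> exists c : nat -> R[i],
  forall M, (forall w, cmod w = r -> cmod (f w) <= M) ->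
  forall N z, cmod z <= r / 2 ->
    cmod (f z - \sum_(n < N) c n * z ^+ n) <= 40 * M * (cmod z / r) ^+ N.
Proof.
move=> /entireP fd r0; have pi0 : 0 < pi :> R := pi_gt0 R.
pose g n (s : R[i]) := f (cexp s) * (cexp s)^-1 ^+ n.
pose u n (s : R[i]) := (cexp s)^-1 ^+ n.
have uc n s : ccont (u n) s.
  have := entireX (n := n) (entireV (@entire_cexp R) (@cexp_neq0 R)).
  by move=> /entireP /(_ s) [D]; exact: cder_cont.
have gc n s : ccont (g n) s.
  apply: ccontM (uc n s); have [D hD] := fd (cexp s).
  exact: cder_cont (cder_comp (cder_cexp s) hD).
pose c n := vint (g n) (ln r) 0 (2 * pi) / (2 * pi)%:C; exists c => M fM N z zr.
have pic0 : (2 * pi)%:C != 0 :> R[i] by rewrite (inj_eq (@complexI R) _ 0) gt_eqF // mulr_gt0.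
have M0 : 0 <= M.
  by apply: le_trans (fM r%:C _); rewrite ?cmod_ge0 // cmodC ger0_norm // ltW.
have [D hD] := fd z.
(* The difference quotient of f, completed by D at z, is continuous everywhere and holomorphic off
   z, hence admissible in [circle_integral0]. Its vanishing integral is Cauchy's formula. *)
pose H w := if w == z then D else (f w - f z) / (w - z).
have HE w : H w * (w - z) = f w - f z.
  rewrite /H; case: eqVneq => [->|wz]; first by rewrite !subrr mulr0.
  by rewrite divfK // subr_eq0.
have Hd w : w != z -> exists D, cder H w D.
  move=> wz; have [E hE] := fd w.
  have wz0 : w - z != 0 by rewrite subr_eq0.
  have h1 := cderB hE (cder_cst (f z) w).
  have h2 := cder_inv (F := fun v => v - z) wz0 (cderB (cder_id w) (cder_cst z w)).
  have dz : 0 < cmod (w - z) by rewrite cmod_gt0.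
  have h3 := cderM h1 h2; eexists; apply: (cder_eq dz _ h3) => w' hw'; rewrite /H; case: eqVneq => // E'.
  by rewrite E' -cmodN opprB ltxx in hw'.
have Hc w : ccont H w.
  have [->|/Hd[E]] := eqVneq w z; last exact: cder_cont.
  move=> e e0; have e20 : 0 < e / 2 by rewrite divr_gt0.
  have [d d0 hd] := hD _ e20; exists d => // w' /hd.
  rewrite {2}/H eqxx; have [->|wz] := eqVneq w' z; first by move=> _; rewrite /H eqxx subrr cmod0.
  have wz0 : 0 < cmod (w' - z) by rewrite cmod_gt0 subr_eq0.
  rewrite -HE -mulrBl cmodM ler_pM2r // => /le_lt_trans; apply.
  by rewrite [ltRHS]splitr ltrDl.
pose k s := H (cexp s) * cexp s.
have kc s : ccont k s.
  have ec := cder_cont (cder_cexp s).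
  by apply: ccontM => //; apply: (ccont_comp ec).
have zr' : cmod z < r by lra.
have k0 : vint k (ln r) 0 (2 * pi) = 0 by exact: circle_integral0 zr' Hc Hd.
pose q s := z * (cexp s)^-1.
have kq s : k s * (1 - q s) = f (cexp s) - f z.
  by rewrite -HE /k /q -mulrA; congr (_ * _); field; exact: cexp_neq0.
(* The geometric expansion of 1 / (1 - z / w) to order n, integrated over the circle. The term f z
   arises from the summand m = 0, hence the factor 0 on the left when n = 0. *)
have key n : f z * (if n == 0%N then 0 else 1) = \sum_(m < n) c m * z ^+ m + (2 * pi)%:C^-1 * vint (fun s => z ^+ n * (k s * u n s)) (ln r) 0 (2 * pi).
  have h1 s : \sum_(m < n) (z ^+ m * g m s + - (f z * z ^+ m) * u m s) + z ^+ n * (k s * u n s) = k s.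
    have -> : \sum_(m < n) (z ^+ m * g m s + - (f z * z ^+ m) * u m s) = (f (cexp s) - f z) * \sum_(m < n) q s ^+ m.
      rewrite mulr_sumr; apply: eq_bigr => m _; rewrite /g /u /q exprMn; ring.
    rewrite -kq -mulrA -opprB mulNr -subrX1 /u /q exprMn; ring.
  have hc1 m s : ccont (fun s => z ^+ m * g m s) s by apply: ccontM => //; exact: cder_cont (cder_cst _ _).
  have hc2 m s : ccont (fun s => - (f z * z ^+ m) * u m s) s by apply: ccontM => //; exact: cder_cont (cder_cst _ _).
  have hc3 m s : ccont (fun s => z ^+ m * g m s + - (f z * z ^+ m) * u m s) s by exact: ccontD.
  have hc4 s : ccont (fun s => \sum_(m < n) (z ^+ m * g m s + - (f z * z ^+ m) * u m s)) s.
    move: (n) => p; elim: p => [|p IHp] in s *.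
      have -> : (fun s => \sum_(m < 0) (z ^+ m * g m s + - (f z * z ^+ m) * u m s)) = fun=> 0.
        by apply/funext => s'; rewrite big_ord0.
      exact: cder_cont (cder_cst _ _).
    have -> : (fun s => \sum_(m < p.+1) (z ^+ m * g m s + - (f z * z ^+ m) * u m s)) =
       fun s => \sum_(m < p) (z ^+ m * g m s + - (f z * z ^+ m) * u m s) + (z ^+ p * g p s + - (f z * z ^+ p) * u p s).
      by apply/funext => s'; rewrite big_ord_recr.
    exact: ccontD.
  have hc5 s : ccont (fun s => z ^+ n * (k s * u n s)) s.
    by apply: ccontM; [exact: cder_cont (cder_cst _ _)|exact: ccontM].
  have := vintD (ln r) 0 (2 * pi) hc4 hc5.
  have -> : (fun s => \sum_(m < n) (z ^+ m * g m s + - (f z * z ^+ m) * u m s) + z ^+ n * (k s * u n s)) = k.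
    by apply/funext => s; exact: h1.
  have /= sumE := @vint_sum R n _ (ln r) 0 (2 * pi) hc3.
  rewrite k0 sumE => E.
  have {}E : \sum_(m < n) (z ^+ m * vint (g m) (ln r) 0 (2 * pi) - f z * z ^+ m * (if m == 0%N :> nat then (2 * pi)%:C else 0)) + vint (fun s => z ^+ n * (k s * u n s)) (ln r) 0 (2 * pi) = 0.
    rewrite [RHS]E; congr (_ + _); apply: eq_bigr => m _.
    by rewrite vintD // !vintZ // vint_cexpVX mulNr.
  have -> : vint (fun s => z ^+ n * (k s * u n s)) (ln r) 0 (2 * pi) =
      - \sum_(m < n) (z ^+ m * vint (g m) (ln r) 0 (2 * pi) - f z * z ^+ m * (if m == 0%N :> nat then (2 * pi)%:C else 0)).
    by apply/eqP; rewrite -addr_eq0 addrC E.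
  rewrite mulrN mulr_sumr -sumrB; case: (n) => [|p]; first by rewrite !big_ord0 mulr0.
  rewrite big_ord_recl /= expr0 !mulr1 big1 ?addr0 => [|m _].
    by move: pic0; rewrite /c; move: (2 * pi)%:C => e e0; field.
  by rewrite /= mulr0 subr0 /c; move: (2 * pi)%:C => e; ring.
have kle s : complex.Re s = ln r -> cmod (k s) <= 2 * (M + cmod (f z)).
  move=> sr; have cs : cmod (cexp s) = r by rewrite cmod_cexp sr lnK.
  have h1 : 1 / 2 <= cmod (1 - q s).
    have := cmod_dist 1 (q s); rewrite cmod1 cmodf cs.
    have : cmod z / r <= 1 / 2 by rewrite ler_pdivrMr //; lra.
    by lra.
  have := cmodBD (f (cexp s)) (f z); rewrite -kq cmodM => h2.
  have h3 := fM _ cs.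
  have : cmod (k s) * (1 / 2) <= cmod (k s) * cmod (1 - q s) by rewrite ler_wpM2l ?cmod_ge0.
  by lra.
have cE y : cmod (cexp (ln r +i* y)) = r by rewrite cmod_cexp /= lnK.
clearbody k.
have vle n : cmod ((2 * pi)%:C^-1 * vint (fun s => z ^+ n * (k s * u n s)) (ln r) 0 (2 * pi)) <=
    4 * (M + cmod (f z)) * (cmod z / r) ^+ n.
  rewrite cmodM cmodV cmodC ger0_norm ?mulr_ge0 ?(ltW pi0) //.
  rewrite ler_pdivrMl ?mulr_gt0 //.
  apply: le_trans (vint_le (M := 2 * (M + cmod (f z)) * (cmod z / r) ^+ n) _ _ _) _.
  - move=> s; apply: ccontM; [exact: cder_cont (cder_cst _ _)|exact: ccontM].
  - by rewrite mulr_ge0 // ltW.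
  - move=> y _; rewrite (cmodM (z ^+ n)) (cmodM (k _)) cmodX /u cmodX cmodV cE expr_div_n exprVn.
    rewrite mulrCA ler_wpM2r ?kle //.
    by rewrite divr_ge0 // exprn_ge0 ?cmod_ge0 // ltW.
  by rewrite le_eqVlt; apply/orP; left; apply/eqP; ring.
have cle m : cmod (c m) * r ^+ m <= 2 * M.
  rewrite /c cmodf cmodC ger0_norm ?mulr_ge0 ?(ltW pi0) // mulrAC ler_pdivrMr ?mulr_gt0 //.
  rewrite -ler_pdivlMr ?exprn_gt0 //.
  apply: le_trans (vint_le (M := M / r ^+ m) _ _ _) _ => //.
  - by rewrite mulr_ge0 // ltW.
  - move=> y _; rewrite /g cmodM cmodX cmodV cE exprVn ler_wpM2r ?invr_ge0 ?exprn_ge0 ?(ltW r0) //.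
    by apply: fM; rewrite cE.
  by rewrite le_eqVlt; apply/orP; left; apply/eqP; ring.
have q2 : cmod z / r <= 1 / 2 by rewrite ler_pdivrMr //; lra.
have q0 : 0 <= cmod z / r by rewrite divr_ge0 ?cmod_ge0 // ltW.
have tle m : cmod (c m * z ^+ m) <= 2 * M * (1 / 2) ^+ m.
  rewrite cmodM cmodX -[cmod z](@divfK _ r) ?gt_eqF // exprMn mulrCA mulrC.
  by apply: ler_pM; rewrite ?cle ?mulr_ge0 ?cmod_ge0 ?exprn_ge0 ?(ltW r0) // lerXn2r // nnegrE; lra.
(* Order n = 3 gives |f z| <= 4 M + |f z| / 2, a crude maximum principle on the half disc. It turns
   4 (M + |f z|) into 40 M. *)
have fz : cmod (f z) <= 9 * M.
  have := key 3%N; rewrite mulr1 => fE.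
  have : cmod (f z) <= 2 * M * (1 / 2) ^+ 0 + 2 * M * (1 / 2) ^+ 1 + 2 * M * (1 / 2) ^+ 2 + 4 * (M + cmod (f z)) * (1 / 2) ^+ 3.
    rewrite {1}fE; apply: le_trans (cmodD _ _) _; apply: lerD; last first.
      apply: le_trans (vle 3%N) _; rewrite ler_wpM2l ?mulr_ge0 ?addr_ge0 ?cmod_ge0 //.
      by rewrite lerXn2r // nnegrE; lra.
    apply: le_trans (cmod_sum _ _ _) _; rewrite !big_ord_recr big_ord0 /= add0r.
    by apply: lerD; [apply: lerD|]; exact: tle.
  rewrite expr0 expr1 !exprS expr0; lra.
have hM : 4 * (M + cmod (f z)) <= 40 * M by lra.
have := key N; case: N => [_|N]; first by rewrite big_ord0 subr0 expr0 mulr1; lra.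
rewrite mulr1 => {1}->; rewrite addrC addKr; apply: le_trans (vle _) _.
by rewrite ler_wpM2r // exprn_ge0.
Qed.

End Taylor.

(** * Power series with infinite radius of convergence *)

Section PowerSeries.
Variable R : realType.
Implicit Types (f g : R[i] -> R[i]) (z w : R[i]) (c : nat -> R[i]) (r M C : R).

Lemma entire_bounded f r : entire f ->
  exists2 M, 0 <= M & forall z, cmod z <= r -> cmod (f z) <= M.
Proof.
move=> /entireP fd; have [r0|r0] := ltP r 0.
  by exists 0 => // z zr; have := cmod_ge0 z; lra.
have [|||M hM] := @ccont_bounded R f (- r) r (- r) r; try lra.
  by move=> z; have [D] := fd z; exact: cder_cont.
have hM' z : cmod z <= r -> cmod (f z) <= M.
  move=> zr; apply: hM; rewrite -ler_norml.
    exact: le_trans (Re_le_cmod z) zr.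
  exact: le_trans (Im_le_cmod z) zr.
exists M => //; apply: le_trans (cmod_ge0 (f 0)) (hM' 0 _); by rewrite cmod0.
Qed.

(** By induction the first N coefficients cancel, and dividing the estimate of order N + 1 by |z|^N
    leaves a difference that is O(|z|). *)
Lemma taylor_uniq c c' (rho : R) : 0 < rho ->
  (forall N, exists C, forall z, cmod z <= rho ->
     cmod (\sum_(n < N) c n * z ^+ n - \sum_(n < N) c' n * z ^+ n) <= C * cmod z ^+ N) ->
  c =1 c'.
Proof.
move=> rho0 h N; elim/ltn_ind: N => N IH.
have [C hC] := h N.+1; apply/eqP; rewrite -subr_eq0 -cmod_eq0 eq_le cmod_ge0 andbT.
apply/ler_addgt0Pr => e e0; rewrite add0r.
have K0 : 0 < `|C| + 1 by rewrite ltr_wpDl.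
pose t := Num.min rho (e / (`|C| + 1)).
have t0 : 0 < t by rewrite lt_min rho0 divr_gt0.
have t1 : t <= rho by rewrite ge_min lexx.
have t2 : t * (`|C| + 1) <= e by rewrite -ler_pdivlMr // ge_min lexx orbT.
have ct : cmod t%:C = t by rewrite cmodC ger0_norm // ltW.
have := hC t%:C; rewrite ct => /(_ t1).
rewrite !big_ord_recr /= (_ : \sum_(i < N) c i * _ = \sum_(i < N) c' i * t%:C ^+ i); last first.
  by apply: eq_bigr => i _; rewrite IH.
rewrite opprD addrACA subrr add0r -mulrBl cmodM cmodX ct.
rewrite exprS mulrA ler_pM2r ?exprn_gt0 // => /le_trans; apply.
apply: le_trans t2; rewrite mulrC ler_wpM2l ?(ltW t0) //.
by rewrite (le_trans (ler_norm C)) // lerDl.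
Qed.

(** The Cauchy remainder estimate for all radii at once. Later arguments choose r, and often N, to
    suit: N = 0 for a maximum principle, N = 1 for a Schwarz lemma, r = 2 rho for a geometric
    error. *)
Definition taylor_coefs c f := forall r M, 0 < r ->
  (forall w, cmod w = r -> cmod (f w) <= M) -> forall N z, cmod z <= r / 2 ->
  cmod (f z - \sum_(n < N) c n * z ^+ n) <= 40 * M * (cmod z / r) ^+ N.

(** The expansions obtained at radius 1 and at radius r both hold near 0, to every order, so
    [taylor_uniq] identifies their coefficients. *)
Theorem taylor f : entire f -> exists c, taylor_coefs c f.
Proof.
move=> fe; have [c hc] := taylor_at_radius fe (ltr01 : 0 < (1 : R)); exists c => r M r0 fM.
have [c' hc'] := taylor_at_radius fe r0.
suff -> : c = c' by exact: hc'.
have [M1 M10 hM1] := entire_bounded 1 fe.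
have {}hM1 w : cmod w = 1 -> cmod (f w) <= M1 by move=> w1; rewrite hM1 ?w1.
apply/funext; apply: (@taylor_uniq _ _ (Num.min (1 / 2) (r / 2))).
  by rewrite lt_min !divr_gt0.
move=> N; exists (40 * M1 + 40 * M / r ^+ N) => z; rewrite le_min => /andP[z1 z2].
have h1 := hc _ hM1 N z z1; have h2 := hc' _ fM N z z2.
have -> : \sum_(n < N) c n * z ^+ n - \sum_(n < N) c' n * z ^+ n =
  (f z - \sum_(n < N) c' n * z ^+ n) - (f z - \sum_(n < N) c n * z ^+ n) by ring.
apply: le_trans (cmodBD _ _) _; rewrite [leLHS]addrC mulrDl; apply: lerD.
  by move: h1; rewrite divr1.
by move: h2; rewrite expr_div_n; congr (_ <= _); rewrite mulrA mulrAC.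
Qed.

(** The remainder estimate of order 0 at the centre, standing in for the maximum principle. *)
Lemma cauchy_bound0 f r M : entire f -> 0 < r ->
  (forall w, cmod w = r -> cmod (f w) <= M) -> cmod (f 0) <= 40 * M.
Proof.
move=> /taylor[c hc] r0 fM; have := hc _ _ r0 fM 0%N 0.
by rewrite cmod0 big_ord0 subr0 expr0 mulr1; apply; rewrite divr_ge0 // ltW.
Qed.

Lemma schwarz_bound f r M z : entire f -> 0 < r ->
  (forall w, cmod w = r -> cmod (f w) <= M) -> cmod z <= r / 2 ->
  cmod (f z - f 0) <= 40 * M * (cmod z / r).
Proof.
move=> /taylor[c hc] r0 fM zr.
have : cmod (f 0 - c 0%N) <= 0.
  have := hc _ _ r0 fM 1%N 0.
  rewrite cmod0 big_ord1 expr0 mulr1 mul0r expr1 mulr0; apply.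
  by rewrite divr_ge0 // ltW.
rewrite le_eqVlt ltNge cmod_ge0 orbF cmod_eq0 subr_eq0 => /eqP ->.
by have := hc _ _ r0 fM 1%N z zr; rewrite big_ord1 expr0 mulr1 expr1.
Qed.

Definition entire_coefs c := forall r, 0 < r ->
  exists2 C, 0 <= C & forall n, cmod (c n) * r ^+ n <= C.

Definition pser c z (l : R[i]) := forall e : R, 0 < e -> exists N0 : nat,
  forall N, (N0 <= N)%N -> cmod (l - \sum_(n < N) c n * z ^+ n) < e.

Lemma taylor_coefs_entire c f : entire f -> taylor_coefs c f -> entire_coefs c.
Proof.
move=> fe hc r r0; have [M M0 hM] := entire_bounded r fe.
exists (60 * M) => [|n]; first by rewrite mulr_ge0.
have fM w : cmod w = r -> cmod (f w) <= M by move=> wr; rewrite hM ?wr.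
have cz : cmod (r / 2)%:C = r / 2 by rewrite cmodC ger0_norm // divr_ge0 // ltW.
have := hc _ _ r0 fM n.+1 (r / 2)%:C; have := hc _ _ r0 fM n (r / 2)%:C.
rewrite cz => /(_ (lexx _)) h1 /(_ (lexx _)) h2.
have q : r / 2 / r = 1 / 2 by field; rewrite gt_eqF.
rewrite q big_ord_recr /= in h1 h2.
have : cmod (c n * (r / 2)%:C ^+ n) <= 40 * M * (1 / 2) ^+ n + 40 * M * (1 / 2) ^+ n.+1.
  apply: le_trans (lerD h1 h2); apply: le_trans (cmodBD _ _).
  by rewrite le_eqVlt; apply/orP; left; apply/eqP; congr cmod; ring.
rewrite cmodM cmodX cz exprMn mulrA exprS => h.
have p2 : 0 < (2^-1 : R) ^+ n by rewrite exprn_gt0 // invr_gt0.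
rewrite -(ler_pM2r p2) (le_trans h) // mul1r le_eqVlt; apply/orP; left; apply/eqP; field; exact: isT.
Qed.

Lemma taylor_pser c f z : entire f -> taylor_coefs c f -> pser c z (f z).
Proof.
move=> fe hc e e0; pose r := 2 * cmod z + 1.
have r0 : 0 < r by rewrite ltr_wpDl // mulr_ge0 // cmod_ge0.
have [M M0 hM] := entire_bounded r fe.
have fM w : cmod w = r -> cmod (f w) <= M by move=> wr; rewrite hM ?wr.
exists (Num.truncn (40 * M / e)).+1 => N hN.
have zr : cmod z <= r / 2 by rewrite /r; lra.
apply: le_lt_trans (hc _ _ r0 fM N z zr) _.
have q : cmod z / r <= 1 / 2 by rewrite ler_pdivrMr //; lra.
have q0 : 0 <= cmod z / r by rewrite divr_ge0 ?cmod_ge0 // ltW.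
apply: (@le_lt_trans _ _ (40 * M * (1 / 2) ^+ N)).
  by rewrite ler_wpM2l ?mulr_ge0 // lerXn2r // nnegrE; lra.
rewrite expr_div_n expr1n mul1r ltr_pdivrMr ?exprn_gt0 // [ltRHS]mulrC -ltr_pdivrMr //.
apply: lt_trans (truncnS_gt _) _; rewrite -natrX ltr_nat.
exact: leq_ltn_trans hN (ltn_expl _ _).
Qed.

Lemma coef_tail c C r z N k : 0 <= C -> 0 < r -> (forall n, cmod (c n) * r ^+ n <= C) ->
  cmod z <= r / 2 ->
  cmod (\sum_(n < N + k) c n * z ^+ n - \sum_(n < N) c n * z ^+ n) <= 2 * C * (cmod z / r) ^+ N.
Proof.
move=> C0 r0 hC zr; set q := cmod z / r.
have q2 : q <= 1 / 2 by rewrite ler_pdivrMr //; lra.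
have q0 : 0 <= q by rewrite divr_ge0 ?cmod_ge0 // ltW.
have tle n : cmod (c n * z ^+ n) <= C * q ^+ n.
  have zE : cmod z = r * q by rewrite mulrC divfK // gt_eqF.
  by rewrite cmodM cmodX zE exprMn mulrA ler_wpM2r ?exprn_ge0.
suff : cmod (\sum_(n < N + k) c n * z ^+ n - \sum_(n < N) c n * z ^+ n) <= 2 * C * (q ^+ N - q ^+ (N + k)).
  by move=> /le_trans; apply; rewrite ler_wpM2l ?mulr_ge0 // gerBl exprn_ge0.
elim: k => [|k IH]; first by rewrite addn0 !subrr cmod0 mulr0.
rewrite addnS big_ord_recr /= -addrAC; apply: le_trans (cmodD _ _) _.
apply: le_trans (lerD IH (tle _)) _; rewrite exprS.
have : 0 <= C * q ^+ (N + k) * (1 - 2 * q) by rewrite !mulr_ge0 ?exprn_ge0 // subr_ge0; lra.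
by lra.
Qed.

Lemma pser_le c C r z l N : 0 <= C -> 0 < r -> (forall n, cmod (c n) * r ^+ n <= C) ->
  cmod z <= r / 2 -> pser c z l ->
  cmod (l - \sum_(n < N) c n * z ^+ n) <= 2 * C * (cmod z / r) ^+ N.
Proof.
move=> C0 r0 hC zr hl; apply/ler_addgt0Pr => e /hl[N0 h].
have /h h1 : (N0 <= N + N0)%N by rewrite leq_addl.
have h2 := coef_tail N N0 C0 r0 hC zr; rewrite [leRHS]addrC.
have -> : l - \sum_(n < N) c n * z ^+ n = (l - \sum_(n < N + N0) c n * z ^+ n) +
  (\sum_(n < N + N0) c n * z ^+ n - \sum_(n < N) c n * z ^+ n) by rewrite addrA subrK.
by apply: le_trans (cmodD _ _) (lerD (ltW h1) h2).
Qed.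

Lemma pser_uniq c c' f : entire_coefs c -> entire_coefs c' ->
  (forall z, pser c z (f z)) -> (forall z, pser c' z (f z)) -> c =1 c'.
Proof.
move=> hc hc' h h'; have [C C0 hC] := hc 1 ltr01; have [C' C0' hC'] := hc' 1 ltr01.
apply: (@taylor_uniq _ _ (1 / 2)) => [|N]; first by rewrite divr_gt0.
exists (2 * C + 2 * C') => z zr.
have h1 := pser_le N C0 ltr01 hC zr (h z); have h2 := pser_le N C0' ltr01 hC' zr (h' z).
have -> : \sum_(n < N) c n * z ^+ n - \sum_(n < N) c' n * z ^+ n =
  (f z - \sum_(n < N) c' n * z ^+ n) - (f z - \sum_(n < N) c n * z ^+ n) by ring.
apply: le_trans (cmodBD _ _) _; rewrite [leLHS]addrC mulrDl.
by move: h1 h2; rewrite !divr1; exact: lerD.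
Qed.

Lemma pser_lim_uniq c z l l' : pser c z l -> pser c z l' -> l = l'.
Proof.
move=> h h'; apply/eqP; rewrite -subr_eq0 -cmod_eq0 eq_le cmod_ge0 andbT.
apply/ler_addgt0Pr => e e0; rewrite add0r.
have e20 : 0 < e / 2 by rewrite divr_gt0.
have [N hN] := h _ e20; have [N' hN'] := h' _ e20.
have h1 := hN _ (leq_maxl N N'); have h2 := hN' _ (leq_maxr N N').
have -> : l - l' = (l - \sum_(n < maxn N N') c n * z ^+ n) - (l' - \sum_(n < maxn N N') c n * z ^+ n) by ring.
by apply: le_trans (cmodBD _ _) _; rewrite [e]splitr lerD ?ltW.
Qed.

(** The intervals of centre x N and radius eps N meet pairwise, so the supremum of their left ends
    lies in all of them. *)
Lemma real_limit (x eps : nat -> R) : (forall N k, `|x (N + k)%N - x N| <= eps N) ->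
  exists l, forall N, `|l - x N| <= eps N.
Proof.
move=> h; pose l := sup [set x N - eps N | N in setT].
have cross N m : x N - eps N <= x m + eps m.
  have := h N m; have := h m N; rewrite addnC !ler_norml => /andP[? ?] /andP[? ?]; lra.
exists l => N.
have h1 : x N - eps N <= l.
  by apply: sup_ubound; [exists (x 0%N + eps 0%N) => _ [m _ <-]; exact: cross|exists N].
have h2 : l <= x N + eps N.
  by apply: ge_sup; [exists (x N - eps N); exists N|move=> _ [m _ <-]; exact: cross].
by rewrite ler_norml; lra.
Qed.

Lemma entire_coefs_pser c : entire_coefs c -> exists f, forall z, pser c z (f z).
Proof.
move=> hc; suff h z : exists l, pser c z l.
  by exists (fun z => xget 0 [set l | pser c z l]) => z; case: xgetP => [l -> //|]; have [l hl] := h z => /(_ l).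
pose r := 2 * cmod z + 1.
have r0 : 0 < r by rewrite ltr_wpDl // mulr_ge0 // cmod_ge0.
have zr : cmod z <= r / 2 by rewrite /r; lra.
have [C C0 hC] := hc _ r0.
pose S N := \sum_(n < N) c n * z ^+ n.
have q2 : cmod z / r <= 1 / 2 by rewrite ler_pdivrMr //; lra.
have q0 : 0 <= cmod z / r by rewrite divr_ge0 ?cmod_ge0 // ltW.
have small e : 0 < e -> exists N0, forall N, (N0 <= N)%N -> 2 * C * (cmod z / r) ^+ N < e.
  move=> e0; exists (Num.truncn (2 * C / e)).+1 => N hN.
  apply: (@le_lt_trans _ _ (2 * C * (1 / 2) ^+ N)).
    by rewrite ler_wpM2l ?mulr_ge0 // lerXn2r // nnegrE; lra.
  rewrite expr_div_n expr1n mul1r ltr_pdivrMr ?exprn_gt0 // [ltRHS]mulrC -ltr_pdivrMr //.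
  apply: lt_trans (truncnS_gt _) _; rewrite -natrX ltr_nat.
  exact: leq_ltn_trans hN (ltn_expl _ _).
have tail N k : cmod (S (N + k)%N - S N) <= 2 * C * (cmod z / r) ^+ N by exact: coef_tail.
have [N k|x hx] := @real_limit (fun N => complex.Re (S N)) (fun N => 2 * C * (cmod z / r) ^+ N).
  by apply: le_trans (tail N k); rewrite -cReN -cReD; exact: Re_le_cmod.
have [N k|y hy] := @real_limit (fun N => complex.Im (S N)) (fun N => 2 * C * (cmod z / r) ^+ N).
  by apply: le_trans (tail N k); rewrite -cImN -cImD; exact: Im_le_cmod.
exists (x +i* y) => e e0; have [|N0 hN0] := small (e / 2); first by rewrite divr_gt0.
exists N0 => N /hN0 hN; apply: le_lt_trans (cmod_leD _) _.
rewrite !(cReD, cImD, cReN, cImN) /= [e]splitr.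
by apply: ltrD; [apply: le_lt_trans (hx N) hN|apply: le_lt_trans (hy N) hN].
Qed.

End PowerSeries.

(** * Termwise differentiation, primitives and entire logarithms *)

Section PowerSeriesDerivative.
Variable R : realType.
Implicit Types (f g : R[i] -> R[i]) (z w h : R[i]) (c : nat -> R[i]) (r M C : R).

Definition coef_deriv c n : R[i] := n.+1%:R * c n.+1.
Definition coef_prim c n : R[i] := if n is m.+1 then c m / m.+1%:R else 0.

Lemma coef_derivK c : coef_deriv (coef_prim c) =1 c.
Proof. by move=> n; rewrite /coef_deriv /= mulrC divfK // pnatr_eq0. Qed.

Lemma entire_coefs_deriv c : entire_coefs c -> entire_coefs (coef_deriv c).
Proof.
move=> hc r r0; have r20 : 0 < 2 * r by rewrite mulr_gt0.
have [C C0 hC] := hc _ r20; exists (C / (2 * r)); first by rewrite divr_ge0 // ltW.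
move=> n; rewrite ler_pdivlMr //; apply: le_trans (hC n.+1).
rewrite cmodM cmodn.
have -> : n.+1%:R * cmod (c n.+1) * r ^+ n * (2 * r) = cmod (c n.+1) * r ^+ n.+1 * (2 * n.+1%:R).
  by rewrite exprS; ring.
have -> : cmod (c n.+1) * (2 * r) ^+ n.+1 = cmod (c n.+1) * r ^+ n.+1 * (2 * 2 ^+ n).
  by rewrite exprMn (exprS 2); ring.
rewrite ler_wpM2l ?mulr_ge0 ?cmod_ge0 ?exprn_ge0 ?(ltW r0) // ler_wpM2l //.
by rewrite -natrX ler_nat; exact: ltn_expl.
Qed.

Lemma entire_coefs_prim c : entire_coefs c -> entire_coefs (coef_prim c).
Proof.
move=> hc r r0; have [C C0 hC] := hc _ r0; exists (C * r); first by rewrite mulr_ge0 // ltW.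
case=> [|n] /=; first by rewrite cmod0 mul0r mulr_ge0 // ltW.
rewrite exprSr mulrA ler_pM2r //; apply: le_trans (hC n).
rewrite ler_wpM2r ?exprn_ge0 ?(ltW r0) // cmodf cmodn ler_pdivrMr // ler_peMr ?cmod_ge0 //.
by rewrite ler1n.
Qed.

(** The factor 2^n, produced by the induction, absorbs the polynomial factors in n of the binomial
    remainders. *)
Lemma expr_remainder z h (rho : R) n : 1 <= rho -> cmod z <= rho -> cmod (z + h) <= rho ->
  cmod ((z + h) ^+ n - z ^+ n) <= cmod h * (2 * rho) ^+ n /\
  cmod ((z + h) ^+ n.+1 - z ^+ n.+1 - n.+1%:R * h * z ^+ n) <= cmod h ^+ 2 * (2 * rho) ^+ n.+1.
Proof.
move=> r1 zr zhr; have r0 : 0 <= rho by lra.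
have ph := cmod_ge0 h.
have D m : cmod ((z + h) ^+ m - z ^+ m) <= cmod h * (2 * rho) ^+ m.
  elim: m => [|m IH]; first by rewrite !expr0 subrr cmod0 mulr1.
  have -> : (z + h) ^+ m.+1 - z ^+ m.+1 = (z + h) * ((z + h) ^+ m - z ^+ m) + h * z ^+ m.
    by rewrite !exprS; ring.
  apply: le_trans (cmodD _ _) _; rewrite !cmodM cmodX.
  have h1 : cmod (z + h) * cmod ((z + h) ^+ m - z ^+ m) <= rho * (cmod h * (2 * rho) ^+ m).
    by apply: ler_pM; rewrite ?cmod_ge0.
  have h2 : cmod h * cmod z ^+ m <= cmod h * (rho * (2 * rho) ^+ m).
    rewrite ler_wpM2l //; apply: le_trans (_ : (2 * rho) ^+ m <= _).
      by rewrite lerXn2r ?nnegrE ?cmod_ge0 ?mulr_ge0 //; lra.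
    by rewrite ler_peMl // exprn_ge0 // mulr_ge0.
  by rewrite exprS; lra.
split=> //; elim: n => [|n IH].
  have -> : (z + h) ^+ 1 - z ^+ 1 - 1 * h * z ^+ 0 = 0 by rewrite !expr1 expr0; ring.
  by rewrite cmod0 mulr_ge0 ?exprn_ge0 // mulr_ge0.
have -> : (z + h) ^+ n.+2 - z ^+ n.+2 - n.+2%:R * h * z ^+ n.+1 =
   z * ((z + h) ^+ n.+1 - z ^+ n.+1 - n.+1%:R * h * z ^+ n) + h * ((z + h) ^+ n.+1 - z ^+ n.+1).
  by rewrite !exprS -natr1; ring.
apply: le_trans (cmodD _ _) _; rewrite !(cmodM _ (_ - _)).
have h1 : cmod z * cmod ((z + h) ^+ n.+1 - z ^+ n.+1 - n.+1%:R * h * z ^+ n) <= rho * (cmod h ^+ 2 * (2 * rho) ^+ n.+1).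
  by apply: ler_pM; rewrite ?cmod_ge0.
have h2 : cmod h * cmod ((z + h) ^+ n.+1 - z ^+ n.+1) <= rho * (cmod h ^+ 2 * (2 * rho) ^+ n.+1).
  apply: le_trans (_ : cmod h * (cmod h * (2 * rho) ^+ n.+1) <= _); first by rewrite ler_wpM2l.
  rewrite mulrA -expr2 ler_peMl // mulr_ge0 ?exprn_ge0 // mulr_ge0 //.
by rewrite [in leRHS](exprS (2 * rho) n.+1); lra.
Qed.

(** The coefficients are bounded at radius 4 rho, so that the factor (2 rho)^(n+1) of
    [expr_remainder] leaves a summable (1 / 2)^(n+1). The error is then quadratic in w - z. *)
Lemma pser_cder c f g : entire_coefs c -> (forall z, pser c z (f z)) ->
  (forall z, pser (coef_deriv c) z (g z)) -> forall z, cder f z (g z).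
Proof.
move=> hc hf hg z; pose rho := cmod z + 1.
have rho1 : 1 <= rho by rewrite lerDr cmod_ge0.
have rho0 : 0 < 4 * rho by lra.
have [C C0 hC] := hc _ rho0.
have key w : cmod (w - z) <= 1 -> cmod (f w - f z - g z * (w - z)) <= C * cmod (w - z) ^+ 2.
  set h := w - z => h1; have wE : w = z + h by rewrite addrC subrK.
  have ph := cmod_ge0 h.
  have zr : cmod z <= rho by rewrite lerDl.
  have whr : cmod (z + h) <= rho by apply: le_trans (cmodD _ _) _; rewrite lerD2l.
  apply/ler_addgt0Pr => e e0; have e30 : 0 < e / 3 by rewrite divr_gt0.
  have [N1 /(_ (maxn N1 _).+1)] := hf w _ e30; have [N2] := hf z _ e30; have [N3] := hg z _ e30.
  move=> h3 h2 h1'.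
  pose N := maxn N1 (maxn N2 N3).
  have {}h1' := h1' (maxn N2 N3) (leq_trans (leq_maxl _ _) (leqnSn _)).
  have {}h2 := h2 N.+1 ltac:(by rewrite /N !leqW // !leq_max leqnn orbT).
  have {}h3 := h3 N ltac:(by rewrite /N !leq_max leqnn !orbT).
  rewrite -/N in h1'.
  set Sw := \sum_(n < N.+1) c n * w ^+ n in h1'.
  set Sz := \sum_(n < N.+1) c n * z ^+ n in h2.
  set T := \sum_(n < N) coef_deriv c n * z ^+ n in h3.
  have E : Sw - Sz - T * h = \sum_(n < N) c n.+1 * ((z + h) ^+ n.+1 - z ^+ n.+1 - n.+1%:R * h * z ^+ n).
    rewrite /Sw /Sz /T !big_ord_recl /= !expr0 opprD addrACA subrr add0r -sumrB mulr_suml -sumrB.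
    by apply: eq_bigr => n _; rewrite /coef_deriv /bump /= add1n -wE; ring.
  have hE : cmod (Sw - Sz - T * h) <= C * cmod h ^+ 2.
    rewrite E; apply: le_trans (cmod_sum _ _ _) _.
    apply: (@le_trans _ _ (\sum_(n < N) C * cmod h ^+ 2 * (1 / 2) ^+ n.+1)).
      apply: ler_sum => n _; have [_ hr] := expr_remainder n rho1 zr whr.
      rewrite cmodM; apply: le_trans (ler_wpM2l (cmod_ge0 _) hr) _.
      have -> : (2 * rho) ^+ n.+1 = (4 * rho) ^+ n.+1 * (1 / 2) ^+ n.+1.
        by rewrite -exprMn; congr (_ ^+ _); field.
      have -> : cmod (c n.+1) * (cmod h ^+ 2 * ((4 * rho) ^+ n.+1 * (1 / 2) ^+ n.+1)) =
        cmod h ^+ 2 * (1 / 2) ^+ n.+1 * (cmod (c n.+1) * (4 * rho) ^+ n.+1) by ring.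
      have -> : C * cmod h ^+ 2 * (1 / 2) ^+ n.+1 = cmod h ^+ 2 * (1 / 2) ^+ n.+1 * C by ring.
      by rewrite ler_wpM2l // mulr_ge0 ?sqr_ge0 ?exprn_ge0 // divr_ge0.
    rewrite -mulr_sumr ler_piMr ?mulr_ge0 ?sqr_ge0 //.
    suff -> : forall p, \sum_(n < p) (1 / 2 : R) ^+ n.+1 = 1 - (1 / 2) ^+ p.
      by rewrite gerBl exprn_ge0 // divr_ge0.
    elim=> [|p IH]; first by rewrite big_ord0 expr0 subrr.
    by rewrite big_ord_recr /= IH exprS; field.
  have -> : f w - f z - g z * h = (f w - Sw) + - (f z - Sz) + - ((g z - T) * h) + (Sw - Sz - T * h) by ring.
  apply: le_trans (cmodD _ _) _; rewrite addrC lerD //.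
  have -> : e = e / 3 + e / 3 + e / 3 by field.
  apply: le_trans (cmodD _ _) _; apply: lerD.
    by apply: le_trans (cmodD _ _) _; rewrite cmodN; apply: lerD; exact: ltW.
  rewrite cmodN cmodM -[leRHS]mulr1; apply: ler_pM; rewrite ?cmod_ge0 //; exact: ltW.
move=> e e0; have K0 : 0 < C + 1 by lra.
exists (Num.min 1 (e / (C + 1))); first by rewrite lt_min ltr01 divr_gt0.
move=> w; rewrite lt_min => /andP[/ltW w1]; rewrite ltr_pdivlMr // => w2.
apply: le_trans (key w w1) _; rewrite expr2 mulrA ler_wpM2r ?cmod_ge0 //.
by have := cmod_ge0 (w - z); lra.
Qed.

Lemma entire_primitive f : entire f -> exists F, forall z, cder F z (f z).
Proof.
move=> fe; have [c hc] := taylor fe.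
have ec := taylor_coefs_entire fe hc; have ec' := entire_coefs_prim ec.
have [F hF] := entire_coefs_pser ec'; exists F.
apply: (pser_cder ec' hF) => z; rewrite (_ : coef_deriv _ = c).
  exact: taylor_pser.
by apply/funext; exact: coef_derivK.
Qed.

Lemma entire_derivative f : entire f ->
  exists2 f', entire f' & forall z, cder f z (f' z).
Proof.
move=> fe; have [c hc] := taylor fe.
have ec := taylor_coefs_entire fe hc; have ec1 := entire_coefs_deriv ec.
have ec2 := entire_coefs_deriv ec1.
have [f1 h1] := entire_coefs_pser ec1; have [f2 h2] := entire_coefs_pser ec2.
exists f1; last by apply: (pser_cder ec) => // z; exact: taylor_pser.
by apply/entireP => z; exists (f2 z); exact: (pser_cder ec1).
Qed.

Lemma cder_uniq f z D E : cder f z D -> cder f z E -> D = E.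
Proof.
move=> hD hE; apply/eqP; rewrite -subr_eq0 -cmod_eq0 eq_le cmod_ge0 andbT.
apply/ler_addgt0Pr => e e0; rewrite add0r.
have e20 : 0 < e / 2 by rewrite divr_gt0.
have [d d0 hd] := hD _ e20; have [d' d'0 hd'] := hE _ e20.
pose t := Num.min d d' / 2; have t0 : 0 < t by rewrite divr_gt0 // lt_min d0.
have tz : cmod (z + t%:C - z) = t by rewrite addrAC subrr add0r cmodC ger0_norm // ltW.
have m0 : 0 < Num.min d d' by rewrite lt_min d0.
have [l1 l2] : Num.min d d' <= d /\ Num.min d d' <= d' by rewrite !ge_min !lexx orbT.
have := hd (z + t%:C); have := hd' (z + t%:C); rewrite tz.
move=> /(_ ltac:(rewrite /t; lra)) h2 /(_ ltac:(rewrite /t; lra)) h1.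
rewrite -(ler_pM2r t0) -{1}tz -cmodM.
have -> : (D - E) * (z + t%:C - z) = (f (z + t%:C) - f z - E * (z + t%:C - z)) - (f (z + t%:C) - f z - D * (z + t%:C - z)) by ring.
by apply: le_trans (cmodBD _ _) _; rewrite [e]splitr mulrDl lerD.
Qed.

(** Both f and 0 are primitives of 0, so the integral of 0 along a vertical and then a horizontal
    segment is computed twice. *)
Lemma cder0_cst f z w : (forall z, cder f z 0) -> f z = f w.
Proof.
suff h v : (forall z, cder f z 0) -> f v = f 0 by move=> hf; rewrite (h z) // (h w).
case: v => x y hf; have h0 : forall z : R[i], cder (fun=> 0) z ((fun=> 0) z : R[i]).
  by move=> v; exact: cder_cst.
have := hint_prim y 0 x (k := fun=> 0) hf; rewrite (hint_prim y 0 x h0) subrr => /esym/eqP.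
rewrite subr_eq0 => /eqP ->.
have := vint_prim 0 0 y (k := fun=> 0) hf; rewrite (vint_prim 0 0 y h0) subrr mulr0 => /esym/eqP.
by rewrite mulf_eq0 oppr_eq0 -cmod_eq0 cmodi oner_eq0 /= subr_eq0 => /eqP.
Qed.

(* If G' = f'/f then f exp(-G) has derivative zero. *)
Theorem entire_log f : entire f -> (forall z, f z != 0) ->
  exists2 g, entire g & forall z, f z = cexp (g z).
Proof.
move=> fe f0; have [f' fe' hf'] := entire_derivative fe.
have [G hG] := entire_primitive (entireM fe' (entireV fe f0)).
have [s hs] := cexp_surj (f0 0).
exists (fun z => G z - G 0 + s).
  by apply/entireP => z; eexists; apply: cderD (cderB (hG z) (cder_cst _ _)) (cder_cst _ _).
move=> z; have h v : cder (fun v => f v * cexp (- G v)) v 0.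
  have := cderM (hf' v) (cder_comp (cderN (hG v)) (cder_cexp _)).
  suff -> : f' v * cexp (- G v) + f v * (cexp (- G v) * - (f' v / f v)) = 0 by [].
  by field.
have := cder0_cst z 0 h; rewrite !cexpD hs !cexpN => E.
have e1 := cexp_neq0 (G z); have e2 := cexp_neq0 (G 0).
by rewrite -[LHS](mulfVK e1) E; field.
Qed.

(** As [cexp] is its own derivative, uniqueness of coefficients gives the recurrence (n + 1) c_(n+1)
    = c_n, with c_0 = 1. *)
Lemma cexp_taylor : entire_coefs (fun n => n`!%:R^-1 : R[i]) /\
  forall z, pser (fun n => n`!%:R^-1) z (cexp z).
Proof.
have [c hc] := taylor (@entire_cexp R).
have ec := taylor_coefs_entire (@entire_cexp R) hc.
have hp w := taylor_pser w (@entire_cexp R) hc.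
have ec1 := entire_coefs_deriv ec; have [g hg] := entire_coefs_pser ec1.
have E : g = @cexp R.
  by apply/funext => w; exact: cder_uniq (pser_cder ec hp hg w) (cder_cexp w).
rewrite E in hg; have cE := pser_uniq ec1 ec hg hp.
suff -> : (fun n => n`!%:R^-1) = c by split.
apply/funext; elim=> [|n IH].
  have : pser c 0 (c 0%N).
    move=> e e0; exists 1%N; case=> // N _; rewrite big_ord_recl /= expr0 mulr1 big1 ?addr0 ?subrr ?cmod0 // => i _.
    by rewrite expr0n mulr0.
  by move=> /(pser_lim_uniq (hp 0)) <-; rewrite cexp0 fact0 invr1.
have n0 : n.+1%:R != 0 :> R[i] by rewrite pnatr_eq0.
by rewrite factS natrM invfM IH -(cE n) /coef_deriv mulKf.
Qed.

Lemma cexp_pser z : pser (fun n => n`!%:R^-1) z (cexp z).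
Proof. by have [_] := cexp_taylor. Qed.

End PowerSeriesDerivative.

(** * Sub-mean value inequality for Gaussian weights *)

Section IntegralLowerBound.

(** The integral of a nonnegative function is a supremum over simple functions below it, so
    inclusion of these families suffices. Thus [calB] can be bounded below without studying [qcomp]
    as a measurable function. *)
Lemma ge0_le_integralT d (T : measurableType d) (R : realType)
    (mu : {measure set T -> \bar R}) (f g : T -> \bar R) :
  (forall x, 0 <= f x)%E -> (forall x, f x <= g x)%E ->
  (\int[mu]_x f x <= \int[mu]_x g x)%E.
Proof.
move=> f0 fg; have g0 x : (0 <= g x)%E by exact: le_trans (f0 x) (fg x).
rewrite !ge0_integralTE //; apply: le_ereal_sup => _ [h hf <-]; exists h => // x.
exact: le_trans (hf x) (fg x).
Qed.

Lemma rectangle_integral_ge (R : realType) (g : R * R -> \bar R) (a b c d C : R) :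
  a < b -> c < d -> 0 <= C -> (forall v, 0 <= g v)%E ->
  (forall v, a <= v.1 <= b -> c <= v.2 <= d -> (C%:E <= g v)%E) ->
  ((C * ((b - a) * (d - c)))%:E <=
    \int[(@lebesgue_measure R \x @lebesgue_measure R)%E]_(v in [set: R * R]) g v)%E.
Proof.
move=> ab cd C0 g0 gC; pose A := `[a, b]%classic `*` `[c, d]%classic : set (R * R).
have mA : measurable A by apply: measurableX; exact: measurable_itv.
apply: (@le_trans _ _ (\int[(@lebesgue_measure R \x @lebesgue_measure R)%E]_(v in [set: R * R]) (C * \1_A v)%:E)%E); last first.
  apply: ge0_le_integralT => [v|v]; first by rewrite lee_fin mulr_ge0.
  rewrite indicE; case: (boolP (v \in A)) => [|_]; last by rewrite mulr0; exact: g0.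
  by rewrite inE => -[/=]; rewrite !in_itv /= mulr1 => h1 h2; exact: gC.
have -> : (\int[(@lebesgue_measure R \x @lebesgue_measure R)%E]_(v in [set: R * R]) (C * \1_A v)%:E =
    C%:E * \int[(@lebesgue_measure R \x @lebesgue_measure R)%E]_(v in [set: R * R]) (\1_A v)%:E)%E.
  under eq_integral do rewrite EFinM.
  rewrite ge0_integralZl_EFin //.
  exact/measurable_EFinP/measurable_indic.
rewrite integral_indic // setIT.
rewrite [X in (_ * X)%E](_ : _ = (lebesgue_measure `[a, b]%classic * lebesgue_measure `[c, d]%classic)%E); last first.
  by apply: product_measure1E; exact: measurable_itv.
by rewrite !lebesgue_measure_itv /= !lte_fin ab cd -!EFinB -!EFinM.
Qed.

End IntegralLowerBound.

(** * Large values of an entire function on a square, and the Gaussian weight *)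

Section SubMeanValue.
Variable R : realType.
Implicit Types (F G : R[i] -> R[i]) (z w : R[i]).

(* The maximiser z of (1 - |z|)^p |G z| on the unit disc dominates |G| in a disc
   of radius comparable to d = 1 - |z|, so by Schwarz |G| >= |G z| / 2 on a
   proportional square; the choice p t >= 2 balances its area d^2. *)
Lemma half_max_square (t : R) : 0 < t -> exists2 kappa : R, 0 < kappa &
  forall G, entire G -> exists z (rho m : R),
    [/\ 0 < rho, 0 <= m,
        forall w, `|complex.Re w - complex.Re z| <= rho -> `|complex.Im w - complex.Im z| <= rho ->
          cmod w <= 1 /\ m <= cmod (G w)
      & kappa * cmod (G 0) `^ t <= rho ^+ 2 * m `^ t].
Proof.
move=> t0; pose p := (Num.truncn (2 / t)).+1.
have pt : 2 <= p%:R * t by rewrite -ler_pdivrMr // ltW // truncnS_gt.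
(* With eta = e9 / 2^p, the Schwarz bound on the variation of G within distance d eta is 160 e9 |G
   z|, which 1 / 400 makes less than |G z| / 2. *)
have [e9 [e90 e91]] : exists e9 : R, 0 < e9 /\ e9 <= 1 / 400 by exists (1 / 400); lra.
pose eta : R := (1 / 2) ^+ p * e9.
have half0 : 0 < 1 / 2 :> R by lra.
have eta0 : 0 < eta by rewrite mulr_gt0 // exprn_gt0.
have eta1 : eta <= 1 / 400.
  apply: le_trans e91; rewrite /eta ler_piMl ?(ltW e90) // exprn_ile1 // ?(ltW half0) //; lra.
have P4 : 0 < (4 : R) `^ t by rewrite powR_gt0.
exists (eta ^+ 2 / (4 * 4 `^ t)); first by rewrite divr_gt0 ?exprn_gt0 ?mulr_gt0.
move=> G Ge; have [G0|G0] := eqVneq (cmod (G 0)) 0.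
  exists 0, (1 / 4), 0; split=> //; last by rewrite G0 powR0 ?gt_eqF // !mulr0.
  move=> w; rewrite /= !subr0 => h1 h2; split; last exact: cmod_ge0.
  by have := cmod_leD w; lra.
have {}G0 : 0 < cmod (G 0) by rewrite lt0r G0 cmod_ge0.
pose u z := (1 - cmod z) ^+ p * cmod (G z).
pose S := [set u z | z in [set z | cmod z <= 1]].
have u0 : u 0 = cmod (G 0) by rewrite /u cmod0 subr0 expr1n mul1r.
have S0 : S (u 0) by exists 0 => //=; rewrite cmod0.
have [M M0 hM] := entire_bounded 1 Ge.
have Sub : has_sup S.
  split; first by exists (u 0).
  exists M => _ [z /= z1 <-]; rewrite /u; have := hM z z1 => h.
  apply: le_trans h; rewrite ler_piMl ?cmod_ge0 // exprn_ile1 // ?subr_ge0 // gerBl cmod_ge0.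
  by [].
have Sle z : cmod z <= 1 -> u z <= sup S by move=> z1; apply: sup_ubound; [case: Sub|exists z].
have s0 : 0 < sup S by apply: lt_le_trans (Sle 0 _); rewrite ?u0 ?cmod0.
(* A point reaching half the supremum replaces the maximiser, at the cost of a factor 2. *)
have [x [z /= z1 <-] uz] := sup_adherent (ltac:(by rewrite divr_gt0) : 0 < sup S / 2) Sub.
have {}uz : sup S <= 2 * u z by lra.
pose d := 1 - cmod z; have d0 : 0 < d.
  rewrite /d subr_gt0 lt_neqAle z1 andbT; apply/eqP => E.
  by move: uz; rewrite /u E subrr expr0n mul0r mulr0; lra.
have d1 : d <= 1 by rewrite gerBl cmod_ge0.
have D0 : 0 < d ^+ p by rewrite exprn_gt0.
have bound h : cmod h = d / 2 -> cmod (G (z + h)) <= 2 * 2 ^+ p * cmod (G z).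
  move=> hd; have zh : d / 2 <= 1 - cmod (z + h).
    by have := cmodD z h; rewrite hd /d; lra.
  have h1 : (d / 2) ^+ p * cmod (G (z + h)) <= 2 * (d ^+ p * cmod (G z)).
    apply: le_trans uz; apply: le_trans (Sle (z + h) _); last by lra.
    by rewrite /u ler_wpM2r ?cmod_ge0 // lerXn2r // nnegrE; lra.
  rewrite -(ler_pM2l D0).
  have -> : d ^+ p = (d / 2) ^+ p * 2 ^+ p by rewrite -exprMn divfK.
  have : 2 ^+ p * ((d / 2) ^+ p * cmod (G (z + h))) <= 2 ^+ p * (2 * (d ^+ p * cmod (G z))).
    by rewrite ler_wpM2l // exprn_ge0.
  have -> : d ^+ p = (d / 2) ^+ p * 2 ^+ p by rewrite -exprMn divfK.
  by lra.
have G'e : entire (fun h => G (z + h)).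
  exact (entire_comp Ge (entireD (@entire_cst R z) (@entire_id R))).
have lip h : cmod h <= d * eta -> cmod (G z) / 2 <= cmod (G (z + h)).
  move=> hd; have hd4 : cmod h <= d / 2 / 2.
    by have : d * eta <= d * (1 / 400) by [rewrite ler_wpM2l // ltW]; lra.
  have d20 : 0 < d / 2 by rewrite divr_gt0.
  have := schwarz_bound G'e d20 bound hd4; rewrite addr0 => hs.
  have h2 : cmod h / (d / 2) <= 2 * eta by rewrite ler_pdivrMr //; lra.
  have h3 : 40 * (2 * 2 ^+ p * cmod (G z)) * (cmod h / (d / 2)) <= 40 * (2 * 2 ^+ p * cmod (G z)) * (2 * eta).
    by rewrite ler_wpM2l // !mulr_ge0 ?cmod_ge0 ?exprn_ge0.
  have h4 : 2 ^+ p * eta = e9.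
    by rewrite /eta mulrA -exprMn (_ : 2 * (1 / 2) = 1) ?expr1n ?mul1r //; field.
  have h5 : 40 * (2 * 2 ^+ p * cmod (G z)) * (2 * eta) = 160 * (2 ^+ p * eta) * cmod (G z) by ring.
  have := cmod_dist (G z) (G (z + h)); rewrite cmodB => h6.
  rewrite h5 h4 in h3.
  have h7 : 160 * e9 * cmod (G z) <= 1 / 2 * cmod (G z).
    by rewrite ler_wpM2r ?cmod_ge0 //; lra.
  by have := cmod_ge0 (G z); lra.
exists z, (d * eta / 2), (cmod (G z) / 2); split.
- by rewrite divr_gt0 // mulr_gt0.
- by rewrite divr_ge0 // cmod_ge0.
- move=> w h1 h2; have hw : cmod (w - z) <= d * eta.
    by apply: le_trans (cmod_leD _) _; rewrite !(cReD, cReN, cImD, cImN); lra.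
  have -> : w = z + (w - z) by rewrite addrC subrK.
  split; last exact: lip.
  apply: le_trans (cmodD _ _) _.
  have : d * eta <= d * (1 / 400) by rewrite ler_wpM2l // ltW.
  by rewrite /d in hw *; lra.
have hG : cmod (G 0) <= 4 * d ^+ p * (cmod (G z) / 2).
  by rewrite -u0; apply: le_trans (Sle 0 _) _; rewrite ?cmod0 // /d; move: uz; rewrite /u; lra.
have m0 : 0 <= cmod (G z) / 2 by rewrite divr_ge0 // cmod_ge0.
have hGt : cmod (G 0) `^ t <= 4 `^ t * (d ^+ 2 * (cmod (G z) / 2) `^ t).
  apply: le_trans (ge0_ler_powR (ltW t0) _ _ hG) _; rewrite ?nnegrE ?(ltW G0) ?mulr_ge0 ?(ltW D0) ?cmod_ge0 //.
  rewrite (@powRM _ (4 * d ^+ p) (cmod (G z) / 2) t) ?mulr_ge0 ?(ltW D0) ?cmod_ge0 //.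
  rewrite (@powRM _ 4 (d ^+ p) t) ?(ltW D0) // -mulrA ler_wpM2l ?(ltW P4) //.
  rewrite ler_wpM2r ?powR_ge0 // -!powR_mulrn ?(ltW d0) // -powRrM.
  by apply: ger_powR => //; rewrite d0 d1.
rewrite mulrAC ler_pdivrMr ?mulr_gt0 //.
apply: le_trans (ler_wpM2l _ hGt) _; first by rewrite sqr_ge0.
by rewrite le_eqVlt; apply/orP; left; apply/eqP; field.
Qed.

(** Expanding |z0 + z|^2 shows that multiplying F (z0 + z) by e^(- alpha conj(z0) z) moves the
    centre of the Gaussian to 0; on the unit disc the remaining weight is at least e^(- alpha t /
    2). The factor 4 is the area of a square of half side 1. The integrand g is only required to
    dominate, which is how the estimate meets [calB]. *)
Theorem gaussian_submean (alpha t : R) : 0 < alpha -> 0 < t -> exists2 kappa : R, 0 < kappa &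
  forall F (g : R * R -> \bar R) z0, entire F ->
    (forall v, (cmod (F (v.1 +i* v.2)) `^ t * expR (- (alpha * t / 2) * cmod (v.1 +i* v.2) ^+ 2))%:E <= g v)%E ->
    ((kappa * (cmod (F z0) `^ t * expR (- (alpha * t / 2) * cmod z0 ^+ 2)))%:E <=
      \int[(@lebesgue_measure R \x @lebesgue_measure R)%E]_(v in [set: R * R]) g v)%E.
Proof.
move=> a0 t0; have [k k0 hk] := half_max_square t0.
exists (4 * expR (- (alpha * t / 2)) * k); first by rewrite !mulr_gt0 ?expR_gt0.
move=> F g z0 Fe hg.
pose G z := F (z0 + z) * cexp (- alpha%:C * conjc z0 * z).
have Ge : entire G.
  apply: entireM; first exact (entire_comp Fe (entireD (@entire_cst R z0) (@entire_id R))).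
  exact (entire_comp (@entire_cexp R) (entireM (@entire_cst R (- alpha%:C * conjc z0)) (@entire_id R))).
have [z [rho [m [rho0 m0 hm hkm]]]] := hk G Ge.
set c := alpha * t / 2 in hg *; have c0 : 0 < c by rewrite divr_gt0 ?mulr_gt0.
have G0 : G 0 = F z0 by rewrite /G addr0 mulr0 cexp0 mulr1.
rewrite G0 in hkm.
pose C := m `^ t * (expR (- c * cmod z0 ^+ 2) * expR (- c)).
have C0 : 0 <= C by rewrite !mulr_ge0 ?powR_ge0 ?expR_ge0.
pose x := complex.Re (z0 + z); pose y := complex.Im (z0 + z).
have xr : x - rho < x + rho by lra.
have yr : y - rho < y + rho by lra.
apply: le_trans (rectangle_integral_ge (a := x - rho) (b := x + rho) (c := y - rho) (d := y + rho) xr yr C0 _ _).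
- rewrite lee_fin.
  have -> : C * ((x + rho - (x - rho)) * (y + rho - (y - rho))) =
    4 * expR (- c * cmod z0 ^+ 2) * expR (- c) * (rho ^+ 2 * m `^ t) by rewrite /C; ring.
  apply: le_trans (ler_wpM2l _ hkm); last by rewrite !mulr_ge0 ?expR_ge0.
  by rewrite le_eqVlt; apply/orP; left; apply/eqP; ring.
- by move=> v; apply: le_trans (hg v); rewrite lee_fin mulr_ge0 ?powR_ge0 ?expR_ge0.
move=> [v1 v2] /= h1 h2; apply: le_trans (hg _); rewrite lee_fin /=.
set v := v1 +i* v2; pose w := v - z0.
have vE : v = z0 + w by rewrite addrC subrK.
have [w1 mG] : cmod w <= 1 /\ m <= cmod (G w).
  by apply: hm; rewrite /w !(cReD, cReN, cImD, cImN) ler_norml;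
    move: h1 h2; rewrite /x /y !(cReD, cReN, cImD, cImN) /=; lra.
have GE : cmod (G w) = cmod (F v) * expR (- alpha * complex.Re (conjc z0 * w)).
  have RE : complex.Re (- alpha%:C * conjc z0 * w) = - alpha * complex.Re (conjc z0 * w).
    by rewrite -mulrA [LHS]cReM cReN cImN /= oppr0 mul0r subr0.
  by rewrite /G -vE cmodM cmod_cexp RE.
have E : cmod v ^+ 2 = cmod z0 ^+ 2 + 2 * complex.Re (conjc z0 * w) + cmod w ^+ 2.
  by rewrite vE !sqr_cmod !(cReM, cReD, cImD, cRe_conj, cIm_conj); ring.
have -> : cmod (F v) `^ t * expR (- c * cmod v ^+ 2) = cmod (G w) `^ t * (expR (- c * cmod z0 ^+ 2) * expR (- c * cmod w ^+ 2)).
  rewrite GE powRM ?cmod_ge0 ?expR_ge0 // -[in RHS]expRM.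
  rewrite -mulrA -!expRD; congr (_ * expR _).
  by rewrite E /c; field.
apply: ler_pM; rewrite ?powR_ge0 ?mulr_ge0 ?expR_ge0 //.
  by apply: ge0_ler_powR; rewrite ?nnegrE ?(ltW t0) ?cmod_ge0.
rewrite ler_wpM2l ?expR_ge0 // ler_expR mulNr lerN2 ler_piMr ?(ltW c0) //.
by rewrite exprn_ile1 // cmod_ge0.
Qed.

End SubMeanValue.

(** * Quaternions and slice regular power series *)

Section QuaternionAlgebra.
Variable R : realType.
Implicit Types (x y I J u : quat R) (z w : R[i]) (r : R).

Lemma quat_eq x y : x.1.1 = y.1.1 -> x.1.2 = y.1.2 -> x.2.1 = y.2.1 -> x.2.2 = y.2.2 -> x = y.
Proof. by case: x => [[a b] [c d]]; case: y => [[a' b'] [c' d']] /= -> -> -> ->. Qed.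

Lemma qmulE (a b c d a' b' c' d' : R) :
  (((a, b), (c, d)) : quat R) * (((a', b'), (c', d')) : quat R) =
  ((a * a' - b * b' - c * c' - d * d', a * b' + b * a' + c * d' - d * c'),
   (a * c' - b * d' + c * a' + d * b', a * d' + b * c' - c * b' + d * a')).
Proof. by []. Qed.
Lemma qaddE (a b c d a' b' c' d' : R) :
  (((a, b), (c, d)) : quat R) + (((a', b'), (c', d')) : quat R) =
  ((a + a', b + b'), (c + c', d + d')).
Proof. by []. Qed.
Lemma qoppE (a b c d : R) : - (((a, b), (c, d)) : quat R) = ((- a, - b), (- c, - d)).
Proof. by []. Qed.
Lemma qscaleE (r a b c d : R) : r *: (((a, b), (c, d)) : quat R) = ((r * a, r * b), (r * c, r * d)).
Proof. by []. Qed.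
Lemma qoneE : (1 : quat R) = ((1, 0), (0, 0)).
Proof. by []. Qed.
Lemma qzeroE : (0 : quat R) = ((0, 0), (0, 0)).
Proof. by []. Qed.
Definition qE := (qmulE, qaddE, qoppE, qscaleE, qoneE, qzeroE).

Lemma qscalel r x y : ((r *: x : quat R) * y : quat R) = r *: (x * y).
Proof.
case: x => [[a b] [c d]]; case: y => [[a' b'] [c' d']]; rewrite !qE.
by apply: quat_eq => /=; ring.
Qed.
Lemma qscaler r x y : (x * (r *: y) : quat R) = r *: (x * y).
Proof.
case: x => [[a b] [c d]]; case: y => [[a' b'] [c' d']]; rewrite !qE.
by apply: quat_eq => /=; ring.
Qed.

Lemma qabs_sqr x : qabs x ^+ 2 = qdot x x.
Proof. by rewrite sqr_sqrtr // /qdot !addr_ge0 // -expr2 sqr_ge0. Qed.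
Lemma qabs_ge0 x : 0 <= qabs x. Proof. exact: sqrtr_ge0. Qed.

Lemma qabs_unique x r : 0 <= r -> r ^+ 2 = qdot x x -> qabs x = r.
Proof. by move=> r0 E; rewrite /qabs -E sqrtr_sqr ger0_norm. Qed.

Lemma qabsM x y : qabs (x * y) = qabs x * qabs y.
Proof.
apply: qabs_unique; first by rewrite mulr_ge0 ?qabs_ge0.
rewrite exprMn !qabs_sqr.
case: x => [[a b] [c d]]; case: y => [[a' b'] [c' d']]; rewrite !qE /qdot /=; ring.
Qed.

Lemma qabsZ r x : qabs (r *: x) = `|r| * qabs x.
Proof.
apply: qabs_unique; first by rewrite mulr_ge0 ?qabs_ge0.
rewrite exprMn real_normK ?num_real // !qabs_sqr.
by case: x => [[a b] [c d]]; rewrite !qE /qdot /=; ring.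
Qed.

Lemma qabsN x : qabs (- x) = qabs x.
Proof. by rewrite -scaleN1r qabsZ normrN1 mul1r. Qed.
Lemma qabsB x y : qabs (x - y) = qabs (y - x).
Proof. by rewrite -qabsN opprB. Qed.
Lemma qabs1 : qabs (1 : quat R) = 1.
Proof. by apply: qabs_unique => //; rewrite /qdot /=; ring. Qed.
Lemma qabs0 : qabs (0 : quat R) = 0.
Proof. by apply: qabs_unique => //; rewrite /qdot /=; ring. Qed.
Lemma qabsX x n : qabs (x ^+ n) = qabs x ^+ n.
Proof. by elim: n => [|n IH]; rewrite ?qabs1 // !exprS qabsM IH. Qed.

Lemma qdot_le x y : qdot x y <= qabs x * qabs y.
Proof.
apply: le_trans (ler_norm _) _.
rewrite -ler_sqr ?nnegrE ?normr_ge0 ?mulr_ge0 ?qabs_ge0 // real_normK ?num_real //.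
rewrite exprMn !qabs_sqr -subr_ge0.
case: x => [[a b] [c d]]; case: y => [[a' b'] [c' d']]; rewrite /qdot /=.
have -> : (a * a + b * b + c * c + d * d) * (a' * a' + b' * b' + c' * c' + d' * d') -
  (a * a' + b * b' + c * c' + d * d') ^+ 2 =
  (a * b' - b * a') ^+ 2 + (a * c' - c * a') ^+ 2 + (a * d' - d * a') ^+ 2 +
  (b * c' - c * b') ^+ 2 + (b * d' - d * b') ^+ 2 + (c * d' - d * c') ^+ 2 by ring.
by rewrite !addr_ge0 // sqr_ge0.
Qed.

Lemma qabsD x y : qabs (x + y) <= qabs x + qabs y.
Proof.
rewrite -ler_sqr ?nnegrE ?addr_ge0 ?qabs_ge0 //.
have -> : qabs (x + y) ^+ 2 = qabs x ^+ 2 + qabs y ^+ 2 + 2 * qdot x y.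
  rewrite !qabs_sqr; case: x => [[a b] [c d]]; case: y => [[a' b'] [c' d']].
  by rewrite !qE /qdot /=; ring.
by have := qdot_le x y; rewrite sqrrD; lra.
Qed.

Lemma qabs_sum (T : Type) (s : seq T) (P : pred T) (F : T -> quat R) :
  qabs (\sum_(i <- s | P i) F i) <= \sum_(i <- s | P i) qabs (F i).
Proof.
elim/big_rec2 : _ => [|i y1 y2 _ h]; first by rewrite qabs0.
by apply: le_trans (qabsD _ _) _; rewrite lerD2l.
Qed.

Lemma qcomp_le_abs x : [/\ `|x.1.1| <= qabs x, `|x.1.2| <= qabs x,
  `|x.2.1| <= qabs x & `|x.2.2| <= qabs x].
Proof.
have h t s : t * t + s = qdot x x -> 0 <= s -> `|t| <= qabs x.
  move=> E s0; rewrite -ler_sqr ?nnegrE ?normr_ge0 ?qabs_ge0 // real_normK ?num_real //.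
  by rewrite qabs_sqr -E expr2 lerDl.
case: x h => [[a b] [c d]]; rewrite /qdot /= => h.
have sq (t : R) : 0 <= t * t by rewrite -expr2 sqr_ge0.
split.
- by apply: (h a (b * b + c * c + d * d)); [ring|rewrite !addr_ge0].
- by apply: (h b (a * a + c * c + d * d)); [ring|rewrite !addr_ge0].
- by apply: (h c (a * a + b * b + d * d)); [ring|rewrite !addr_ge0].
- by apply: (h d (a * a + b * b + c * c)); [ring|rewrite !addr_ge0].
Qed.

End QuaternionAlgebra.

(** * The slices C_I and their embeddings *)

Section Embedding.
Variable R : realType.
Implicit Types (x y I J u : quat R) (z w : R[i]) (r : R).

Lemma imag_unitP I : imag_units I -> I.1.1 = 0 /\ qdot I I = 1.
Proof.
case: I => [[a b] [c d]]; rewrite /imag_units /= !qE => -[h1 h2 h3 h4]; rewrite /qdot /=.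
have [a0|a0] := eqVneq a 0; first by rewrite a0 in h1 *; split=> //; lra.
have two t : a * t + t * a = 0 -> t = 0.
  by move=> ht; apply: (mulfI a0); lra.
have b0 : b = 0 by apply: two; lra.
have c0 : c = 0 by apply: two; lra.
have d0 : d = 0 by apply: two; lra.
by have := sqr_ge0 a; rewrite expr2; rewrite b0 c0 d0 in h1; lra.
Qed.

Lemma imag_unit_intro I : I.1.1 = 0 -> qdot I I = 1 -> imag_units I.
Proof.
case: I => [[a b] [c d]]; rewrite /imag_units /qdot /= => -> h; rewrite !qE.
by apply: quat_eq => /=; lra.
Qed.

Lemma embE (b c d : R) z : emb ((0, b), (c, d)) z =
  ((complex.Re z, complex.Im z * b), (complex.Im z * c, complex.Im z * d)).
Proof. by rewrite /emb; apply: quat_eq; rewrite /= /GRing.scale /=; ring. Qed.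
Lemma embD I z w : emb I (z + w) = emb I z + emb I w.
Proof. by rewrite /emb cReD cImD !scalerDl addrACA. Qed.
Lemma embZ I r z : emb I (r%:C * z) = r *: emb I z.
Proof. by rewrite /emb cReM cImM /= !mul0r subr0 addr0 scalerDr !scalerA. Qed.
Lemma embN I z : emb I (- z) = - emb I z.
Proof. by rewrite /emb cReN cImN !scaleNr opprD. Qed.
Lemma embB I z w : emb I (z - w) = emb I z - emb I w.
Proof. by rewrite embD embN. Qed.
Lemma emb0 I : emb I 0 = 0.
Proof. by rewrite /emb !scale0r addr0. Qed.
Lemma emb_real I r : emb I r%:C = r *: (1 : quat R).
Proof. by rewrite /emb /= scale0r addr0. Qed.
Lemma emb1 I : emb I 1 = 1.
Proof. by rewrite (emb_real I 1) scale1r. Qed.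
Lemma emb_sum I n (F : nat -> R[i]) : emb I (\sum_(k < n) F k) = \sum_(k < n) emb I (F k).
Proof. by elim: n => [|n IH]; rewrite ?big_ord0 ?emb0 // !big_ord_recr /= embD IH. Qed.

Lemma embM I z w : imag_units I -> emb I (z * w) = emb I z * emb I w.
Proof.
move=> /imag_unitP; case: I => [[a b] [c d]] /= [-> h]; rewrite !embE !qE cReM cImM.
apply: quat_eq => /=; try (by ring).
have -> : complex.Re z * complex.Re w - complex.Im z * complex.Im w =
  complex.Re z * complex.Re w - complex.Im z * complex.Im w * 1 by ring.
by rewrite -h /qdot /=; ring.
Qed.

Lemma embX I z n : imag_units I -> emb I (z ^+ n) = emb I z ^+ n.
Proof. by move=> hI; elim: n => [|n IH]; rewrite ?expr0 ?emb1 // !exprS embM // IH. Qed.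

Lemma qabs_emb I z : imag_units I -> qabs (emb I z) = cmod z.
Proof.
move=> /imag_unitP; case: I => [[a b] [c d]] /= [-> h]; apply: qabs_unique; first exact: cmod_ge0.
have -> : cmod z ^+ 2 = complex.Re z ^+ 2 + complex.Im z ^+ 2 * 1 by rewrite sqr_cmod mulr1.
by rewrite -h embE /qdot /=; ring.
Qed.

Lemma perp_emb I J z : imag_units I -> imag_units J -> perp J I ->
  J * emb I z = emb I (conjc z) * J.
Proof.
move=> /imag_unitP + /imag_unitP; case: I => [[a b] [c d]]; case: J => [[a' b'] [c' d']] /=.
rewrite /perp => -[-> _] [-> _] h; rewrite !embE !qE cRe_conj cIm_conj.
apply: quat_eq => /=; try (by ring).
have : complex.Im z * 2 * qdot (((0, b'), (c', d')) : quat R) ((0, b), (c, d)) = 0 by rewrite h mulr0.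
by rewrite /qdot /=; lra.
Qed.

(** C_I and C_I J are orthogonal: the cross term is a multiple of [qdot J I]. *)
Lemma qabs_split I J z w : imag_units I -> imag_units J -> perp J I ->
  qabs (emb I z + emb I w * J) ^+ 2 = cmod z ^+ 2 + cmod w ^+ 2.
Proof.
move=> hI hJ h; have [Ia I1] := imag_unitP hI; have [Ja J1] := imag_unitP hJ.
have J1' : qabs J = 1 by apply: qabs_unique; rewrite ?expr1n.
have -> : qabs (emb I z + emb I w * J) ^+ 2 = qabs (emb I z) ^+ 2 + qabs (emb I w * J) ^+ 2 +
   2 * qdot (emb I z) (emb I w * J).
  rewrite !qabs_sqr; case: (emb I z) => [[? ?] [? ?]]; case: (_ * J) => [[? ?] [? ?]].
  by rewrite !qE /qdot /=; ring.
have -> : qdot (emb I z) (emb I w * J) =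
    (complex.Im z * complex.Re w - complex.Re z * complex.Im w) * qdot J I.
  move: Ia Ja; case: (I) => [[a b] [c d]]; case: (J) => [[a' b'] [c' d']] /= -> ->.
  by rewrite !embE !qE /qdot /=; ring.
by rewrite h mulr0 mulr0 addr0 qabsM J1' mulr1 !qabs_emb.
Qed.

Lemma qconj_emb I z : imag_units I -> qconj (emb I z) = emb I (conjc z).
Proof.
move=> /imag_unitP; case: I => [[a b] [c d]] /= [-> _]; rewrite !embE /qconj cRe_conj cIm_conj /=.
by rewrite !mulNr.
Qed.

Lemma quat_slice I x : imag_units I -> exists I' z, imag_units I' /\ x = emb I' z.
Proof.
move=> hI; case: x => [[a b] [c d]]; pose r := Num.sqrt (b * b + c * c + d * d).
have sq (t : R) : 0 <= t * t by rewrite -expr2 sqr_ge0.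
have rE : r ^+ 2 = b * b + c * c + d * d by rewrite sqr_sqrtr // !addr_ge0.
have [r0|r0] := eqVneq r 0.
  exists I, (a%:C); split => //; rewrite emb_real !qE; move: rE; rewrite r0 expr0n /= => rE.
  have z0 (t s : R) : 0 <= s -> t * t + s = 0 -> t = 0.
    move=> s0 ts; have E : t * t = 0 by have := sq t; lra.
    by apply/eqP; rewrite -sqrf_eq0 expr2 E.
  have b0 : b = 0 by apply: (z0 b (c * c + d * d)); rewrite ?addr_ge0 // addrA -rE.
  have c0 : c = 0 by apply: (z0 c (b * b + d * d)); rewrite ?addr_ge0 //; lra.
  have d0 : d = 0 by apply: (z0 d (c * c + b * b)); rewrite ?addr_ge0 //; lra.
  by rewrite b0 c0 d0; apply: quat_eq => /=; ring.
exists ((0, b / r), (c / r, d / r)), (a +i* r); split.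
  apply: imag_unit_intro => //; rewrite /qdot /=.
  have -> : 0 * 0 + b / r * (b / r) + c / r * (c / r) + d / r * (d / r) = (b * b + c * c + d * d) / r ^+ 2 by field.
  by rewrite -rE divff // expf_neq0.
by rewrite embE; apply: quat_eq => //=; rewrite mulrC divfK.
Qed.

End Embedding.

(** * Limits and geometric series of quaternions *)

Section QuaternionLimits.
Variable R : realType.
Implicit Types (u v : nat -> quat R) (l x y : quat R) (r C K : R).

(** Convergence in the multiplicative modulus [qabs] rather than in the sup norm that defines the
    topology; [qlimP] identifies the two. *)
Definition qlim u l := forall e : R, 0 < e -> exists N0 : nat,
  forall N, (N0 <= N)%N -> qabs (u N - l) < e.

Lemma norm_le_qabs x : `|x| <= qabs x.
Proof.
have [h1 h2 h3 h4] := qcomp_le_abs x.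
by rewrite /Num.norm /= !ge_max h1 h2 h3 h4.
Qed.

Lemma qabs_le_norm x : qabs x <= 4 * `|x|.
Proof.
have h1 : `|x.1.1| <= `|x| by rewrite [leRHS]/Num.norm /= !le_max lexx.
have h2 : `|x.1.2| <= `|x| by rewrite [leRHS]/Num.norm /= !le_max lexx !orbT.
have h3 : `|x.2.1| <= `|x| by rewrite [leRHS]/Num.norm /= !le_max lexx !orbT.
have h4 : `|x.2.2| <= `|x| by rewrite [leRHS]/Num.norm /= !le_max lexx !orbT.
have n0 : 0 <= `|x| by exact: normr_ge0.
rewrite -ler_sqr ?nnegrE ?qabs_ge0 ?mulr_ge0 // qabs_sqr exprMn.
have sq (t : R) : `|t| <= `|x| -> t * t <= `|x| ^+ 2.
  by move=> h; rewrite -expr2 -(real_normK (num_real t)) ler_sqr ?nnegrE.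
have := sq _ h1; have := sq _ h2; have := sq _ h3; have := sq _ h4.
have := sqr_ge0 `|x|; rewrite /qdot (_ : 4 ^+ 2 = 16); [lra|by rewrite -natrX].
Qed.

Lemma qlimP u l : qlim u l <-> u @ \oo --> l.
Proof.
split=> [h|/cvgrPdist_lt h e e0].
  apply/cvgrPdist_lt => e e0; have [N0 hN] := h e e0; exists N0 => // N /= /hN hN'.
  by apply: le_lt_trans (norm_le_qabs _) _; rewrite qabsB.
have [|N0 _ hN] := h (e / 4); first by rewrite divr_gt0.
exists N0 => N /hN /= hN'; rewrite qabsB; apply: le_lt_trans (qabs_le_norm _) _.
by rewrite mulrC -ltr_pdivlMr.
Qed.

Lemma qlim_uniq u l l' : qlim u l -> qlim u l' -> l = l'.
Proof.
move=> /qlimP h /qlimP h'; apply: cvg_unique h h'; exact: norm_hausdorff.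
Qed.

Lemma qlim_lim u l : qlim u l -> lim (u @ \oo) = l.
Proof. by move=> /qlimP h; apply/cvg_lim => //; exact: norm_hausdorff. Qed.

Lemma qlim_ext u v l : u =1 v -> qlim u l -> qlim v l.
Proof. by move=> /funext ->. Qed.

Lemma qlimD u v l m : qlim u l -> qlim v m -> qlim (fun n => u n + v n) (l + m).
Proof.
move=> hu hv e e0; have e20 : 0 < e / 2 by rewrite divr_gt0.
have [N1 h1] := hu _ e20; have [N2 h2] := hv _ e20; exists (maxn N1 N2) => N.
rewrite geq_max => /andP[/h1 a1 /h2 a2]; rewrite opprD addrACA.
by apply: le_lt_trans (qabsD _ _) _; rewrite [e]splitr ltrD.
Qed.

Lemma qlimMl x u l : qlim u l -> qlim (fun n => x * u n) (x * l).
Proof.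
move=> hu e e0; have K0 : 0 < qabs x + 1 by rewrite ltr_wpDl ?qabs_ge0.
have [|N1 h1] := hu (e / (qabs x + 1)); first by rewrite divr_gt0.
exists N1 => N /h1; rewrite -mulrBr qabsM ltr_pdivlMr // mulrC; apply: le_lt_trans.
by rewrite ler_wpM2r ?qabs_ge0 // lerDl.
Qed.

Lemma qlimMr x u l : qlim u l -> qlim (fun n => u n * x) (l * x).
Proof.
move=> hu e e0; have K0 : 0 < qabs x + 1 by rewrite ltr_wpDl ?qabs_ge0.
have [|N1 h1] := hu (e / (qabs x + 1)); first by rewrite divr_gt0.
exists N1 => N /h1; rewrite -mulrBl qabsM ltr_pdivlMr //; apply: le_lt_trans.
by rewrite ler_wpM2l ?qabs_ge0 // lerDl.
Qed.

Lemma qlim_emb (I : quat R) (c : nat -> R[i]) (z l : R[i]) : imag_units I -> pser c z l ->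
  qlim (fun N => \sum_(n < N) emb I (c n * z ^+ n)) (emb I l).
Proof.
move=> hI h e /h[N0 hN]; exists N0 => N /hN.
by rewrite -(emb_sum I N (fun n => c n * z ^+ n)) -embB qabs_emb // cmodB.
Qed.

Lemma half_pow_lt r e : 0 < e -> exists N0 : nat, forall N, (N0 <= N)%N -> r * (1 / 2) ^+ N < e.
Proof.
move=> e0; exists (Num.truncn (r / e)).+1 => N hN.
rewrite expr_div_n expr1n mul1r ltr_pdivrMr ?exprn_gt0 // [ltRHS]mulrC -ltr_pdivrMr //.
apply: lt_trans (truncnS_gt _) _; rewrite -natrX ltr_nat.
exact: leq_ltn_trans hN (ltn_expl _ _).
Qed.

Lemma qseries_tail u C q N k : 0 <= C -> 0 <= q <= 1 / 2 -> (forall n, qabs (u n) <= C * q ^+ n) ->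
  qabs (\sum_(n < N + k) u n - \sum_(n < N) u n) <= 2 * C * q ^+ N.
Proof.
move=> C0 /andP[q0 q2] hC.
suff : qabs (\sum_(n < N + k) u n - \sum_(n < N) u n) <= 2 * C * (q ^+ N - q ^+ (N + k)).
  by move=> /le_trans; apply; rewrite ler_wpM2l ?mulr_ge0 // gerBl exprn_ge0.
elim: k => [|k IH]; first by rewrite addn0 !subrr qabs0 mulr0.
rewrite addnS big_ord_recr /= -addrAC; apply: le_trans (qabsD _ _) _.
apply: le_trans (lerD IH (hC _)) _; rewrite exprS.
have : 0 <= C * q ^+ (N + k) * (1 - 2 * q) by rewrite !mulr_ge0 ?exprn_ge0 // subr_ge0; lra.
by lra.
Qed.

Lemma qseries_cvg u C q : 0 <= C -> 0 <= q <= 1 / 2 -> (forall n, qabs (u n) <= C * q ^+ n) ->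
  exists l, forall N, qabs (\sum_(n < N) u n - l) <= 8 * C * q ^+ N.
Proof.
move=> C0 hq hC; pose S N := \sum_(n < N) u n.
have tail N k : qabs (S (N + k)%N - S N) <= 2 * C * q ^+ N by exact: qseries_tail.
have lim (p : quat R -> R) : (forall x y, p (x - y) = p x - p y) -> (forall x, `|p x| <= qabs x) ->
    exists l : R, forall N, `|l - p (S N)| <= 2 * C * q ^+ N.
  move=> pB ple; apply: (@real_limit R (fun N => p (S N)) (fun N => 2 * C * q ^+ N)) => N k.
  by rewrite -pB; apply: le_trans (ple _) (tail N k).
have [|x|a ha] := lim (fun x => x.1.1) => //; first by case: (qcomp_le_abs x).
have [|x|b hb] := lim (fun x => x.1.2) => //; first by case: (qcomp_le_abs x).
have [|x|c hc] := lim (fun x => x.2.1) => //; first by case: (qcomp_le_abs x).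
have [|x|d hd] := lim (fun x => x.2.2) => //; first by case: (qcomp_le_abs x).
exists ((a, b), (c, d)) => N; rewrite qabsB; apply: le_trans (qabs_le_norm _) _.
have -> : 8 * C * q ^+ N = 4 * (2 * C * q ^+ N) by ring.
rewrite ler_wpM2l // /Num.norm /= !ge_max.
by apply/andP; split; apply/andP; split; [exact: ha|exact: hb|exact: hc|exact: hd].
Qed.

Lemma qlim_geom u l K q : 0 <= K -> 0 <= q <= 1 / 2 -> (forall N, qabs (u N - l) <= K * q ^+ N) -> qlim u l.
Proof.
move=> K0 /andP[q0 q2] h e /(half_pow_lt K)[N0 hN]; exists N0 => N /hN; apply: le_lt_trans.
apply: le_trans (h N) _; rewrite ler_wpM2l // lerXn2r // nnegrE; lra.
Qed.

(* Mertens: the N-th partial sum of the Cauchy product is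
   \sum_(k < N) x_k B_(N - k), where B is the partial sum of y. *)
Lemma qlim_cauchy_product (x y : nat -> quat R) (X Y : quat R) C K q : 0 <= C -> 0 <= K -> 0 <= q <= 1 / 4 ->
  (forall n, qabs (x n) <= C * q ^+ n) ->
  qlim (fun N => \sum_(n < N) x n) X ->
  (forall N, qabs (\sum_(n < N) y n - Y) <= K * q ^+ N) ->
  qlim (fun N => \sum_(m < N) \sum_(k < m.+1) x k * y (m - k)%N) (X * Y).
Proof.
move=> C0 K0 /andP[q0 q4] hx hX hY.
have E N : \sum_(m < N) \sum_(k < m.+1) x k * y (m - k)%N = \sum_(k < N) x k * \sum_(n < N - k) y n.
  elim: N => [|N IH]; first by rewrite !big_ord0.
  rewrite big_ord_recr /= IH.
  have -> : \sum_(k < N.+1) x k * \sum_(n < N.+1 - k) y n =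
     \sum_(k < N.+1) (x k * \sum_(n < N - k) y n + x k * y (N - k)%N).
    apply: eq_bigr => k _; rewrite -mulrDr; congr (_ * _).
    by rewrite subSn ?big_ord_recr // -ltnS.
  rewrite big_split /=; congr (_ + _).
  by rewrite big_ord_recr /= subnn big_ord0 mulr0 addr0.
have h : qlim (fun N => \sum_(k < N) x k * (\sum_(n < N - k) y n - Y)) 0.
  apply: (@qlim_geom _ _ (C * K) (1 / 2)); [by rewrite mulr_ge0|lra|] => N.
  rewrite subr0; apply: le_trans (qabs_sum _ _ _) _.
  apply: (@le_trans _ _ (\sum_(k < N) C * K * q ^+ N)).
    apply: ler_sum => k _; rewrite qabsM.
    apply: le_trans (ler_pM (qabs_ge0 _) (qabs_ge0 _) (hx k) (hY (N - k)%N)) _.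
    by rewrite mulrACA -exprD subnKC // ltnW.
  rewrite sumr_const card_ord -[leLHS]mulr_natr -[leLHS]mulrA ler_wpM2l ?mulr_ge0 //.
  (* The N error terms are each at most C K q^N; q <= 1 / 4 and N <= 2^N leave (1 / 2)^N. *)
  apply: (@le_trans _ _ ((1 / 4) ^+ N * 2 ^+ N)).
    apply: ler_pM; rewrite ?exprn_ge0 // ?lerXn2r ?nnegrE //; try lra.
    by rewrite -natrX ler_nat ltnW // ltn_expl.
  by rewrite -exprMn (_ : 1 / 4 * 2 = 1 / 2) //; field.
have := qlimD h (qlimMr Y hX); rewrite add0r; apply: qlim_ext => N.
rewrite E mulr_suml -big_split /=; apply: eq_bigr => k _.
by rewrite mulrBr subrK.
Qed.

End QuaternionLimits.

(** * Quaternionic power series and their star products *)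

Section QuaternionPowerSeries.
Variable R : realType.
Implicit Types (a b : nat -> quat R) (f g : quat R -> quat R) (xi : quat R).

Definition qentire_coefs a := forall r : R, 0 < r ->
  exists2 C, 0 <= C & forall n, qabs (a n) * r ^+ n <= C.

Lemma qpseriesP a f : is_qpseries a f <->
  forall xi, qlim (fun N => \sum_(n < N) xi ^+ n * a n) (f xi).
Proof.
have E xi : (fun N => \sum_(0 <= n < N) xi ^+ n * a n) = (fun N => \sum_(n < N) xi ^+ n * a n).
  by apply/funext => N; rewrite big_mkord.
by split=> h xi; have := h xi; rewrite E => /qlimP.
Qed.

(** Bounding the coefficients at radius 4 s + 1 gives a ratio at most 1 / 4, as the Cauchy product
    requires; the summand 1 keeps the radius positive when s = 0. *)
Lemma qterm_bound a (s : R) : qentire_coefs a -> 0 <= s -> exists2 C, 0 <= C &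
  forall xi n, qabs xi <= s -> qabs (xi ^+ n * a n) <= C * (s / (4 * s + 1)) ^+ n.
Proof.
move=> ha s0; have r0 : 0 < 4 * s + 1 by rewrite ltr_wpDl // mulr_ge0.
have [C C0 hC] := ha _ r0; exists C => // xi n hxi.
rewrite qabsM qabsX expr_div_n mulrA ler_pdivlMr ?exprn_gt0 //.
have -> : qabs xi ^+ n * qabs (a n) * (4 * s + 1) ^+ n = qabs (a n) * (4 * s + 1) ^+ n * qabs xi ^+ n by ring.
apply: ler_pM; rewrite ?mulr_ge0 ?qabs_ge0 ?exprn_ge0 ?qabs_ge0 ?(ltW r0) //.
by rewrite lerXn2r // nnegrE ?qabs_ge0.
Qed.

Lemma qratio (s : R) : 0 <= s -> 0 <= s / (4 * s + 1) <= 1 / 4.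
Proof.
move=> s0; have r0 : 0 < 4 * s + 1 by rewrite ltr_wpDl // mulr_ge0.
by rewrite divr_ge0 ?(ltW r0) //= ler_pdivrMr //; lra.
Qed.

Lemma qentire_cvg a xi : qentire_coefs a ->
  exists l, qlim (fun N => \sum_(n < N) xi ^+ n * a n) l.
Proof.
move=> ha; have [C C0 hq] := qterm_bound ha (qabs_ge0 xi).
have /andP[q0 q1] := qratio (qabs_ge0 xi).
have hq' n := hq xi n (lexx _); have q2 : 0 <= qabs xi / (4 * qabs xi + 1) <= 1 / 2 by lra.
have [l hl] := qseries_cvg C0 q2 hq'.
by exists l; apply: (qlim_geom _ q2 hl); rewrite mulr_ge0.
Qed.

Lemma qseries_rate a xi (s : R) l : qentire_coefs a -> qabs xi <= s ->
  qlim (fun N => \sum_(n < N) xi ^+ n * a n) l ->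
  exists2 K, 0 <= K & forall N, qabs (\sum_(n < N) xi ^+ n * a n - l) <= K * (s / (4 * s + 1)) ^+ N.
Proof.
move=> ha xs hl; have s0 : 0 <= s := le_trans (qabs_ge0 xi) xs.
have [C C0 hq] := qterm_bound ha s0; have /andP[q0 q1] := qratio s0.
have q2 : 0 <= s / (4 * s + 1) <= 1 / 2 by lra.
have [l' hl'] := qseries_cvg C0 q2 (fun n => hq xi n xs).
have C80 : 0 <= 8 * C by rewrite mulr_ge0.
by exists (8 * C) => //; rewrite (qlim_uniq hl (qlim_geom C80 q2 hl')).
Qed.

Lemma qrealX (x : R) n : (x *: (1 : quat R) : quat R) ^+ n = x ^+ n *: (1 : quat R).
Proof.
elim: n => [|n IH]; first by rewrite !expr0 scale1r.
by rewrite exprS IH qscalel mul1r scalerA -exprS.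
Qed.

(** Agreement on the real axis suffices, since there the first differing term x^m c_m would be
    O(x^(m+1)). The real axis lies in every slice, so expansions found in different slices can be
    compared. *)
Lemma qcoef_uniq a b : (forall x : R, exists l,
    qlim (fun N => \sum_(n < N) (x *: (1 : quat R) : quat R) ^+ n * a n) l /\
    qlim (fun N => \sum_(n < N) (x *: (1 : quat R) : quat R) ^+ n * b n) l) -> a =1 b.
Proof.
move=> h; pose c n := a n - b n.
have hx (x : R) : qlim (fun N => \sum_(n < N) x ^+ n *: c n) 0.
  have [l [ha hb]] := h x; have := qlimD ha (qlimMl (-1) hb).
  rewrite mulN1r subrr; apply: qlim_ext => N.
  rewrite mulr_sumr -big_split; apply: eq_bigr => n _ /=.
  by rewrite qrealX !qscalel !mul1r mulN1r -scalerBr.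
(* From some rank on, two consecutive partial sums at x = 1 have modulus less than 1, so each term
   is at most 2; the finitely many others are added. *)
have [B B0 hB] : exists2 B, 0 <= B & forall n, qabs (c n) <= B.
  have [N0 hN] := hx 1 1 ltr01.
  exists (2 + \sum_(n < N0) qabs (c n)); first by rewrite addr_ge0 // sumr_ge0 // => n _; exact: qabs_ge0.
  move=> n; have [nN|Nn] := ltnP n N0.
    rewrite (bigD1 (Ordinal nN)) //= addrCA lerDl addr_ge0 // sumr_ge0 // => m _; exact: qabs_ge0.
  apply: (@le_trans _ _ 2); last by rewrite lerDl sumr_ge0 // => m _; exact: qabs_ge0.
  have h1 := hN _ Nn; have h2 := hN _ (leqW Nn).
  rewrite big_ord_recr /= expr1n scale1r !subr0 in h1 h2.
  have -> : c n = (\sum_(i < n) 1 ^+ i *: c i + c n) - \sum_(i < n) 1 ^+ i *: c i by rewrite addrAC subrr add0r.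
  by apply: le_trans (qabsD _ _) _; rewrite qabsN; lra.
suff c0 n : c n = 0 by move=> n; apply/eqP; rewrite -subr_eq0 -/(c n) c0.
elim/ltn_ind: n => m IH.
suff : qabs (c m) <= 0.
  rewrite le_eqVlt ltNge qabs_ge0 orbF => /eqP E.
  have [h1 h2 h3 h4] := qcomp_le_abs (c m); rewrite E in h1 h2 h3 h4.
  by apply: quat_eq; apply/eqP; rewrite -normr_le0.
apply/ler_addgt0Pr => e e0; rewrite add0r.
pose x := Num.min (1 / 2) (e / (2 * B + 1)).
have K0 : 0 < 2 * B + 1 by rewrite ltr_wpDl // mulr_ge0.
have x0 : 0 < x by rewrite lt_min !divr_gt0.
have x1 : x <= 1 / 2 by rewrite ge_min lexx.
have x2 : x * (2 * B + 1) <= e by rewrite -ler_pdivlMr // ge_min lexx orbT.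
have x12 : 0 <= x <= 1 / 2 by rewrite ltW.
have ub n : qabs (x ^+ n *: c n) <= B * x ^+ n.
  by rewrite qabsZ ger0_norm ?exprn_ge0 ?(ltW x0) // mulrC ler_wpM2r ?exprn_ge0 ?(ltW x0).
have S1 : \sum_(n < m.+1) x ^+ n *: c n = x ^+ m *: c m.
  by rewrite big_ord_recr /= big1 ?add0r // => i _; rewrite IH ?scaler0.
suff : qabs (x ^+ m *: c m) <= 2 * B * x ^+ m.+1.
  rewrite qabsZ ger0_norm ?exprn_ge0 ?(ltW x0) // exprSr mulrA mulrAC mulrC ler_pM2r ?exprn_gt0 //.
  by move=> /le_trans; apply; apply: le_trans x2; lra.
apply/ler_addgt0Pr => e' e'0; have [N0 hN] := hx x e' e'0.
have h1 := hN (m.+1 + N0)%N (leq_addl _ _); rewrite subr0 in h1.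
have h2 := qseries_tail m.+1 N0 B0 x12 ub; rewrite S1 in h2.
set S := \sum_(n < m.+1 + N0) _ in h1 h2.
have -> : x ^+ m *: c m = S - (S - x ^+ m *: c m) by rewrite opprB addrC subrK.
by apply: le_trans (qabsD _ _) _; rewrite qabsN; lra.
Qed.

Lemma qcoefE a f : is_qpseries a f -> qcoef f = a.
Proof.
move=> hf; rewrite /qcoef; case: xgetP => [b _ hb|/(_ a)]; last by case.
apply/funext; apply: qcoef_uniq => x; exists (f (x *: (1 : quat R))).
by split; [move/qpseriesP : hb|move/qpseriesP : hf]; exact.
Qed.

Definition qconv a b n : quat R := \sum_(k < n.+1) a k * b (n - k)%N.

Lemma qentire_conv a b : qentire_coefs a -> qentire_coefs b -> qentire_coefs (qconv a b).
Proof.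
move=> ha hb r r0; have r20 : 0 < 2 * r by rewrite mulr_gt0.
have [C C0 hC] := ha _ r20; have [D D0 hD] := hb _ r20.
exists (C * D) => [|n]; first by rewrite mulr_ge0.
have rn : 0 < r ^+ n by rewrite exprn_gt0.
have rn2 : 0 < (2 * r) ^+ n by rewrite exprn_gt0.
rewrite -ler_pdivlMr //; apply: le_trans (qabs_sum _ _ _) _.
apply: (@le_trans _ _ (\sum_(k < n.+1) C * D / (2 * r) ^+ n)).
  apply: ler_sum => k _; rewrite qabsM ler_pdivlMr //.
  have -> : (2 * r) ^+ n = (2 * r) ^+ k * (2 * r) ^+ (n - k) by rewrite -exprD subnKC // -ltnS.
  by rewrite mulrACA; apply: ler_pM; rewrite ?mulr_ge0 ?qabs_ge0 ?exprn_ge0 ?(ltW r20).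
rewrite sumr_const card_ord -[leLHS]mulr_natr -[leLHS]mulrA ler_wpM2l ?mulr_ge0 //.
rewrite exprMn invfM -mulrA mulrCA ler_piMr ?invr_ge0 ?(ltW rn) //.
by rewrite mulrC ler_pdivrMr ?exprn_gt0 // mul1r -natrX ler_nat ltn_expl.
Qed.

Lemma qstar_series f g a b : is_qpseries a f -> is_qpseries b g -> qentire_coefs a ->
  qentire_coefs b -> is_qpseries (qconv a b) (qstar f g).
Proof.
move=> hf hg ha hb; apply/qpseriesP => xi.
have [l hl] := qentire_cvg xi (qentire_conv ha hb).
rewrite /qstar (qcoefE hf) (qcoefE hg).
suff -> : \big[+%R/0]_(0 <= n <oo) (xi ^+ n * \sum_(k < n.+1) a k * b (n - k)%N) = l by [].
apply: qlim_lim; apply: qlim_ext hl => N.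
by rewrite big_mkord.
Qed.

Fixpoint qconv_pow a n : nat -> quat R :=
  if n is m.+1 then qconv a (qconv_pow a m) else fun k => if k == 0%N then 1 else 0.

Lemma qstar_pow_series f a n : is_qpseries a f -> qentire_coefs a ->
  is_qpseries (qconv_pow a n) (qstar_pow f n) /\ qentire_coefs (qconv_pow a n).
Proof.
move=> hf ha; elim: n => [|n [IH1 IH2]]; last first.
  by split; [exact: qstar_series|exact: qentire_conv].
split=> [|r r0]; last first.
  exists 1 => // -[|m] /=; first by rewrite qabs1 mul1r expr0.
  by rewrite qabs0 mul0r.
apply/qpseriesP => xi e e0; exists 1%N => -[//|N] _.
rewrite big_ord_recl /= expr0 mulr1 big1 => [|i _]; last by rewrite mulr0.
by rewrite addr0 subrr qabs0.
Qed.

End QuaternionPowerSeries.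

(** * Power series expansion of slice regular functions *)

Section SliceRegular.
Variable R : realType.
Implicit Types (f : quat R -> quat R) (I J : quat R) (z w : R[i]).

Let I0 : quat R := ((0, 1), (0, 0)).
Let J0 : quat R := ((0, 0), (1, 0)).

Lemma I0_unit : imag_units I0.
Proof. by apply: imag_unit_intro; rewrite /qdot /=; ring. Qed.

Lemma quat_split (x : quat R) : x = emb I0 (x.1.1 +i* x.1.2) + emb I0 (x.2.1 +i* x.2.2) * J0.
Proof.
case: x => [[a b] [c d]]; rewrite !embE !qE.
by apply: quat_eq => /=; ring.
Qed.

(** The quaternion u = 1 - I I0 satisfies I u = I + I0 = u I0. It vanishes only for I = - I0, where
    J0 takes its place. *)
Lemma conjugating_quat I : imag_units I -> exists u : quat R, 0 < qabs u /\
  forall z, emb I z * u = u * emb I0 z.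
Proof.
move=> /imag_unitP; case: I => [[a b] [c d]] /= [-> h].
have [E|E] := eqVneq (((0, b), (c, d)) : quat R) ((0, -1), (0, 0)).
  case: E => -> -> ->; exists J0; split; first by rewrite (@qabs_unique R J0 1) // /qdot /=; ring.
  by move=> z; rewrite !embE !qE; apply: quat_eq => /=; ring.
have hq : b * b + c * c + d * d = 1 by move: h; rewrite /qdot /=; lra.
exists ((1 + b, 0), (- d, c)); split.
  have u2 : qabs (((1 + b, 0), (- d, c)) : quat R) ^+ 2 = 2 * (1 + b).
    by rewrite qabs_sqr /qdot /=; lra.
  have b1 : 0 <= 1 + b.
    by have := sqr_ge0 (qabs (((1 + b, 0), (- d, c)) : quat R)); rewrite u2; lra.
  have {}b1 : 0 < 1 + b.
    rewrite lt0r b1 andbT; apply: contra_neq E => b0.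
    have sq (t : R) : 0 <= t * t by rewrite -expr2 sqr_ge0.
    have bm : b = -1 by lra.
    have hcd : c * c + d * d = 0 by move: hq; rewrite bm; lra.
    have c0 : c = 0 by apply/eqP; rewrite -sqrf_eq0 expr2; apply/eqP; have := sq c; have := sq d; lra.
    have d0 : d = 0 by apply/eqP; rewrite -sqrf_eq0 expr2; apply/eqP; have := sq c; have := sq d; lra.
    by rewrite c0 d0 bm.
  rewrite lt0r qabs_ge0 andbT -sqrf_eq0 u2 gt_eqF // mulr_gt0 //.
move=> z; rewrite !embE !qE.
have key t : t * b * b + t * c * c + t * d * d = t.
  have -> : t * b * b + t * c * c + t * d * d = t * (b * b + c * c + d * d) by ring.
  by rewrite hq mulr1.
by have := key (complex.Im z); move=> k; apply: quat_eq => /=; lra.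
Qed.

(* With h small, psi (x + h) - psi x is 'd psi x h; the Cauchy-Riemann equation
   makes the differential left-linear over the slice C_I. *)
Lemma slice_regular_deriv f I z : slice_regular f -> imag_units I ->
  exists L : quat R, forall e : R, 0 < e -> exists2 d : R, 0 < d & forall w, cmod (w - z) < d ->
    qabs (f (emb I w) - f (emb I z) - emb I (w - z) * L) <= e * cmod (w - z).
Proof.
move=> [fd fCR] hI; set x0 := emb I z.
have df := fd x0; pose D (h : quat R) : quat R := 'd f x0 h.
have DZ (r : R) h : D (r *: h) = r *: D h by rewrite /D linearZ.
have DD h h' : D (h + h') = D h + D h' by rewrite /D linearD.
have loc (e : R) : 0 < e -> exists2 d : R, 0 < d & forall h : quat R, `|h| < d ->
    `|f (h + x0) - (f x0 + D h)| <= e * `|h|.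
  move=> e0; have /eqaddoP /(_ e e0) := diff_locally df.
  by move=> /nbhs_norm0P[d /= d0 hd]; exists d => // h; exact: hd.
have z_eta : complex.Re z +i* complex.Im z = z by case: (z).
have dir (v : quat R) (g : R -> quat R) (t : R) : (forall h, g (h + t) = f (h *: v + x0)) -> derive1 g t = D v.
  move=> gE; have g0 : g t = f x0 by rewrite -[t]add0r gE scale0r add0r.
  rewrite /derive1 g0; apply/cvg_lim; first exact: norm_hausdorff.
  apply/cvgrPdist_le => e e0; have K0 : 0 < `|v| + 1 by rewrite ltr_wpDl.
  have [|d d0 hd] := loc (e / (`|v| + 1)); first by rewrite divr_gt0.
  rewrite near_withinE; apply/nbhs_ballP; exists (d / (`|v| + 1)) => /=; first by rewrite divr_gt0.
  move=> h; rewrite /ball /= sub0r normrN => hdh h0.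
  have hv : `|h *: v| < d.
    rewrite normrZ; apply: (@le_lt_trans _ _ (`|h| * (`|v| + 1))).
      by rewrite ler_wpM2l // lerDl.
    by rewrite -ltr_pdivlMr.
  have := hd _ hv; rewrite -gE => H.
  have -> : D v - h^-1 *: (g (h + t) - f x0) = - (h^-1 *: (g (h + t) - (f x0 + D (h *: v)))).
    have -> : g (h + t) - (f x0 + D (h *: v)) = (g (h + t) - f x0) - h *: D v.
      by rewrite DZ opprD addrA.
    by rewrite [in RHS]scalerBr scalerA mulVf // scale1r opprB.
  rewrite normrN normrZ normfV ler_pdivrMl ?normr_gt0 //; apply: le_trans H _.
  rewrite normrZ mulrCA ler_wpM2l // -mulrA ler_piMr ?(ltW e0) //.
  by rewrite mulrC ler_pdivrMr // mul1r lerDl.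
have d1 : derive1 (fun t : R => f (emb I (t +i* complex.Im z))) (complex.Re z) = D (1 : quat R).
  by apply: dir => h; congr (f _); rewrite /x0 /emb /= scalerDl addrA.
have dI : derive1 (fun t : R => f (emb I (complex.Re z +i* t))) (complex.Im z) = D I.
  by apply: dir => h; congr (f _); rewrite /x0 /emb /= scalerDl addrCA.
have := fCR I hI (complex.Re z) (complex.Im z); rewrite d1 dI => /eqP.
rewrite scaler_eq0 invr_eq0 pnatr_eq0 /= addr_eq0 => /eqP CR.
have ID : I * D (1 : quat R) = D I by rewrite CR mulrN mulrA hI mulN1r opprK.
have DE h : D (emb I h) = emb I h * D (1 : quat R).
  by rewrite /emb DD !DZ mulrDl !qscalel mul1r ID.
exists (D (1 : quat R)) => e e0; have [|d d0 hd] := loc (e / 4); first by rewrite divr_gt0.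
exists d => // w wz; have := hd (emb I (w - z)).
have n1 : `|emb I (w - z)| <= cmod (w - z).
  by apply: le_trans (norm_le_qabs _) _; rewrite qabs_emb.
move=> /(_ (le_lt_trans n1 wz)); rewrite DE {1}embB subrK => h.
have -> : f (emb I w) - f x0 - emb I (w - z) * D (1 : quat R) = f (emb I w) - (f x0 + emb I (w - z) * D (1 : quat R)).
  by rewrite opprD addrA.
apply: le_trans (qabs_le_norm _) _; have := le_trans h (ler_wpM2l _ n1).
by move=> /(_ ltac:(by rewrite divr_ge0 // ltW)); lra.
Qed.

(** Left multiplication by v = u^-1 carries the slice C_I to the standard slice, where the two
    complex components are read off the coordinates. This provides a splitting on each slice without
    choosing a perpendicular unit. *)
Lemma slice_regular_split f I : slice_regular f -> imag_units I ->
  exists u P Q, [/\ 0 < qabs u, forall z, emb I z * u = u * emb I0 z, entire P, entire Q &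
    forall z, f (emb I z) = u * (emb I0 (P z) + emb I0 (Q z) * J0)].
Proof.
move=> hf hI; have [u [u0 hu]] := conjugating_quat hI.
pose v : quat R := (qabs u ^- 2) *: qconj u.
have uv : u * v = 1.
  rewrite /v qscaler; have -> : u * qconj u = (qabs u ^+ 2) *: (1 : quat R).
    by rewrite qabs_sqr; case: (u) => [[a b] [c d]]; rewrite /qconj !qE /qdot; apply: quat_eq => /=; ring.
  by rewrite scalerA mulVf ?scale1r // expf_neq0 // gt_eqF.
have vu : v * u = 1.
  rewrite /v qscalel; have -> : qconj u * u = (qabs u ^+ 2) *: (1 : quat R).
    by rewrite qabs_sqr; case: (u) => [[a b] [c d]]; rewrite /qconj !qE /qdot; apply: quat_eq => /=; ring.
  by rewrite scalerA mulVf ?scale1r // expf_neq0 // gt_eqF.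
pose g z := v * f (emb I z).
have vI z : v * emb I z = emb I0 z * v.
  by rewrite -[LHS]mulr1 -uv mulrA -(mulrA v) hu mulrA vu mul1r.
have hd z : exists L, forall e : R, 0 < e -> exists2 d : R, 0 < d & forall w, cmod (w - z) < d ->
    qabs (g w - g z - emb I0 (w - z) * L) <= e * cmod (w - z).
  have [L hL] := slice_regular_deriv z hf hI; exists (v * L) => e e0.
  have K0 : 0 < qabs v + 1 by rewrite ltr_wpDl ?qabs_ge0.
  have [|d d0 hd] := hL (e / (qabs v + 1)); first by rewrite divr_gt0.
  exists d => // w /hd h.
  have -> : g w - g z - emb I0 (w - z) * (v * L) = v * (f (emb I w) - f (emb I z) - emb I (w - z) * L).
    by rewrite !mulrBr mulrA -vI -mulrA.
  rewrite qabsM; apply: le_trans (ler_wpM2l (qabs_ge0 _) h) _.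
  rewrite mulrA ler_wpM2r ?cmod_ge0 // mulrCA ler_piMr ?(ltW e0) //.
  by rewrite ler_pdivrMr // mul1r lerDl.
exists u, (fun z => (g z).1.1 +i* (g z).1.2), (fun z => (g z).2.1 +i* (g z).2.2); split => //.
- apply/entireP => z; have [L hL] := hd z; exists (L.1.1 +i* L.1.2) => e e0.
  have [|d d0 h] := hL (e / 2); first by rewrite divr_gt0.
  exists d => // w /h; set X := g w - g z - _ => hX.
  have -> : (g w).1.1 +i* (g w).1.2 - ((g z).1.1 +i* (g z).1.2) - (L.1.1 +i* L.1.2) * (w - z) = X.1.1 +i* X.1.2.
    rewrite /X; move: (g w) (g z) => [[? ?] [? ?]] [[? ?] [? ?]]; case: (L) => [[? ?] [? ?]].
    by rewrite embE !qE; case: (w - z) => ? ?; apply/complex_eq => /=; ring.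
  have [h1 h2 _ _] := qcomp_le_abs X.
  by apply: le_trans (cmod_leD _) _ => /=; lra.
- apply/entireP => z; have [L hL] := hd z; exists (L.2.1 +i* L.2.2) => e e0.
  have [|d d0 h] := hL (e / 2); first by rewrite divr_gt0.
  exists d => // w /h; set X := g w - g z - _ => hX.
  have -> : (g w).2.1 +i* (g w).2.2 - ((g z).2.1 +i* (g z).2.2) - (L.2.1 +i* L.2.2) * (w - z) = X.2.1 +i* X.2.2.
    rewrite /X; move: (g w) (g z) => [[? ?] [? ?]] [[? ?] [? ?]]; case: (L) => [[? ?] [? ?]].
    by rewrite embE !qE; case: (w - z) => ? ?; apply/complex_eq => /=; ring.
  have [_ _ h1 h2] := qcomp_le_abs X.
  by apply: le_trans (cmod_leD _) _ => /=; lra.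
move=> z; have -> := esym (quat_split (g z)).
by rewrite /g mulrA uv mul1r.
Qed.

Lemma split_qentire I (J : quat R) (p q : nat -> R[i]) : imag_units I -> entire_coefs p -> entire_coefs q ->
  qentire_coefs (fun n => emb I (p n) + emb I (q n) * J).
Proof.
move=> hI hp hq r r0; have [C C0 hC] := hp r r0; have [D D0 hD] := hq r r0.
exists (C + D * qabs J) => [|n]; first by rewrite addr_ge0 // mulr_ge0 // qabs_ge0.
apply: le_trans (ler_wpM2r (exprn_ge0 _ (ltW r0)) (qabsD _ _)) _; rewrite mulrDl lerD //.
  by rewrite qabs_emb.
by rewrite qabsM qabs_emb // mulrAC ler_wpM2r ?qabs_ge0.
Qed.

Lemma split_qseries I (J : quat R) (p q : nat -> R[i]) z a b : imag_units I -> pser p z a -> pser q z b ->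
  qlim (fun N => \sum_(n < N) emb I z ^+ n * (emb I (p n) + emb I (q n) * J)) (emb I a + emb I b * J).
Proof.
move=> hI /(qlim_emb hI) ha /(qlim_emb hI) hb.
have := qlimD ha (qlimMr J hb); apply: qlim_ext => N.
rewrite mulr_suml -big_split; apply: eq_bigr => n _ /=.
rewrite mulrDr mulrA -(embX z n hI) -(embM _ (p n) hI) -(embM _ (q n) hI).
by rewrite (mulrC _ (p n)) (mulrC _ (q n)).
Qed.

(** Each slice has its own convergent expansion. All of them describe f on the real axis, where
    [qcoef_uniq] forces the coefficients to be those of the slice C_I. *)
Theorem slice_regular_qpseries f I J P Q : slice_regular f -> imag_units I ->
  entire P -> entire Q -> (forall z, f (emb I z) = emb I (P z) + emb I (Q z) * J) ->
  exists p q, [/\ entire_coefs p, entire_coefs q, forall z, pser p z (P z), forall z, pser q z (Q z) &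
    is_qpseries (fun n => emb I (p n) + emb I (q n) * J) f].
Proof.
move=> hf hI Pe Qe fE; have [p hp] := taylor Pe; have [q hq] := taylor Qe.
have ep := taylor_coefs_entire Pe hp; have eq := taylor_coefs_entire Qe hq.
have sp z := taylor_pser z Pe hp; have sq z := taylor_pser z Qe hq.
exists p, q; split=> //; apply/qpseriesP => xi.
have [I' [z [hI' ->]]] := quat_slice xi hI.
have [u [P' [Q' [u0 hu P'e Q'e fE']]]] := slice_regular_split hf hI'.
have [p' hp'] := taylor P'e; have [q' hq'] := taylor Q'e.
have sp' w := taylor_pser w P'e hp'; have sq' w := taylor_pser w Q'e hq'.
have hz w : qlim (fun N => \sum_(n < N) emb I' w ^+ n * (u * (emb I0 (p' n) + emb I0 (q' n) * J0))) (f (emb I' w)).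
  rewrite fE'; have := qlimMl u (split_qseries J0 I0_unit (sp' w) (sq' w)).
  apply: qlim_ext => N; rewrite mulr_sumr; apply: eq_bigr => n _.
  by rewrite !mulrA -(embX w n hI') -(embX w n I0_unit) hu.
suff -> : (fun N => \sum_(n < N) emb I' z ^+ n * (emb I (p n) + emb I (q n) * J)) =
    (fun N => \sum_(n < N) emb I' z ^+ n * (u * (emb I0 (p' n) + emb I0 (q' n) * J0))) by exact: hz.
apply/funext => N; apply: eq_bigr => n _; congr (_ * _); move: n.
suff E : (fun n => emb I (p n) + emb I (q n) * J) =1 (fun n => u * (emb I0 (p' n) + emb I0 (q' n) * J0)).
  by move=> n; exact: E.
apply: qcoef_uniq => x; exists (f (emb I x%:C)); split.
  by rewrite fE -(emb_real I); exact: split_qseries.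
by rewrite (emb_real I) -(emb_real I'); exact: hz.
Qed.

End SliceRegular.

(** * Star powers and the composition with a kernel *)

Section RingIdentities.
Variable T : nzRingType.
Implicit Types (a b c p q j x y : T).

Lemma mulr_commute_mid a b c p : c * p = p * c -> a * p * (c * b) = a * c * (p * b).
Proof. by move=> h; rewrite !mulrA -(mulrA a c) h mulrA. Qed.

Lemma mulr_commute_mid2 a b c c' q j : c * q = q * c -> c * j = j * c' ->
  a * (q * j) * (c' * b) = a * c * (q * j * b).
Proof. by move=> h h'; rewrite !mulrA -(mulrA a c) h -(mulrA a (q * c) j) -(mulrA q c j) h' !mulrA. Qed.

(** One step of the matrix product for elements x + y j; [xc] and [yc] play the conjugates of x' and
    y', and the hypotheses record how j commutes past them. *)
Lemma split_product p q j x y x' y' xc yc : j * j = -1 -> j * x' = xc * j -> j * y' = yc * j ->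
  p * (x + y * j) + q * j * (x' + y' * j) = (p * x - q * yc) + (p * y + q * xc) * j.
Proof.
move=> jj hx hy; rewrite !mulrDr -(mulrA q j x') hx -(mulrA q j (y' * j)) (mulrA j y' j) hy.
rewrite -(mulrA yc j j) jj mulrN1 mulrN mulrDl !mulrA -!addrA; congr (_ + _).
by rewrite addrA addrC.
Qed.

Lemma sum_split_linear N (a b c d : nat -> T) k1 k2 k3 k4 j :
  k1 * (\sum_(n < N) a n) + k2 * (\sum_(n < N) b n) +
    (k3 * (\sum_(n < N) c n) + k4 * (\sum_(n < N) d n)) * j =
  \sum_(n < N) (k1 * a n + k2 * b n + (k3 * c n + k4 * d n) * j).
Proof. by rewrite !mulr_sumr -!big_split /= mulr_suml -big_split. Qed.

End RingIdentities.

(** * Star powers of psi on C_I and their exponential series *)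

Section StarPowers.
Variable R : realType.
Implicit Types (z w : R[i]).
Variables (psi : quat R -> quat R) (I J : quat R) (P Q : R[i] -> R[i]).
Hypotheses (psi_reg : slice_regular psi) (I_unit : imag_units I)
  (J_unit : imag_units J) (IJ_perp : perp J I) (P_entire : entire P) (Q_entire : entire Q)
  (psi_split : forall z, psi (emb I z) = emb I (P z) + emb I (Q z) * J).

Lemma emb_perp z : emb I z * J = J * emb I (conjc z).
Proof. by rewrite (perp_emb _ I_unit J_unit IJ_perp) conjcK. Qed.

(** The star product with psi on the left is P(z) g(z) + Q(z) J g(conj z): powers of z commute with
    elements of C_I but are conjugated when they pass J, so the second factor is evaluated at conj
    z. *)
Lemma qconv_value (p q : nat -> R[i]) (b : nat -> quat R) z (Y Y' : quat R) :
  entire_coefs p -> entire_coefs q -> qentire_coefs b ->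
  pser p z (P z) -> pser q z (Q z) ->
  qlim (fun N => \sum_(n < N) emb I z ^+ n * b n) Y ->
  qlim (fun N => \sum_(n < N) emb I (conjc z) ^+ n * b n) Y' ->
  qlim (fun N => \sum_(n < N) emb I z ^+ n * qconv (fun n => emb I (p n) + emb I (q n) * J) b n)
    (emb I (P z) * Y + emb I (Q z) * J * Y').
Proof.
move=> hp hq hb hP hQ hY hY'.
have zs : qabs (emb I z) <= cmod z by rewrite qabs_emb.
have zs' : qabs (emb I (conjc z)) <= cmod z by rewrite qabs_emb // cmod_conj.
have [K K0 hK] := qseries_rate hb zs hY.
have [K' K0' hK'] := qseries_rate hb zs' hY'.
have zero_coefs : entire_coefs (fun=> 0 : R[i]).
  by move=> r r0; exists 0 => // n; rewrite cmod0 mul0r.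
have zero_pser : pser (fun=> 0) z 0.
  by move=> e e0; exists 0%N => N _; rewrite big1 ?subr0 ?cmod0 // => i _; rewrite mul0r.
have hp' := split_qentire J I_unit hp zero_coefs.
have hq' := split_qentire J I_unit zero_coefs hq.
have [C C0 hC] := qterm_bound hp' (cmod_ge0 z).
have [D D0 hD] := qterm_bound hq' (cmod_ge0 z).
have r4 := qratio (cmod_ge0 z).
have h1 := qlim_cauchy_product (y := fun n => emb I z ^+ n * b n) C0 K0 r4 (fun n => hC (emb I z) n zs)
  (split_qseries J I_unit hP zero_pser) hK.
have h2 := qlim_cauchy_product (y := fun n => emb I (conjc z) ^+ n * b n) D0 K0' r4 (fun n => hD (emb I z) n zs)
  (split_qseries J I_unit zero_pser hQ) hK'.
have := qlimD h1 h2; rewrite !emb0 mul0r addr0 add0r.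
apply: qlim_ext => N; rewrite -big_split; apply: eq_bigr => m _ /=.
rewrite /qconv mulr_sumr -big_split; apply: eq_bigr => k _ /=. 
rewrite addr0 ?add0r.
have -> : emb I z ^+ m = emb I z ^+ k * emb I z ^+ (m - k) by rewrite -exprD subnKC // -ltnS.
have comm u : emb I z ^+ (m - k) * emb I u = emb I u * emb I z ^+ (m - k).
  by rewrite -(embX z _ I_unit) -!(embM _ _ I_unit) mulrC.
have commJ : emb I z ^+ (m - k) * J = J * emb I (conjc z) ^+ (m - k).
  by rewrite -!(embX _ _ I_unit) emb_perp rmorphXn.
rewrite (mulrDl (emb I (p k))) (mulrDr (emb I z ^+ k * _)).
by rewrite (mulr_commute_mid _ _ (comm _)) (mulr_commute_mid2 _ _ (comm _) commJ).
Qed.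

(** With [diagonal_power_Q], the first row of A^n = (l1^n (A - l2) - l2^n (A - l1)) / (l1 - l2), for
    A the 2 x 2 matrix with eigenvalues l1 and l2. *)
Definition diagonal_power_P n (Pz l1 l2 : R[i]) := ((Pz - l2) * l1 ^+ n + (l1 - Pz) * l2 ^+ n) / (l1 - l2).
Definition diagonal_power_Q n (Qz l1 l2 : R[i]) := Qz * (l1 ^+ n - l2 ^+ n) / (l1 - l2).

(* psi acts like the matrix ((P, Q), (- Q#, P#)), with eigenvalues l1 and l2;
   star powers correspond to its matrix powers. *)
Lemma qstar_pow_diagonal n z (l1 l2 : R[i]) : l1 != l2 -> l1 + l2 = P z + sharp P z ->
  l1 * l2 = P z * sharp P z + Q z * sharp Q z ->
  qstar_pow psi n (emb I z) =
    emb I (diagonal_power_P n (P z) l1 l2) + emb I (diagonal_power_Q n (Q z) l1 l2) * J.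
Proof.
have [p [q [hp hq hP hQ ha]]] := slice_regular_qpseries psi_reg I_unit P_entire Q_entire psi_split.
have ea := split_qentire J I_unit hp hq.
elim: n z l1 l2 => [|n IH] z l1 l2 l12 hsum hprod.
  have d0 : l1 - l2 != 0 by rewrite subr_eq0.
  rewrite /diagonal_power_P /diagonal_power_Q !expr0 !mulr1 subrr mulr0 mul0r emb0 mul0r addr0.
  have -> : (P z - l2 + (l1 - P z)) / (l1 - l2) = 1 by field.
  by rewrite emb1.
have [hb eb] := qstar_pow_series n ha ea.
have [hc _] := qstar_pow_series n.+1 ha ea.
have := qconv_value hp hq eb (hP z) (hQ z) ((qpseriesP _ _).1 hb _) ((qpseriesP _ _).1 hb _).
move/(qlim_uniq ((qpseriesP _ _).1 hc _)) => ->.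
(* The recursion also needs the n-th power at conj z, where the conjugates of l1 and l2 are the
   eigenvalues. *)
have l12' : conjc l1 != conjc l2 by rewrite (inj_eq (can_inj (@conjcK R))).
have hsum' : conjc l1 + conjc l2 = P (conjc z) + sharp P (conjc z).
  by rewrite -rmorphD hsum rmorphD /sharp /= !conjcK addrC.
have hprod' : conjc l1 * conjc l2 = P (conjc z) * sharp P (conjc z) + Q (conjc z) * sharp Q (conjc z).
  by rewrite -rmorphM hprod rmorphD !rmorphM /sharp /= !conjcK mulrC [X in _ + X]mulrC.
rewrite (IH z l1 l2) // (IH (conjc z) (conjc l1) (conjc l2)) //.
set A := diagonal_power_P n (P z) _ _; set B := diagonal_power_Q n (Q z) _ _.
set A' := diagonal_power_P n (P (conjc z)) _ _; set B' := diagonal_power_Q n (Q (conjc z)) _ _.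
have JJ : J * J = - 1 by [].
have -> : emb I (P z) * (emb I A + emb I B * J) + emb I (Q z) * J * (emb I A' + emb I B' * J) =
   emb I (P z * A - Q z * conjc B') + emb I (P z * B + Q z * conjc A') * J.
  rewrite (split_product _ _ _ _ JJ (perp_emb A' I_unit J_unit IJ_perp) (perp_emb B' I_unit J_unit IJ_perp)).
  by rewrite embB embD (embM (P z) A I_unit) (embM (Q z) _ I_unit) (embM (P z) B I_unit) (embM (Q z) (conjc A') I_unit).
have sP : conjc (P (conjc z)) = l1 + l2 - P z by rewrite hsum addrAC subrr add0r.
have sQ : Q z * conjc (Q (conjc z)) = l1 * l2 - P z * (l1 + l2 - P z).
  by rewrite -sP hprod addrAC subrr add0r.
have d0 : l1 - l2 != 0 by rewrite subr_eq0.
have -> : conjc A' = (((l1 + l2 - P z) - l2) * l1 ^+ n + (l1 - (l1 + l2 - P z)) * l2 ^+ n) / (l1 - l2).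
  rewrite /A' /diagonal_power_P rmorphM fmorphV rmorphD !rmorphM !rmorphB !rmorphXn /=.
  by rewrite !conjcK sP.
have B'E : conjc B' = conjc (Q (conjc z)) * (l1 ^+ n - l2 ^+ n) / (l1 - l2).
  by rewrite /B' /diagonal_power_Q !rmorphM fmorphV !rmorphB !rmorphXn /= !conjcK.
have -> : Q z * conjc B' = (l1 * l2 - P z * (l1 + l2 - P z)) * (l1 ^+ n - l2 ^+ n) / (l1 - l2).
  by rewrite -sQ B'E !mulrA.
have -> : P z * A - (l1 * l2 - P z * (l1 + l2 - P z)) * (l1 ^+ n - l2 ^+ n) / (l1 - l2) =
    diagonal_power_P n.+1 (P z) l1 l2.
  by rewrite /A /diagonal_power_P !exprS; field.
rewrite (_ : P z * B + _ = diagonal_power_Q n.+1 (Q z) l1 l2) //.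
by rewrite /B /diagonal_power_Q !exprS; field.
Qed.

Lemma emb_split_mulr (A B b : R[i]) :
  (emb I A + emb I B * J) * emb I b = emb I (A * b) + emb I (B * conjc b) * J.
Proof.
by rewrite mulrDl -mulrA (perp_emb b I_unit J_unit IJ_perp) mulrA (embM A b I_unit) (embM B _ I_unit).
Qed.

Lemma emb_split_sum (k1 k2 k3 k4 a b c d : R[i]) :
  emb I k1 * emb I a + emb I k2 * emb I b + (emb I k3 * emb I c + emb I k4 * emb I d) * J =
  emb I (k1 * a + k2 * b) + emb I (k3 * c + k4 * d) * J.
Proof.
by rewrite (embD I (k1 * a)) (embD I (k3 * c)) (embM k1 a I_unit) (embM k2 b I_unit)
  (embM k3 c I_unit) (embM k4 d I_unit).
Qed.

Lemma fock_kernel_series (alpha : R) (w : R[i]) : 0 < alpha ->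
  is_qpseries (fun n => emb I ((expR (- (alpha / 2) * cmod w ^+ 2))%:C * (n`!%:R^-1 * (alpha%:C * conjc w) ^+ n)))
    (fock_kernel alpha (emb I w)).
Proof.
move=> a0; set e := expR _; pose b' n := emb I (n`!%:R^-1 * (alpha%:C * conjc w) ^+ n).
have eb : qentire_coefs b'.
  move=> r r0; pose s := alpha * cmod w * r + 1.
  have s1 : 0 <= alpha * cmod w * r by rewrite !mulr_ge0 ?cmod_ge0 ?(ltW a0) ?(ltW r0).
  have s0 : 0 < s by rewrite ltr_wpDl.
  have [C C0 hC] := (@cexp_taylor R).1 s s0; exists C => // n.
  apply: le_trans (hC n); rewrite /b' qabs_emb // cmodM cmodX cmodM cmodC cmod_conj.
  rewrite (ger0_norm (ltW a0)) -mulrA ler_wpM2l ?cmod_ge0 // -exprMn.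
  by rewrite lerXn2r ?nnegrE ?(ltW s0) // /s lerDl.
apply/qpseriesP => xi; have [l hl] := qentire_cvg xi eb.
have scaleE n : (alpha ^+ n / n`!%:R) *: (xi ^+ n * qconj (emb I w) ^+ n : quat R) = xi ^+ n * b' n.
  rewrite qconj_emb // -(embX _ n I_unit) /b' exprMn.
  have -> : n`!%:R^-1 * (alpha%:C ^+ n * conjc w ^+ n) = (alpha ^+ n / n`!%:R)%:C * conjc w ^+ n.
    by rewrite rmorphM rmorphXn fmorphV rmorph_nat mulrCA mulrA.
  by rewrite embZ qscaler.
have -> : fock_kernel alpha (emb I w) xi = (e *: (1 : quat R) : quat R) * l.
  rewrite /fock_kernel qabs_emb // -/e qscalel mul1r; congr (_ *: _).
  suff E : lim ((fun N => \sum_(0 <= n < N) (alpha ^+ n / n`!%:R) *: (xi ^+ n * qconj (emb I w) ^+ n : quat R)) @ \oo) = l by exact: E.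
  apply: qlim_lim; apply: qlim_ext hl => N; rewrite big_mkord; apply: eq_bigr => n _.
  by rewrite scaleE.
have := qlimMl (e *: (1 : quat R) : quat R) hl; apply: qlim_ext => N.
rewrite mulr_sumr; apply: eq_bigr => n _.
by rewrite embZ qscaler qscalel mul1r.
Qed.

(** The kernel coefficients stand on the right and involve conj w. In the J-component they are moved
    across J, which conjugates them, so this component is holomorphic in w. By orthogonality,
    dropping the other one only decreases the modulus. *)
Theorem qcomp_fock_kernel_ge (alpha : R) (w z l1 l2 : R[i]) : 0 < alpha -> l1 != l2 ->
  l1 + l2 = P z + sharp P z -> l1 * l2 = P z * sharp P z + Q z * sharp Q z ->
  expR (- (alpha / 2) * cmod w ^+ 2) *
    cmod (Q z * (cexp (alpha%:C * w * l1) - cexp (alpha%:C * w * l2)) / (l1 - l2)) <=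
  qabs (qcomp (fock_kernel alpha (emb I w)) psi (emb I z)).
Proof.
move=> a0 l12 hsum hprod; have hk := @fock_kernel_series alpha w a0.
set e := expR _ in hk *.
have d0 : l1 - l2 != 0 by rewrite subr_eq0.
pose c n : R[i] := n`!%:R^-1.
pose S u N := \sum_(n < N) emb I (c n * u ^+ n).
have hS u : qlim (S u) (emb I (cexp u)) by exact: (qlim_emb I_unit (cexp_pser u)).
pose kp := e%:C * ((P z - l2) / (l1 - l2)); pose kp' := e%:C * ((l1 - P z) / (l1 - l2)).
pose kq := e%:C * (Q z / (l1 - l2)).
pose u1 := alpha%:C * conjc w * l1; pose u2 := alpha%:C * conjc w * l2.
pose v1 := alpha%:C * w * l1; pose v2 := alpha%:C * w * l2.
have hlim := qlimD (qlimD (qlimMl (emb I kp) (hS u1)) (qlimMl (emb I kp') (hS u2)))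
  (qlimMr J (qlimD (qlimMl (emb I kq) (hS v1)) (qlimMl (emb I (- kq)) (hS v2)))).
have -> : qcomp (fock_kernel alpha (emb I w)) psi (emb I z) =
   emb I (kp * cexp u1 + kp' * cexp u2) + emb I (kq * (cexp v1 - cexp v2)) * J.
  rewrite mulrBr -mulNr -emb_split_sum.
  suff E : lim ((fun N => \sum_(0 <= n < N) qstar_pow psi n (emb I z) * qcoef (fock_kernel alpha (emb I w)) n) @ \oo) =
    emb I kp * emb I (cexp u1) + emb I kp' * emb I (cexp u2) +
    (emb I kq * emb I (cexp v1) + emb I (- kq) * emb I (cexp v2)) * J by exact: E.
  rewrite (qcoefE hk); apply: qlim_lim; apply: qlim_ext hlim => N.
  pose t u n := emb I (c n * u ^+ n).
  rewrite big_mkord (sum_split_linear N (t u1) (t u2) (t v1) (t v2)); apply: eq_bigr => n _.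
  rewrite (qstar_pow_diagonal n l12 hsum hprod).
  set b := e%:C * _.
  rewrite emb_split_mulr emb_split_sum.
  have -> : kp * (c n * u1 ^+ n) + kp' * (c n * u2 ^+ n) = diagonal_power_P n (P z) l1 l2 * b.
    by rewrite /b /diagonal_power_P /kp /kp' /u1 /u2 /c !exprMn; ring.
  have -> : conjc b = e%:C * (c n * (alpha%:C * w) ^+ n).
    have cM (x y : R[i]) : conjc (x * y) = conjc x * conjc y by exact: rmorphM.
    have cX (x : R[i]) : conjc (x ^+ n) = conjc x ^+ n by exact: rmorphXn.
    by rewrite /b !cM cX cM conjc_inv conjc_nat !conjc_real conjcK.
  have -> : kq * (c n * v1 ^+ n) + - kq * (c n * v2 ^+ n) =
      diagonal_power_Q n (Q z) l1 l2 * (e%:C * (c n * (alpha%:C * w) ^+ n)).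
    by rewrite /diagonal_power_Q /kq /v1 /v2 /c !exprMn; ring.
  by [].
set A := kp * _ + _; set B := kq * _.
have -> : e * cmod (Q z * (cexp (alpha%:C * w * l1) - cexp (alpha%:C * w * l2)) / (l1 - l2)) = cmod B.
  have e0 : `|e| = e by rewrite ger0_norm // expR_ge0.
  by rewrite -[in LHS]e0 -cmodC -cmodM /B /kq -/v1 -/v2; congr cmod; ring.
rewrite -ler_sqr ?nnegrE ?cmod_ge0 ?qabs_ge0 // (qabs_split _ _ I_unit J_unit IJ_perp).
by rewrite lerDr sqr_ge0.
Qed.

End StarPowers.

(** * Growth of entire functions by averaging over roots of unity *)

Section DiscreteJensen.
Variable R : realType.
Implicit Types (f W : R[i] -> R[i]) (z w zeta : R[i]) (N : nat).

Lemma cmod_root zeta N : (0 < N)%N -> zeta ^+ N = 1 -> cmod zeta = 1.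
Proof.
move=> N0 h; have := cmodX zeta N; rewrite h cmod1 => /esym/eqP.
by rewrite pexpr_eq1 ?cmod_ge0 // => /eqP.
Qed.

Lemma primitive_root_exists N : (0 < N)%N -> exists zeta, zeta ^+ N = 1 /\
  forall m, (0 < m < N)%N -> zeta ^+ m != 1.
Proof.
move=> N0; have pi0 : 0 < pi :> R := pi_gt0 R.
have NR : 0 < N%:R :> R by rewrite ltr0n.
pose s : R[i] := 0 +i* (2 * pi / N%:R).
have sE m : m%:R * s = 0 +i* (m%:R * (2 * pi / N%:R)).
  have -> : m%:R = (m%:R : R)%:C :> R[i] by rewrite rmorph_nat.
  by apply/complex_eq; rewrite ?(cReM, cImM) /=; ring.
exists (cexp s); split=> [|m /andP[m0 mN]]; rewrite -cexpMn sE.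
  have -> : N%:R * (2 * pi / N%:R) = 2 * pi :> R by field; rewrite gt_eqF.
  by have := cexp_2pi (0 : R[i]); rewrite add0r cexp0.
set y : R := m%:R * _.
have y0 : 0 < y by rewrite mulr_gt0 ?ltr0n // divr_gt0 // mulr_gt0.
have y2 : y < 2 * pi.
  have mR : m%:R < N%:R :> R by rewrite ltr_nat.
  by rewrite /y mulrA ltr_pdivrMr // mulrC ltr_pM2l // mulr_gt0.
apply/eqP => E; have [yp|py] := leP y pi.
  have := @cexp_eq1 R (0 +i* y); rewrite /= ger0_norm ?(ltW y0) // => /(_ yp E) [] /eqP.
  by rewrite gt_eqF.
have E' : cexp (0 +i* (y - 2 * pi)) = 1 :> R[i].
  rewrite -(cexp_2pi (0 +i* (y - 2 * pi))) -E; congr cexp.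
  by apply/complex_eq; rewrite ?(cReD, cImD) /=; ring.
have := @cexp_eq1 R (0 +i* (y - 2 * pi)); rewrite /= ler_norml => /(_ _ E') H.
have /H [] : - pi <= y - 2 * pi <= pi by lra.
by move=> /eqP; rewrite lt_eqF //; lra.
Qed.

Lemma root_sum zeta N m : (0 < N)%N -> zeta ^+ N = 1 ->
  (forall m, (0 < m < N)%N -> zeta ^+ m != 1) -> (0 < m < N.*2)%N -> m != N ->
  \sum_(k < N) (zeta ^+ m) ^+ k = 0.
Proof.
move=> N0 h hp /andP[m0 mN] mN'.
have z1 : zeta ^+ m != 1.
  have [lt|ge] := ltnP m N; first by rewrite hp // m0.
  have -> : m = (N + (m - N))%N by rewrite subnKC.
  rewrite exprD h mul1r hp // subn_gt0 ltn_neqAle eq_sym mN' ge /=.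
  by rewrite ltn_subLR // addnn.
apply/eqP; have := subrX1 (zeta ^+ m) N; rewrite exprAC h expr1n subrr => /esym/eqP.
by rewrite mulf_eq0 subr_eq0 (negPf z1).
Qed.

(** Averaging against zeta^(- j k), written as zeta^((N - j) k), extracts t_j z^j exactly from the
    Taylor polynomial of degree below N. The remainder, estimated from radius 2 rho, contributes the
    factor (1 / 2)^N. *)
Lemma discrete_fourier f (t : nat -> R[i]) (rho M : R) N zeta z j : taylor_coefs t f -> 0 < rho ->
  (forall w, cmod w = 2 * rho -> cmod (f w) <= M) -> (j < N)%N -> zeta ^+ N = 1 ->
  (forall m, (0 < m < N)%N -> zeta ^+ m != 1) -> cmod z = rho ->
  cmod (t j) * rho ^+ j * N%:R <= \sum_(k < N) cmod (f (zeta ^+ k * z)) + 40 * M * (1 / 2) ^+ N * N%:R.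
Proof.
move=> ht rho0 fM jN h hp zr; have N0 : (0 < N)%N by apply: leq_ltn_trans jN.
have cz := cmod_root N0 h.
have rho20 : 0 < 2 * rho by rewrite mulr_gt0.
pose S w := \sum_(n < N) t n * w ^+ n.
have E : \sum_(k < N) (zeta ^+ (N - j)) ^+ k * S (zeta ^+ k * z) = t j * z ^+ j * N%:R.
  rewrite /S; under eq_bigr => k _ do rewrite mulr_sumr.
  rewrite exchange_big (bigD1 (Ordinal jN)) //= [X in _ + X]big1 ?addr0 => [|n nj].
    rewrite -[in RHS](card_ord N) -sumr_const mulr_sumr; apply: eq_bigr => k _.
    rewrite exprMn mulr1 mulrCA; congr (_ * _).
    by rewrite mulrA -!exprM -mulnC -exprD -mulnDr subnK ?(ltnW jN) // mulnC exprM h expr1n mul1r.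
  have -> : \sum_(k < N) (zeta ^+ (N - j)) ^+ k * (t n * (zeta ^+ k * z) ^+ n) =
     t n * z ^+ n * \sum_(k < N) (zeta ^+ (N - j + n)) ^+ k.
    rewrite mulr_sumr; apply: eq_bigr => k _.
    by rewrite exprMn exprD exprMn -!exprM (mulnC k n); ring.
  rewrite root_sum ?mulr0 //; last first.
    apply: contra_neq nj => E; apply/val_inj => /=; apply/eqP.
    by rewrite -(eqn_add2l (N - j)) E subnK // ltnW.
  rewrite addn_gt0 subn_gt0 jN /= -addnn.
  by apply: leq_ltn_trans (_ : N + n < _)%N; rewrite ?leq_add2r ?leq_subr // ltn_add2l.
have -> : cmod (t j) * rho ^+ j * N%:R = cmod (t j * z ^+ j * N%:R) by rewrite !cmodM cmodX cmodn zr.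
rewrite -E.
have -> : 40 * M * (1 / 2) ^+ N * N%:R = \sum_(k < N) 40 * M * (1 / 2) ^+ N.
  by rewrite sumr_const card_ord mulr_natr.
rewrite -big_split; apply: le_trans (cmod_sum _ _ _) _; apply: ler_sum => k _ /=.
rewrite cmodM !cmodX cz !expr1n mul1r.
have zk : cmod (zeta ^+ k * z) = rho by rewrite cmodM cmodX cz expr1n mul1r.
have := ht _ _ rho20 fM N (zeta ^+ k * z); rewrite zk.
have -> : rho / (2 * rho) = 1 / 2 by field; rewrite gt_eqF.
move=> /(_ ltac:(by lra)) h1.
have := cmod_dist (S (zeta ^+ k * z)) (f (zeta ^+ k * z)); rewrite cmodB /S; lra.
Qed.

(** A Cauchy estimate in quadratic mean. The mean of |f| is reduced to that of |f|^2 by y <= X / 2 +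
    y^2 / (2 X), where X is the very quantity to be bounded, and large N removes the remainder. The
    point z may depend on N and zeta, which is all that [mean_growth] provides. *)
Lemma coef_le_mean f (t : nat -> R[i]) (rho B : R) j : entire f -> taylor_coefs t f -> 0 < rho ->
  (forall N zeta, (0 < N)%N -> zeta ^+ N = 1 -> exists2 z, cmod z = rho &
    \sum_(k < N) cmod (f (zeta ^+ k * z)) ^+ 2 <= N%:R * B) ->
  (cmod (t j) * rho ^+ j) ^+ 2 <= B.
Proof.
move=> fe ht rho0 hmean; set X := cmod (t j) * rho ^+ j.
have [M M0 hM] := entire_bounded (2 * rho) fe.
have fM w : cmod w = 2 * rho -> cmod (f w) <= M by move=> wr; rewrite hM ?wr.
have X0 : 0 <= X by rewrite mulr_ge0 ?cmod_ge0 ?exprn_ge0 ?(ltW rho0).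
have B0 : 0 <= B.
  have [z _] := hmean 1%N 1 isT (expr1n _ _); rewrite big_ord1 => /(le_trans (sqr_ge0 _)).
  by rewrite mul1r.
move: X0; rewrite le_eqVlt => /orP[/eqP E|X0]; first by rewrite -E expr0n /=.
suff : X <= X / 2 + B / (2 * X).
  have -> : B / (2 * X) = B / X / 2 by field; rewrite gt_eqF.
  move=> h; have : X <= B / X by lra.
  by rewrite ler_pdivlMr.
apply/ler_addgt0Pr => e e0.
pose N := (maxn j (Num.truncn (40 * M / e))).+1.
have jN : (j < N)%N by rewrite ltnS leq_maxl.
have NR : 0 < N%:R :> R by rewrite ltr0n.
have eN : 40 * M * (1 / 2) ^+ N <= e.
  rewrite expr_div_n expr1n mul1r ler_pdivrMr ?exprn_gt0 // [leRHS]mulrC -ler_pdivrMr //.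
  apply: ltW; apply: lt_trans (truncnS_gt _) _; rewrite -natrX ltr_nat.
  by apply: (leq_ltn_trans _ (ltn_expl N (ltnSn 1))); rewrite /N ltnS leq_maxr.
have [zeta [h hp]] := primitive_root_exists (ltn0Sn _ : (0 < N)%N).
have [w wr hw] := hmean N zeta isT h.
have := discrete_fourier ht rho0 fM jN h hp wr; rewrite -/X => hX.
clearbody X.
have hs : \sum_(k < N) cmod (f (zeta ^+ k * w)) <= N%:R * (X / 2 + B / (2 * X)).
  pose F (k : 'I_N) : R := X / 2 + cmod (f (zeta ^+ k * w)) ^+ 2 / (2 * X).
  have h1 : \sum_(k < N) cmod (f (zeta ^+ k * w)) <= \sum_(k < N) F k.
    apply: ler_sum => k _; rewrite /F; set y := cmod _.
    have -> : X / 2 + y ^+ 2 / (2 * X) = (X ^+ 2 + y ^+ 2) / (2 * X) by field; rewrite gt_eqF.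
    rewrite ler_pdivlMr ?mulr_gt0 //; have := sqr_ge0 (X - y).
    have -> : (X - y) ^+ 2 = X ^+ 2 + y ^+ 2 - y * (2 * X) by ring.
    by rewrite subr_ge0.
  apply: le_trans h1 _; rewrite /F big_split /= sumr_const card_ord -mulr_suml.
  rewrite -[leLHS]/(_ *+ N + _) -(mulr_natl (X / 2) N) [leRHS]mulrDr lerD2l.
  by rewrite [leRHS]mulrA ler_wpM2r // invr_ge0 mulr_ge0 // ltW.
rewrite -(ler_pM2r NR); apply: le_trans hX _.
rewrite [leRHS]mulrDl; apply: lerD; first by rewrite [leRHS]mulrC.
by rewrite ler_wpM2r // ltW.
Qed.

(* Discrete Jensen: w |-> \prod_k W (z1 + zeta^k w) takes the value W(z1)^N at 0,
   so it cannot be small on all of |w| = rho. *)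
Lemma mean_growth W (G : R[i] -> R) (alpha beta C : R) z1 : entire W -> W z1 != 0 -> 0 < alpha -> 0 < beta ->
  (forall z, cmod (W z) * expR (beta * G z) <= C * expR (alpha / 2 * cmod z ^+ 2)) ->
  exists2 K, 0 <= K & forall (rho : R) N zeta, 0 < rho -> (0 < N)%N -> zeta ^+ N = 1 ->
    exists2 z, cmod z = rho &
    \sum_(k < N) G (z1 + zeta ^+ k * z) <= N%:R * ((K + alpha / 2 * (cmod z1 + rho) ^+ 2) / beta).
Proof.
move=> We W1 a0 b0 hG; have w0 : 0 < cmod (W z1) by rewrite cmod_gt0.
have C0 : 0 < C.
  have h := hG z1; have : 0 < C * expR (alpha / 2 * cmod z1 ^+ 2).
    by apply: lt_le_trans h; rewrite mulr_gt0 ?expR_gt0.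
  by rewrite pmulr_lgt0 ?expR_gt0.
pose K0 := ln 41 + ln (C / cmod (W z1)).
exists `|K0| => // rho N zeta rho0 N0 h.
have NR : 0 < N%:R :> R by rewrite ltr0n.
have cz := cmod_root N0 h.
pose V w := \prod_(k < N) W (z1 + zeta ^+ k * w).
have Ve : entire V.
  apply: entire_prod => k; apply: (entire_comp We).
  apply: (entireD (@entire_cst R z1)); exact (entireM (@entire_cst R (zeta ^+ k)) (@entire_id R)).
have V0 : cmod (V 0) = cmod (W z1) ^+ N.
  rewrite /V cmod_prod -[X in _ ^+ X](card_ord N) -prodr_const.
  by apply: eq_bigr => k _; rewrite mulr0 addr0.
(* If this failed on the whole circle, [cauchy_bound0] would give |V 0| <= (40 / 41) |V 0|,
   impossible as V 0 != 0. *)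
have [z zr hz] : exists2 z, cmod z = rho & cmod (W z1) ^+ N <= 41 * cmod (V z).
  apply: contrapT => H.
  have hV w : cmod w = rho -> cmod (V w) <= cmod (W z1) ^+ N / 41.
    move=> wr; rewrite ler_pdivlMr // mulrC; apply: ltW; rewrite ltNge; apply/negP => hw.
    by apply: H; exists w.
  have := cauchy_bound0 Ve rho0 hV; rewrite V0.
  have wN : 0 < cmod (W z1) ^+ N by rewrite exprn_gt0.
  by lra.
exists z => //.
set S := \sum_(k < N) _.
pose E := alpha / 2 * (cmod z1 + rho) ^+ 2.
have hV : cmod (V z) * expR (beta * S) <= (C * expR E) ^+ N.
  rewrite /V cmod_prod /S mulr_sumr.
  have -> : expR (\sum_(k < N) beta * G (z1 + zeta ^+ k * z)) = \prod_(k < N) expR (beta * G (z1 + zeta ^+ k * z)).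
    by rewrite expR_sum.
  rewrite -big_split /= -[X in _ <= _ ^+ X](card_ord N) -prodr_const.
  apply: ler_prod => k _; rewrite mulr_ge0 ?cmod_ge0 ?expR_ge0 //=.
  apply: le_trans (hG _) _; rewrite ler_wpM2l ?(ltW C0) // ler_expR /E.
  rewrite ler_wpM2l ?divr_ge0 ?(ltW a0) // lerXn2r ?nnegrE ?addr_ge0 ?cmod_ge0 ?(ltW rho0) //.
  by apply: le_trans (cmodD _ _) _; rewrite cmodM cmodX cz expr1n mul1r zr.
have hS : expR (beta * S) <= 41 * (C / cmod (W z1) * expR E) ^+ N.
  have wN : 0 < cmod (W z1) ^+ N by rewrite exprn_gt0.
  rewrite mulrAC expr_div_n mulrA ler_pdivlMr //.
  rewrite mulrC; apply: le_trans (ler_wpM2r (expR_ge0 _) hz) _.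
  by rewrite -mulrA ler_wpM2l.
have X0 : 0 < C / cmod (W z1) by rewrite divr_gt0.
have lnS : beta * S <= ln 41 + N%:R * (ln (C / cmod (W z1)) + E).
  rewrite -(@ler_expR R) (le_trans hS) // expRD lnK ?posrE //.
  by rewrite expRM_natl expRD lnK ?posrE.
have l41 : 0 <= ln 41 :> R by rewrite ln_ge0 // ler1n.
have N1 : 1 <= N%:R :> R by rewrite ler1n.
rewrite mulrA ler_pdivlMr // mulrC (le_trans lnS) //.
have : ln 41 <= N%:R * ln 41 :> R by rewrite ler_peMl.
have : N%:R * K0 <= N%:R * `|K0| by rewrite ler_wpM2l ?(ltW NR) ?ler_norm.
by rewrite /K0 /E; lra.
Qed.

Lemma quadratic_dominates (x A B D : R) : (forall rho : R, 1 <= rho -> x * rho ^+ 2 <= A * rho ^+ 2 + B * rho + D) -> x <= A.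
Proof.
move=> h; apply/ler_addgt0Pr => e e0.
pose rho := 1 + (`|B| + `|D|) / e.
have r1 : 1 <= rho by rewrite lerDl divr_ge0 ?addr_ge0 // ltW.
have r0 : 0 < rho by lra.
have rp : 0 < rho ^+ 2 by rewrite exprn_gt0.
have re : `|B| + `|D| <= rho * e.
  by rewrite /rho mulrDl divfK ?gt_eqF // lerDr mul1r ltW.
rewrite -(ler_pM2r rp) (le_trans (h _ r1)) // mulrDl -addrA lerD2l.
have h1 : B * rho <= `|B| * rho by rewrite ler_wpM2r ?ler_norm // ltW.
have h2 : D <= `|D| * rho by apply: le_trans (ler_norm D) _; rewrite ler_peMr.
have h3 : (`|B| + `|D|) * rho <= rho * e * rho by rewrite ler_wpM2r // ltW.
have -> : e * rho ^+ 2 = rho * e * rho by ring.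
by lra.
Qed.

(** Recentred at z1, where W does not vanish, f has Taylor coefficients with |t_j|^2 rho^(2 j) <=
    (alpha / (2 beta)) rho^2 + O(rho). Letting rho grow kills every t_j with j >= 2 and bounds
    t_1. *)
Theorem growth_affine W (G : R[i] -> R) f (alpha beta C : R) z1 : entire W -> W z1 != 0 ->
  0 < alpha -> 0 < beta ->
  (forall z, cmod (W z) * expR (beta * G z) <= C * expR (alpha / 2 * cmod z ^+ 2)) ->
  entire f -> (forall z, cmod (f z) ^+ 2 <= G z) ->
  exists a0 a1, (forall z, f z = a0 + a1 * z) /\ cmod a1 ^+ 2 <= alpha / (2 * beta).
Proof.
move=> We W1 alpha0 beta0 hG fe fG.
have [K K0 hK] := mean_growth We W1 alpha0 beta0 hG.
pose g z := f (z1 + z).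
have ge : entire g by exact (entire_comp fe (entireD (@entire_cst R z1) (@entire_id R))).
have [t ht] := taylor ge.
have key j (rho : R) : 0 < rho -> (cmod (t j) * rho ^+ j) ^+ 2 <= (K + alpha / 2 * (cmod z1 + rho) ^+ 2) / beta.
  move=> rho0; apply: (coef_le_mean j ge ht rho0) => N zeta N0 h.
  have [z zr hz] := hK rho N zeta rho0 N0 h; exists z => //.
  by apply: le_trans hz; apply: ler_sum => k _; exact: fG.
set A := alpha / (2 * beta); pose c := cmod z1.
have A0 : 0 < A by rewrite divr_gt0 // mulr_gt0.
have keyE (rho : R) : (K + alpha / 2 * (cmod z1 + rho) ^+ 2) / beta =
    A * rho ^+ 2 + (2 * A * c) * rho + (K / beta + A * c ^+ 2).
  by rewrite /A /c; field; rewrite gt_eqF.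
have t1 : cmod (t 1%N) ^+ 2 <= A.
  apply: (@quadratic_dominates _ _ (2 * A * c) (K / beta + A * c ^+ 2)) => rho r1.
  have r0 : 0 < rho by lra.
  by have := key 1%N rho r0; rewrite keyE expr1 exprMn.
have t2 j : (1 < j)%N -> t j = 0.
  move=> j1; apply/eqP; rewrite -cmod_eq0 -sqrf_eq0 eq_le sqr_ge0 andbT.
  have c0 : 0 <= c by exact: cmod_ge0.
  apply: (@quadratic_dominates _ 0 0 (A + 2 * A * c + (K / beta + A * c ^+ 2))) => rho r1.
  have r0 : 0 < rho by lra.
  have := key j rho r0; rewrite keyE exprMn => hj; rewrite mul0r mul0r add0r add0r.
  have rp : 0 < rho ^+ 2 by rewrite exprn_gt0.
  have rr : 1 <= rho ^+ 2 by rewrite exprn_ege1.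
  have rrho : rho <= rho ^+ 2 by rewrite expr2 ler_peMr // ltW.
  have rj : rho ^+ 2 * rho ^+ 2 <= (rho ^+ j) ^+ 2.
    by rewrite -expr2 lerXn2r ?nnegrE ?exprn_ge0 ?(ltW r0) // ler_weXn2l.
  rewrite -(ler_pM2r rp).
  apply: le_trans (_ : cmod (t j) ^+ 2 * (rho ^+ j) ^+ 2 <= _).
    by rewrite -mulrA ler_wpM2l ?sqr_ge0.
  apply: le_trans hj _; rewrite [leRHS]mulrDl [X in _ <= X + _]mulrDl; apply: lerD; [apply: lerD|].
  - by [].
  - by apply: ler_wpM2l rrho; apply: mulr_ge0 c0; apply: mulr_ge0 (ltW A0).
  - apply: ler_peMr rr; apply: addr_ge0; last exact: mulr_ge0 (ltW A0) (sqr_ge0 c).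
    exact: divr_ge0 K0 (ltW beta0).
have gE z : g z = t 0%N + t 1%N * z.
  apply: (pser_lim_uniq (taylor_pser z ge ht)) => e e0; exists 2%N => -[//|[//|N]] _.
  rewrite 2!big_ord_recl big1 /= => [|i _]; last by rewrite t2 ?mul0r.
  by rewrite expr0 mulr1 addr0 expr1 subrr cmod0.
exists (t 0%N - t 1%N * z1), (t 1%N); split => // z.
have -> : f z = g (z - z1) by rewrite /g addrC subrK.
by rewrite gE; ring.
Qed.

End DiscreteJensen.

(** * Rigidity of the symbol *)

Section KernelBound.
Variable R : realType.

Lemma lty_ubound (T : Type) (f : T -> R) (y : \bar R) : (y < +oo)%E -> (forall i, ((f i)%:E <= y)%E) ->
  exists M, forall i, f i <= M.
Proof.
case: y => [r _ h|//|_ h]; first by exists r => i; rewrite -lee_fin.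
by exists 0 => i; have := h i; rewrite leeNy_eq.
Qed.

Lemma powR_le_bound (q kappa x M : R) : 0 < q -> 0 < kappa -> 0 <= x -> kappa * x `^ q <= M ->
  x <= (M / kappa) `^ q^-1.
Proof.
move=> q0 k0 x0 h.
have h' : x `^ q <= M / kappa by rewrite ler_pdivlMr // mulrC.
have -> : x = (x `^ q) `^ q^-1 by rewrite -powRrM mulfV ?gt_eqF // powRr1.
by apply: ge0_ler_powR => //; rewrite ?nnegrE ?invr_ge0 ?(ltW q0) ?powR_ge0 // (le_trans _ h') ?powR_ge0.
Qed.

Variables (alpha q : R) (psi : quat R -> quat R) (I J : quat R) (P Q l1 l2 : R[i] -> R[i]).
Hypotheses (alpha0 : 0 < alpha) (q0 : 0 < q) (psi_reg : slice_regular psi).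
Hypotheses (I_unit : imag_units I) (J_unit : imag_units J) (IJ_perp : perp J I).
Hypotheses (P_entire : entire P) (Q_entire : entire Q)
  (psi_split : forall z : R[i], psi (emb I z) = emb I (P z) + emb I (Q z) * J).
Hypotheses (l1e : entire l1) (l2e : entire l2) (l12_neq0 : forall z, l1 z - l2 z != 0).
Hypothesis l_sum : forall z, l1 z + l2 z = P z + sharp P z.
Hypothesis l_prod : forall z, l1 z * l2 z = P z * sharp P z + Q z * sharp Q z.

(** The J-component of the composition without its Gaussian factor, entire in each variable.
    [damped] restores that factor and adds the weight in z, making the expression suited to
    [gaussian_submean] in either variable. *)
Definition kernel_diff z w := Q z * (cexp (alpha%:C * w * l1 z) - cexp (alpha%:C * w * l2 z)) / (l1 z - l2 z).
Definition damped z w := expR (- (alpha / 2) * cmod z ^+ 2) * (expR (- (alpha / 2) * cmod w ^+ 2) * cmod (kernel_diff z w)).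

Lemma damped_ge0 z w : 0 <= damped z w.
Proof. by rewrite /damped !mulr_ge0 ?expR_ge0 ?cmod_ge0. Qed.

Lemma entire_kernel_diffl w : entire (fun z => kernel_diff z w).
Proof.
have h l : entire l -> entire (fun z => cexp (alpha%:C * w * l z)).
  move=> le; exact (entire_comp (@entire_cexp R) (entireM (@entire_cst R (alpha%:C * w)) le)).
exact (entireM (entireM Q_entire (entireB (h _ l1e) (h _ l2e))) (entireV (entireB l1e l2e) l12_neq0)).
Qed.

Lemma entire_kernel_diffr z : entire (fun w => kernel_diff z w).
Proof.
have h l : entire (fun w => cexp (alpha%:C * w * l)).
  exact (entire_comp (@entire_cexp R) (entireM (entireM (@entire_cst R alpha%:C) (@entire_id R)) (@entire_cst R l))).
exact (entireM (entireM (@entire_cst R (Q z)) (entireB (h (l1 z)) (h (l2 z)))) (@entire_cst R (l1 z - l2 z)^-1)).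
Qed.

Lemma calB_ge : exists2 kappa, 0 < kappa &
  forall z w, ((kappa * damped z w `^ q)%:E <= calB alpha q psi I (emb I w))%E.
Proof.
have [kappa k0 hk] := gaussian_submean alpha0 q0; exists kappa => // z w.
have he : entire (fun z => (expR (- (alpha / 2) * cmod w ^+ 2))%:C * kernel_diff z w).
  exact (entireM (@entire_cst R _) (@entire_kernel_diffl w)).
have cE u : cmod ((expR (- (alpha / 2) * cmod w ^+ 2))%:C * kernel_diff u w) =
    expR (- (alpha / 2) * cmod w ^+ 2) * cmod (kernel_diff u w).
  by rewrite cmodM cmodC ger0_norm ?expR_ge0.
rewrite /calB /slice_integral.
apply: le_trans (hk _ (fun v => (qabs (qcomp (fock_kernel alpha (emb I w)) psi (emb I (v.1 +i* v.2))) `^ q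
     * expR (- (alpha * q / 2) * qabs (emb I (v.1 +i* v.2)) ^+ 2))%:E) z he _).
  rewrite lee_fin ler_pM2l // cE /damped powRM ?expR_ge0 ?mulr_ge0 ?expR_ge0 ?cmod_ge0 //.
  rewrite -expRM mulrC ler_wpM2l ?powR_ge0 // ler_expR.
  by rewrite le_eqVlt; apply/orP; left; apply/eqP; field.
move=> v; rewrite lee_fin cE qabs_emb // ler_wpM2r ?expR_ge0 //.
apply: ge0_ler_powR; rewrite ?nnegrE ?(ltW q0) ?mulr_ge0 ?expR_ge0 ?cmod_ge0 ?qabs_ge0 //.
apply: (qcomp_fock_kernel_ge psi_reg I_unit J_unit IJ_perp P_entire Q_entire psi_split) => //.
by rewrite -subr_eq0.
Qed.

Lemma damped_bounded (p : R) : 0 < p ->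
  (ereal_sup [set calB alpha q psi I w | w in slice I] < +oo)%E \/
  (q < p /\ (slice_integral I (fun w => poweR (calB alpha q psi I w) (p / (p - q))) < +oo)%E) ->
  exists C, forall z w, damped z w <= C.
Proof.
move=> p0; have [kappa k0 hk] := calB_ge => -[hs|[qp hs]].
  have [|M hM] := @lty_ubound (R[i] * R[i]) (fun v => kappa * damped v.1 v.2 `^ q) _ hs.
    move=> v; apply: le_trans (hk v.1 v.2) _; apply: ereal_sup_ubound => /=.
    by exists (emb I v.2) => //; exists v.2.
  exists ((M / kappa) `^ q^-1) => z w.
  by apply: powR_le_bound (damped_ge0 z w) (hM (z, w)).
set s := p / (p - q) in hs.
have s0 : 0 < s by rewrite divr_gt0 // subr_gt0.
have qs0 : 0 < q * s by exact: mulr_gt0.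
have [kappa' k'0 hk'] := gaussian_submean alpha0 qs0.
have [|M hM] := @lty_ubound (R[i] * R[i]) (fun v => kappa' * (kappa * damped v.1 v.2 `^ q) `^ s) _ hs.
  move=> [z w] /=; rewrite /slice_integral.
  (* The constant kappa enters the entire function as kappa^(1/q), so that the s-th power of the
     lower bound on [calB] is exactly a weighted power of exponent q s. *)
  pose r : R := kappa `^ q^-1 * expR (- (alpha / 2) * cmod z ^+ 2).
  have r0 : 0 <= r by rewrite mulr_ge0 ?powR_ge0 ?expR_ge0.
  have he : entire (fun w => r%:C * kernel_diff z w).
    exact (entireM (@entire_cst R _) (@entire_kernel_diffr z)).
  have cE u : cmod (r%:C * kernel_diff z u) `^ (q * s) * expR (- (alpha * (q * s) / 2) * cmod u ^+ 2) =
      (kappa * damped z u `^ q) `^ s.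
    have -> : expR (- (alpha * (q * s) / 2) * cmod u ^+ 2) = expR (- (alpha / 2) * cmod u ^+ 2) `^ (q * s).
      by rewrite -expRM; congr expR; field.
    rewrite -powRM ?cmod_ge0 ?expR_ge0 // powRrM; congr (_ `^ s).
    have -> : kappa = (kappa `^ q^-1) `^ q by rewrite -powRrM mulVf ?gt_eqF // powRr1 // ltW.
    rewrite -powRM ?powR_ge0 ?damped_ge0 //; congr (_ `^ q).
    by rewrite cmodM cmodC ger0_norm // /r /damped; ring.
  apply: le_trans (hk' _ (fun v => poweR (calB alpha q psi I (emb I (v.1 +i* v.2))) s) w he _).
    by rewrite cE.
  move=> v; rewrite cE -poweR_EFin.
  have B0 : (0 <= calB alpha q psi I (emb I (v.1 +i* v.2)))%E.
    by apply: integral_ge0 => u _; rewrite lee_fin mulr_ge0 ?powR_ge0 ?expR_ge0.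
  apply: gt0_ler_poweR (hk _ _); first exact: ltW.
    by rewrite in_itv /= leey andbT lee_fin mulr_ge0 ?powR_ge0 // ltW.
  by rewrite in_itv /= leey andbT.
exists (((M / kappa') `^ s^-1 / kappa) `^ q^-1) => z w.
apply: powR_le_bound (damped_ge0 z w) _ => //.
by apply: powR_le_bound (hM (z, w)) => //; rewrite mulr_ge0 ?powR_ge0 // ltW.
Qed.

End KernelBound.

(** * From bounded differences of exponentials to growth of the eigenvalues *)

Section GrowthBound.
Variable R : realType.
Implicit Types k l z w : R[i].

(** A rational minorant, linear for small x and bounded for large x: multiplying it by 1 + x gives
    back x, which later restores a factor |l - l'|^2 and cancels the denominator. *)
Lemma onem_expRN_ge (x : R) : 0 <= x -> x / (1 + x) <= 1 - expR (- x).
Proof.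
move=> x0; have x1 : 0 < 1 + x by lra.
have h : expR (- x) <= (1 + x)^-1.
  by rewrite expRN lef_pV2 ?posrE ?expR_gt0 // expR_ge1Dx.
have -> : x / (1 + x) = 1 - (1 + x)^-1 by field; rewrite gt_eqF.
by rewrite lerD2l lerN2.
Qed.

Lemma sqr_cmod_sub l l' :
  cmod (l - l') ^+ 2 = cmod l ^+ 2 + cmod l' ^+ 2 - 2 * complex.Re (conjc l * l').
Proof. by rewrite !sqr_cmod cReD cImD cReN cImN cReM cRe_conj cIm_conj; ring. Qed.

Lemma sqr_cmod_half_sum l l' :
  cmod ((l + l') / 2) ^+ 2 + cmod ((l - l') / 2) ^+ 2 = (cmod l ^+ 2 + cmod l' ^+ 2) / 2.
Proof.
rewrite !cmodf cmodn !exprMn !sqr_cmod !cReD !cImD cReN cImN.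
by field.
Qed.

(* The choice w = conj l makes |cexp (alpha w l)| = e^(alpha |l|^2) while
   |cexp (alpha w (l' - l))| <= e^(- alpha |l - l'|^2 / 2). *)
Lemma exp_difference_ge (alpha : R) k l l' : 0 < alpha -> l != l' -> cmod l' <= cmod l ->
  alpha / 2 * cmod (k * (l - l')) * expR (alpha / 2 * cmod l ^+ 2) <=
  expR (- (alpha / 2) * cmod (conjc l) ^+ 2) *
    cmod (k * (cexp (alpha%:C * conjc l * l) - cexp (alpha%:C * conjc l * l')) / (l - l')) *
    (1 + 2 * alpha * cmod l ^+ 2).
Proof.
move=> a0 ll' le.
have d0 : 0 < cmod (l - l') by rewrite cmod_gt0 subr_eq0.
have a0' : 0 <= alpha by exact: ltW.
have le2 : cmod l' ^+ 2 <= cmod l ^+ 2 by rewrite lerXn2r ?nnegrE ?cmod_ge0.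
have dle : cmod (l - l') ^+ 2 <= 4 * cmod l ^+ 2.
  have -> : 4 * cmod l ^+ 2 = (2 * cmod l) ^+ 2 by ring.
  rewrite lerXn2r ?nnegrE ?mulr_ge0 ?cmod_ge0 //; apply: le_trans (cmodBD _ _) _.
  by rewrite mulr_natl mulr2n lerD2l.
have nE := sqr_cmod_sub l l'.
set x := alpha / 2 * cmod (l - l') ^+ 2.
have x0 : 0 <= x by rewrite mulr_ge0 ?sqr_ge0 // divr_ge0.
have E1 : cexp (alpha%:C * conjc l * l') =
    cexp (alpha%:C * conjc l * l) * cexp (- (alpha%:C * conjc l * (l - l'))).
  by rewrite -cexpD; congr cexp; ring.
have E2 : cmod (cexp (alpha%:C * conjc l * l)) = expR (alpha * cmod l ^+ 2).
  rewrite cmod_cexp -mulrA (mulrC (conjc l)) mul_conjc -rmorphM //.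
(* As |l'| <= |l|, Re(conj(l) (l - l')) >= |l - l'|^2 / 2. *)
have E3 : 1 - expR (- x) <= cmod (1 - cexp (- (alpha%:C * conjc l * (l - l')))).
  apply: le_trans (cmod_dist _ _); rewrite cmod1 lerD2l lerN2 cmod_cexp ler_expR.
  rewrite cReN lerN2 -mulrA cReM /= mul0r subr0.
  rewrite mulrBr cReD cReN (mulrC (conjc l) l) mul_conjc /= /x nE.
  rewrite -mulrA ler_wpM2l //; move: le2.
  by move: (cmod l ^+ 2) (cmod l' ^+ 2) (complex.Re _) => u v t; lra.
have E4 := le_trans (onem_expRN_ge x0) E3.
rewrite E1.
set e1 := cexp (alpha%:C * conjc l * l) in E2 *.
set e2 := cexp (- _) in E3 E4 *.
have -> : k * (e1 - e1 * e2) / (l - l') = k * e1 * (1 - e2) / (l - l').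
  by congr (_ / _); ring.
rewrite cmodf (cmodM (k * e1)) (cmodM k e1) (cmodM k) E2 cmod_conj.
have -> : expR (alpha * cmod l ^+ 2) = expR (alpha / 2 * cmod l ^+ 2) * expR (alpha / 2 * cmod l ^+ 2).
  by rewrite -expRD; congr expR; field.
rewrite mulNr expRN.
set E := expR (alpha / 2 * _); have Ep : 0 < E by exact: expR_gt0.
have -> : E^-1 * (cmod k * (E * E) * cmod (1 - e2) / cmod (l - l')) * (1 + 2 * alpha * cmod l ^+ 2) =
   (cmod k * E / cmod (l - l')) * (cmod (1 - e2) * (1 + 2 * alpha * cmod l ^+ 2)).
  by field; rewrite !gt_eqF.
have -> : alpha / 2 * (cmod k * cmod (l - l')) * E = (cmod k * E / cmod (l - l')) * x.
  by rewrite /x; field; rewrite gt_eqF.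
apply: ler_wpM2l; first by rewrite divr_ge0 ?mulr_ge0 ?cmod_ge0 // ltW.
have x1 : 0 < 1 + x by rewrite ltr_wpDr.
(* Since |l - l'| <= 2 |l|, 1 + x <= 1 + 2 alpha |l|^2: the last factor pays for the denominator in
   x / (1 + x). *)
rewrite -{1}(divfK (lt0r_neq0 x1) x); apply: ler_pM => //; first by rewrite divr_ge0 // ltW.
  exact: ltW.
rewrite lerD2l /x; move: dle; rewrite -(ler_pM2l (_ : 0 < alpha / 2)) ?divr_gt0 //.
by move: (cmod l ^+ 2) (cmod (l - l') ^+ 2) => u v; lra.
Qed.

(** The factor 1 + 2 alpha |l|^2 is absorbed by e^((alpha / 2 - beta) |l|^2), whence beta < alpha /
    2. The parallelogram identity rewrites the exponent as beta times the mean of |l|^2 and |l'|^2,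
    which is at most beta |l|^2 for the larger eigenvalue l. *)
Lemma exp_difference_growth (alpha beta C : R) k l l' : 0 < alpha -> 0 < beta -> beta < alpha / 2 -> l != l' ->
  (forall w, expR (- (alpha / 2) * cmod w ^+ 2) *
    cmod (k * (cexp (alpha%:C * w * l) - cexp (alpha%:C * w * l')) / (l - l')) <= C) ->
  cmod (k * (l - l')) * expR (beta * (cmod ((l + l') / 2) ^+ 2 + cmod ((l - l') / 2) ^+ 2)) <=
  2 / alpha * (1 + 2 * alpha / (alpha / 2 - beta)) * C.
Proof.
move=> a0 b0 ba; rewrite sqr_cmod_half_sum.
wlog le : l l' / cmod l' <= cmod l => [hw|] ll' h.
  case: (leP (cmod l') (cmod l)) => [|/ltW] le; first exact: hw.
  have -> : cmod (k * (l - l')) = cmod (k * (l' - l)) by rewrite !cmodM cmodB.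
  rewrite (addrC (cmod l ^+ 2)); apply: hw => //; first by rewrite eq_sym.
  move=> w; apply: le_trans (h w); rewrite le_eqVlt; apply/orP; left; apply/eqP.
  by rewrite !cmodf !(cmodM k) cmodB (cmodB l l').
have := exp_difference_ge k a0 ll' le.
have := h (conjc l).
set V := _ * cmod (_ / _); move=> VC hV.
have V0 : 0 <= V by rewrite mulr_ge0 ?expR_ge0 ?cmod_ge0.
clearbody V.
set N := cmod (k * _) in hV *; have N0 : 0 <= N by exact: cmod_ge0.
clearbody N.
have m0 : 0 <= cmod l ^+ 2 by exact: sqr_ge0.
have le2 : cmod l' ^+ 2 <= cmod l ^+ 2 by rewrite lerXn2r ?nnegrE ?cmod_ge0.
move: (cmod l ^+ 2) (cmod l' ^+ 2) m0 le2 hV => m m' m0 mm hV.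
set g := alpha / 2 - beta; have g0 : 0 < g by rewrite subr_gt0.
set K := 1 + 2 * alpha / g.
have K0 : 0 <= K by rewrite addr_ge0 // divr_ge0 ?mulr_ge0 // ltW.
have e1 : 1 + g * m <= expR (g * m) by exact: expR_ge1Dx.
have hK : 1 + 2 * alpha * m <= K * expR (g * m).
  apply: le_trans (ler_wpM2l K0 e1).
  have -> : K * (1 + g * m) = 1 + 2 * alpha * m + (g * m + 2 * alpha / g).
    by rewrite /K; field; rewrite gt_eqF.
  by rewrite lerDl addr_ge0 ?divr_ge0 ?mulr_ge0 // ltW.
have eE : expR (alpha / 2 * m) = expR (beta * m) * expR (g * m).
  by rewrite -expRD; congr expR; rewrite /g; ring.
have gp : 0 < expR (g * m) by exact: expR_gt0.
have : alpha / 2 * N * expR (beta * m) * expR (g * m) <= C * K * expR (g * m).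
  rewrite -mulrA -eE; apply: le_trans hV _; rewrite -[leRHS]mulrA.
  by apply: le_trans (ler_wpM2l V0 hK) _; rewrite ler_wpM2r // mulr_ge0 // ltW.
rewrite ler_pM2r // => hh.
apply: le_trans (_ : N * expR (beta * m) <= _).
  rewrite ler_wpM2l // ler_expR ler_pM2l //; lra.
have -> : 2 / alpha * K * C = 2 / alpha * (C * K) by ring.
have -> : N * expR (beta * m) = 2 / alpha * (alpha / 2 * N * expR (beta * m)).
  by field; rewrite gt_eqF.
by rewrite ler_wpM2l // divr_ge0 // ltW.
Qed.

End GrowthBound.

(** * Affine trace, constant discriminant and the final logarithm *)

Section Rigidity.
Variable R : realType.
Implicit Types F : R[i] -> R[i].

Lemma conjc_id_real (z : R[i]) : conjc z = z -> z = (complex.Re z)%:C.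
Proof.
case: z => a b /(congr1 (@complex.Im R)) /= h.
by apply: complex_eq => //=; lra.
Qed.

Lemma entire_sqrt F : entire F -> (forall z, F z != 0) ->
  exists2 d : R[i] -> R[i], entire d & forall z, d z ^+ 2 = F z.
Proof.
move=> Fe F0; have [g ge hg] := entire_log Fe F0.
exists (fun z => cexp (g z / 2)) => [|z].
  exact (entire_comp (@entire_cexp R) (entireM ge (@entire_cst R 2^-1))).
by rewrite hg expr2 -cexpD; congr cexp; field.
Qed.

Section Growth.
Variables (alpha q p : R) (psi : quat R -> quat R) (I J : quat R) (P Q d : R[i] -> R[i]).
Hypotheses (alpha0 : 0 < alpha) (p0 : 0 < p) (q0 : 0 < q) (psi_reg : slice_regular psi).
Hypotheses (I_unit : imag_units I) (J_unit : imag_units J) (IJ_perp : perp J I).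
Hypotheses (P_entire : entire P) (Q_entire : entire Q)
  (psi_split : forall z : R[i], psi (emb I z) = emb I (P z) + emb I (Q z) * J).
Hypothesis Q_neq0 : exists z : R[i], Q z <> 0.
Hypothesis B_cond : (ereal_sup [set calB alpha q psi I w | w in slice I] < +oo)%E \/
  (q < p /\ (slice_integral I (fun w => poweR (calB alpha q psi I w) (p / (p - q))) < +oo)%E).
Hypotheses (de : entire d) (d_neq0 : forall z, d z != 0) (d_sqr : forall z, d z ^+ 2 = Delta P Q z).

Let T z := (P z + sharp P z) / 2.

Lemma entire_trace : entire T.
Proof. exact (entireM (entireD P_entire (entire_sharp P_entire)) (@entire_cst R (2^-1))). Qed.

Lemma discriminant_growth (beta : R) : 0 < beta -> beta < alpha / 2 -> exists C, forall z,
  cmod (Q z * d z) * expR (beta * (cmod (T z) ^+ 2 + cmod (d z / 2) ^+ 2)) <= C * expR (alpha / 2 * cmod z ^+ 2).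
Proof.
move=> b0 ba.
pose l1 z := T z + d z / 2; pose l2 z := T z - d z / 2.
have half_d : entire (fun z => d z / 2) by exact (entireM de (@entire_cst R 2^-1)).
have l1e : entire l1 by exact (entireD entire_trace half_d).
have l2e : entire l2 by exact (entireB entire_trace half_d).
have l12 z : l1 z - l2 z = d z by rewrite /l1 /l2; field.
have l12_neq0 z : l1 z - l2 z != 0 by rewrite l12.
have l_sum z : l1 z + l2 z = P z + sharp P z by rewrite /l1 /l2 /T; field.
have l_prod z : l1 z * l2 z = P z * sharp P z + Q z * sharp Q z.
  have -> : l1 z * l2 z = T z ^+ 2 - d z ^+ 2 / 4 by rewrite /l1 /l2; field.
  by rewrite d_sqr /T /Delta; field.
have [C hC] := damped_bounded alpha0 q0 psi_reg I_unit J_unit IJ_perp P_entire Q_entire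
  psi_split l1e l2e l12_neq0 l_sum l_prod p0 B_cond.
exists (2 / alpha * (1 + 2 * alpha / (alpha / 2 - beta)) * C) => z.
have ll : l1 z != l2 z by rewrite -subr_eq0.
(* For fixed z, the bound uniform in w is C e^(alpha |z|^2 / 2). *)
have := @exp_difference_growth R alpha beta (C * expR (alpha / 2 * cmod z ^+ 2)) (Q z) (l1 z) (l2 z) alpha0 b0 ba ll.
rewrite (mulrA _ C) l12.
have -> : (l1 z + l2 z) / 2 = T z by rewrite l_sum.
apply=> w; have := hC z w.
rewrite /damped /kernel_diff mulNr expRN ler_pdivrMl ?expR_gt0 // l12.
by rewrite [leRHS]mulrC.
Qed.

Lemma discriminant_affine (beta : R) : 0 < beta -> beta < alpha / 2 ->
  (exists a0 a1, (forall z, T z = a0 + a1 * z) /\ cmod a1 ^+ 2 <= alpha / (2 * beta)) /\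
  (exists a0 a1, forall z, d z / 2 = a0 + a1 * z).
Proof.
move=> b0 ba; have [C hC] := discriminant_growth b0 ba.
have We : entire (fun z => Q z * d z) by exact (entireM Q_entire de).
have [z1 /eqP Q1] := Q_neq0.
have W1 : Q z1 * d z1 != 0 by rewrite mulf_neq0.
split.
  apply: (growth_affine We W1 alpha0 b0 hC entire_trace) => z.
  by rewrite lerDl sqr_ge0.
have half_d : entire (fun z => d z / 2) by exact (entireM de (@entire_cst R 2^-1)).
have [|a0 [a1 [h _]]] := growth_affine We W1 alpha0 b0 hC half_d; last by exists a0, a1.
by move=> z; rewrite lerDr sqr_ge0.
Qed.

(** The slope a1 does not depend on beta. If x = |a1|^2 exceeded 1, beta = alpha / (1 + x) would be
    admissible and give x <= (1 + x) / 2. *)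
Lemma trace_affine : exists a0 a1, (forall z, T z = a0 + a1 * z) /\ cmod a1 <= 1.
Proof.
have a20 : 0 < alpha / 4 by rewrite divr_gt0.
have [|[a0 [a1 [h _]]] _] := discriminant_affine a20; first by lra.
exists a0, a1; split => //; rewrite leNgt; apply/negP => a1_gt1.
pose x := cmod a1 ^+ 2.
have x1 : 1 < x by rewrite exprn_egt1.
have b0 : 0 < alpha / (1 + x) by rewrite divr_gt0 //; lra.
have b1 : alpha / (1 + x) < alpha / 2 by rewrite ltr_pM2l // ltf_pV2 ?posrE; lra.
have [[c0 [c1 [hc c1_le]]] _] := discriminant_affine b0 b1.
have c0E : c0 = a0 by have := hc 0; rewrite h !mulr0 !addr0.
have c1E : c1 = a1 by have := hc 1; rewrite h !mulr1 c0E => /addrI.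
move: c1_le; rewrite c1E -/x.
have -> : alpha / (2 * (alpha / (1 + x))) = (1 + x) / 2.
  by field; rewrite !gt_eqF //; lra.
by move=> hx; lra.
Qed.

Lemma discriminant_cst z w : d z = d w.
Proof.
have a20 : 0 < alpha / 4 by rewrite divr_gt0.
have [|_ [a0 [a1 h]]] := discriminant_affine a20; first by lra.
have dE u : d u = 2 * (a0 + a1 * u) by rewrite -h; field.
have [a10|a10] := eqVneq a1 0; first by rewrite !dE a10 !mul0r.
have := d_neq0 (- a0 / a1); rewrite dE.
by have -> : 2 * (a0 + a1 * (- a0 / a1)) = 0 by [field]; rewrite eqxx.
Qed.

End Growth.

(** Writing Q = c e^g, the hypothesis says e^(g + g#) = 1. Hence g + g# has zero derivative and is
    constant; at 0 its value is real, so it is 0, and l = - i g satisfies l# = l. *)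
Lemma entire_log_unitary Q (c : R) : entire Q -> 0 < c ->
  (forall z, Q z * sharp Q z = (c ^+ 2)%:C) ->
  exists l : R[i] -> R[i], [/\ entire l, sharp l = l & forall z, Q z = c%:C * cexp ('i * l z)].
Proof.
move=> Qe c0 hQ.
have cC0 : c%:C != 0 :> R[i] by rewrite fmorph_eq0 gt_eqF.
have Q0 z : Q z / c%:C != 0.
  rewrite mulf_neq0 ?invr_eq0 //; apply/eqP => h; have := hQ z; rewrite h mul0r => /esym/eqP.
  by rewrite fmorph_eq0 expf_eq0 /= gt_eqF.
have [g ge hg] := entire_log (entireM Qe (@entire_cst R c%:C^-1)) Q0.
have QE z : Q z = c%:C * cexp (g z) by rewrite -hg mulrC divfK.
pose u z := g z + sharp g z.
have ue : entire u by exact (entireD ge (entire_sharp ge)).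
have hu z : cexp (u z) = 1.
  rewrite /u cexpD; have -> : cexp (sharp g z) = sharp Q z / c%:C.
    have cM y : conjc (c%:C * y) = c%:C * conjc y :> R[i].
      by case: y => y y'; apply: complex_eq => /=; ring.
    by rewrite /sharp cexp_conj QE cM [RHS]mulrC mulKf.
  have -> : cexp (g z) = Q z / c%:C by [].
  by rewrite mulrACA hQ rmorphXn /= -invfM -expr2 mulfV // expf_neq0.
have [u' _ hu'] := entire_derivative ue.
have u'0 z : u' z = 0.
  have h := cder_comp (hu' z) (cder_cexp (u z)).
  have h1 : cder (fun=> 1) z (cexp (u z) * u' z).
    by apply: (cder_eq ltr01 _ h) => w _; rewrite hu.
  by have := cder_uniq h1 (cder_cst _ _); rewrite hu mul1r.
have u_cst z : u z = u 0 by apply: cder0_cst => w; rewrite -(u'0 w).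
have u00 : u 0 = 0.
  apply: cexp_eq1 (hu 0).
  have -> : complex.Im (u 0) = 0.
    by rewrite /u /sharp conjc0 cImD cIm_conj subrr.
  by rewrite normr0 pi_ge0.
have uz z : g z + sharp g z = 0 by rewrite -/(u z) u_cst.
exists (fun z => - 'i * g z); split => /=.
- exact (entireM (@entire_cst R (- 'i)) ge).
- apply: funext => z.
  have -> : sharp (fun z => - 'i * g z) z = 'i * sharp g z.
    rewrite /sharp; case: (g _) => x y; apply: complex_eq => /=; ring.
  have -> : sharp g z = - g z by apply/eqP; rewrite -addr_eq0 addrC uz.
  by ring.
- move=> z; have -> : 'i * (- 'i * g z) = g z by rewrite mulrA mulrN -expr2 sqr_i opprK mul1r.
  exact: QE.
Qed.

End Rigidity.

Theorem corollary3p4 (R : realType) (alpha p q : R)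
    (psi : quat R -> quat R) (I J : quat R) (P Q : R[i] -> R[i])
    (alpha_gt0 : 0 < alpha) (p_gt0 : 0 < p) (q_gt0 : 0 < q)
    (psi_reg : slice_regular psi)
    (I_unit : imag_units I) (J_unit : imag_units J) (IJ_perp : perp J I)
    (P_entire : entire P) (Q_entire : entire Q)
    (psi_split : forall z : R[i],
       psi (emb I z) = emb I (P z) + emb I (Q z) * J)
    (Q_neq0 : exists z : R[i], Q z <> 0)
    (B_cond :
       (ereal_sup [set calB alpha q psi I w | w in slice I] < +oo)%E \/
       (q < p /\
        (slice_integral I
           (fun w => poweR (calB alpha q psi I w) (p / (p - q))) < +oo)%E))
    (Delta_neq0 : forall z : R[i], Delta P Q z <> 0) :
  exists (a b c : R) (h : R[i] -> R[i]),
    [/\ 0 < c, entire h & sharp h = h] /\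
    [/\ forall z : R[i], P z = a%:C * z + b%:C + 'i * h z,
        forall z : R[i], Q z * sharp Q z = (c ^+ 2)%:C - h z ^+ 2
      & `|a| <= 1] /\
    (forall z : R[i],
       psi (emb I z) = emb I (a%:C * z + b%:C + 'i * h z) + emb I (Q z) * J) /\
    (sharp P = P ->
       [/\ forall z : R[i], h z = 0,
           forall z : R[i], Q z * sharp Q z = (c ^+ 2)%:C
         & exists l : R[i] -> R[i],
             [/\ entire l, sharp l = l
               & forall z : R[i], Q z = c%:C * cexp ('i * l z)]]).
Proof.
have P'e := entire_sharp P_entire.
have De : entire (Delta P Q).
  exact (entireB (entireX (n:=2) (entireB P_entire P'e))
    (entireM (@entire_cst R 4) (entireM Q_entire (entire_sharp Q_entire)))).
have D0 z : Delta P Q z != 0 by apply/eqP.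
have [d de d_sqr] := entire_sqrt De D0.
have d_neq0 z : d z != 0 by have := D0 z; rewrite -d_sqr sqrf_eq0.
have [a0 [a1 [TE a1_le]]] := trace_affine alpha_gt0 p_gt0 q_gt0 psi_reg I_unit J_unit IJ_perp
  P_entire Q_entire psi_split Q_neq0 B_cond de d_neq0 d_sqr.
have DE z : Delta P Q z = Delta P Q 0.
  rewrite -!d_sqr (discriminant_cst alpha_gt0 p_gt0 q_gt0 psi_reg I_unit J_unit IJ_perp
    P_entire Q_entire psi_split Q_neq0 B_cond de d_neq0 d_sqr z 0) //.
have PPJ z : conjc (P z) = sharp P (conjc z) by rewrite /sharp conjcK.
(* The trace commutes with conjugation: its values at 0 and 1 are real, hence so are a0 and a1. *)
have TJ z : conjc ((P z + sharp P z) / 2) = (P (conjc z) + sharp P (conjc z)) / 2.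
  rewrite {1}/sharp /sharp conjcK; case: (P z) => x y; case: (P (conjc z)) => x' y'.
  by apply: complex_eq => /=; field.
have a0E : a0 = (complex.Re a0)%:C.
  by apply: conjc_id_real; have := TJ 0; rewrite conjc0 !TE !mulr0 !addr0.
have a1E : a1 = (complex.Re a1)%:C.
  have := congr1 (@complex.Im R) (TJ 1); rewrite conjc1 !TE !mulr1 cIm_conj !cImD a0E /= => h.
  by apply: complex_eq => //=; move: h; move: (complex.Im _) => y; lra.
(* At the real point 0, P - P# = 2 i Im P and Q Q# = |Q|^2, so Delta = - 4 y with y >= 0; the
   absence of zeros makes y positive, and c is its square root. *)
pose y := complex.Im (P 0) ^+ 2 + cmod (Q 0) ^+ 2.
have DyE : Delta P Q 0 = - 4 * y%:C.
  rewrite /Delta /sharp conjc0 mul_conjc /y; case: (P 0) => u v.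
  by apply: complex_eq => /=; rewrite ?expr2 /=; ring.
have y0 : 0 < y.
  rewrite lt_neqAle addr_ge0 ?sqr_ge0 // andbT eq_sym; apply/eqP => yE.
  by have := D0 0; rewrite DyE yE mulr0 eqxx.
pose c := Num.sqrt y.
have c0 : 0 < c by rewrite sqrtr_gt0.
have cE : c ^+ 2 = y by rewrite sqr_sqrtr // ltW.
(* The factor - i / 2 turns P - P#, which the sharp operation negates, into a function fixed by it;
   then Delta = - 4 h^2 - 4 Q Q# = - 4 c^2. *)
pose h z := - 'i / 2 * (P z - sharp P z).
have i2 : 'i * 'i = -1 :> R[i] by rewrite -expr2 sqr_i.
have he : entire h by exact (entireM (@entire_cst R (- 'i / 2)) (entireB P_entire P'e)).
have h_sharp : sharp h = h.
  apply: funext => z; rewrite /h /sharp !conjcK.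
  case: (P z) => u v; case: (P (conjc z)) => u' v'.
  by apply: complex_eq => /=; field.
have PE z : P z = (complex.Re a1)%:C * z + (complex.Re a0)%:C + 'i * h z.
  rewrite -a0E -a1E [X in X + _]addrC -TE.
  have -> : 'i * h z = - ('i * 'i) * (P z - sharp P z) / 2 by rewrite /h; field.
  by rewrite i2; field.
have QE z : Q z * sharp Q z = (c ^+ 2)%:C - h z ^+ 2.
  have -> : h z ^+ 2 = ('i * 'i) * (P z - sharp P z) ^+ 2 / 4 by rewrite /h; field.
  rewrite i2 cE; have -> : y%:C = - Delta P Q z / 4 by rewrite DE DyE; field.
  by rewrite /Delta; field.
exists (complex.Re a1), (complex.Re a0), c, h; split; first by [].
split; first by split => //; exact: le_trans (Re_le_cmod a1) a1_le.
split => [z|PP]; first by rewrite -PE.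
have h0 z : h z = 0 by rewrite /h PP subrr mulr0.
have QE' z : Q z * sharp Q z = (c ^+ 2)%:C by rewrite QE h0 expr0n subr0.
by split => //; exact: entire_log_unitary.
Qed.
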